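(* Let $N>1$, $s\in(0,1)$, $p\in(1,\infty)$, and let $\Omega\subset\mathbb R^N$ be a bounded domain with $C^{1,1}$ boundary. There exist $\alpha\in(0,s]$ depending only on $N,p,s$, and $C_\Omega>0$ depending only on $N,p,s,\Omega$, such that for every $f\in L^\infty(\Omega)$ and every weak solution $u\in W^{s,p}_0(\Omega)$ of $$(-\Delta)^s_p u=f \ \text{in } \Omega,\qquad u=0 \ \text{in } \Omega^c,$$ one has $u\in C^\alpha(\overline\Omega)$ and $$\|u\|_{C^\alpha(\overline\Omega)}\le C_\Omega\,\|f\|_{L^\infty(\Omega)}^{\frac{1}{p-1}}.$$
   Context: Notation: for $a\in\mathbb R$, $q>0$, $a^{q}:=|a|^{q-1}a$. $\Omega^c=\mathbb R^N\setminus\Omega$. $W^{s,p}_0(\Omega)=\{u\in L^p(\mathbb R^N): \int_{\mathbb R^N\times\mathbb R^N}\frac{|u(x)-u(y)|^p}{|x-y|^{N+ps}}dx\,dy<\infty,\ u=0\text{ a.e. in }\Omega^c\}$. A weak solution $u\in W^{s,p}_0(\Omega)$ of the Dirichlet problem means: for every $\varphi\in W^{s,p}_0(\Omega)$, $$\int_{\mathbb R^N\times\mathbb R^N}\frac{(u(x)-u(y))^{p-1}(\varphi(x)-\varphi(y))}{|x-y|^{N+ps}}\,dx\,dy=\int_\Omega f\varphi\,dx.$$ $C^\alpha(\overline\Omega)$ is the space of continuous functions on $\overline\Omega$ with finite $[u]_{C^\alpha(\overline\Omega)}=\sup_{x\ne y\in\overline\Omega}|u(x)-u(y)|/|x-y|^\alpha$,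 normed by $\|u\|_{L^\infty(\Omega)}+[u]_{C^\alpha(\overline\Omega)}$ (the conclusion means $u$ has such a representative). *)

(* Defs.v *)
From HB Require Import structures.
From mathcomp Require Import all_boot all_order all_algebra.
From mathcomp Require Import all_classical all_reals all_analysis.
Set Implicit Arguments. Unset Strict Implicit. Unset Printing Implicit Defensive.
Import Order.TTheory GRing.Theory Num.Theory.
Import numFieldNormedType.Exports.
Local Open Scope classical_set_scope.
Local Open Scope ring_scope.

Section Defs.
Variable R : realType.

Definition enorm {N : nat} (x : 'rV[R]_N) : R :=
  Num.sqrt (\sum_(i < N) (x ord0 i) ^+ 2).

Definition spow (q a : R) : R := (`|a| `^ (q - 1)) * a.

Definition orthogonal_mx {N : nat} (Q : 'M[R]_N) : Prop := Q *m Q^T = 1%:M.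

Definition C11_fun {N : nat} (g : 'rV[R]_N -> R^o) : Prop :=
  (forall x, differentiable g x) /\
  exists L : R, forall x y v : 'rV[R]_N,
    `| 'd g x v - 'd g y v | <= L * enorm (x - y) * enorm v.

Definition bounded_domain {N : nat} (O : set 'rV[R]_N) : Prop :=
  open O /\ connected O /\ O !=set0 /\
  exists M : R, forall x, O x -> enorm x <= M.

(* C^{1,1} boundary: near each boundary point, after an orthogonal change of
   coordinates, O is the strict epigraph of a C^{1,1} function of the
   remaining N-1 coordinates (the distinguished coordinate is k). *)
Definition C11_boundary {N : nat} (O : set 'rV[R]_N) : Prop :=
  forall x0, (closure O `\` O) x0 ->
  exists (r : R) (k : 'I_N) (Q : 'M[R]_N) (g : 'rV[R]_N -> R^o),
    0 < r /\ orthogonal_mx Q /\ C11_fun g /\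
    forall x, enorm (x - x0) < r ->
      (O x <-> let y := (x - x0) *m Q in
               g (y - (y ord0 k) *: delta_mx ord0 k) < y ord0 k).


End Defs.

Definition BorelRN (R : realType) (N : nat) :=
  g_sigma_algebraType (@open 'rV[R]_N).

Section MeasureDefs.
Variables (R : realType) (N : nat).
Local Notation T := (BorelRN R N).
Variable mu : {sigma_finite_measure set T -> \bar R}.

(* mu is N-dimensional Lebesgue measure: it gives closed boxes their volume
   (this determines a sigma-finite Borel measure uniquely) *)
Definition lebesgue_on_boxes : Prop :=
  forall a b : 'rV[R]_N, (forall i, a ord0 i <= b ord0 i) ->
    mu [set x : T | forall i, a ord0 i <= x ord0 i <= b ord0 i] =
    (\prod_(i < N) (b ord0 i - a ord0 i))%:E.

Definition kernel (p s : R) (x y : 'rV[R]_N) : R :=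
  enorm (x - y) `^ (N%:R + p * s).

Definition W0 (p s : R) (O : set 'rV[R]_N) (u : 'rV[R]_N -> R) : Prop :=
  measurable_fun [set: T] (u : T -> R) /\
  (\int[mu]_x (`|u x| `^ p)%:E < +oo)%E /\
  (\int[(mu \x mu)%E]_z ((`|u z.1 - u z.2| `^ p) / kernel p s z.1 z.2)%:E
     < +oo)%E /\
  {ae mu, forall x : T, ~ O x -> u x = 0}.

Definition weak_solution (p s : R) (O : set 'rV[R]_N)
    (f u : 'rV[R]_N -> R) : Prop :=
  W0 p s O u /\
  forall phi : 'rV[R]_N -> R, W0 p s O phi ->
    (\int[mu \x mu]_z
       (spow (p - 1) (u z.1 - u z.2) * (phi z.1 - phi z.2) / kernel p s z.1 z.2)%:E
    = \int[mu]_(x in (O : set T)) (f x * phi x)%:E)%E.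

Definition Linf (O : set 'rV[R]_N) (f : 'rV[R]_N -> R) : Prop :=
  measurable_fun (O : set T) (f : T -> R) /\
  exists M : R, {ae mu, forall x : T, O x -> `|f x| <= M}.

Definition Linf_norm (O : set 'rV[R]_N) (f : 'rV[R]_N -> R) : R :=
  inf [set M : R | 0 <= M /\ {ae mu, forall x : T, O x -> `|f x| <= M}].

End MeasureDefs.

(* Main.v *)
(* De Giorgi's method, run up to the boundary.  At a boundary point of a C^{1,1} domain,
   the complement contains at all small scales a cube whose relative size depends on N
   only; since u vanishes there, truncations of u are admissible test functions and the
   argument is the same as in the interior, with an exponent independent of the domain.

   The nonlocality makes the two ingredients elementary.  If w >= 0 in a cube Q of size r
   and w >= D/2 on a fixed fraction of Q, testing with (d phi - w)_+ for a tent phi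
   produces, besides a Caccioppoli bound, the interaction of the level set {w < d phi}
   with {w >= D/2}; this forces the level set to have relative measure O((d/D)^(p-1)).
   The interaction of a level set S with its own complement controls |S|^(-sp/N) times
   the L^p norm of the truncation, and the usual iteration gives w >= d/4 in a smaller
   cube.  Hence the oscillation of u contracts by a fixed factor from one scale to the
   next, the tails being carried along as bounds with slow polynomial growth.

   The global bound follows by testing with min((u - k)_+, 1): on a cube outside the
   domain u = 0, so the nonlocal term is at least c k^(p-1) times the integral of the
   test function, which is impossible if c k^(p-1) exceeds the bound on f. *)
Require Import Defs.
From HB Require Import structures.
From mathcomp Require Import all_boot all_order all_algebra.
From mathcomp Require Import all_classical all_reals all_analysis.
From mathcomp Require Import measurable_realfun ring lra.
Set Implicit Arguments. Unset Strict Implicit. Unset Printing Implicit Defensive.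
Import Order.TTheory GRing.Theory Num.Theory.
Import numFieldNormedType.Exports.
Local Open Scope classical_set_scope.
Local Open Scope ring_scope.

(** * Norms, cubes and measurability *)

(** Two constraints shape the argument. A test function must vanish off [O], so a truncation of [w]
    is admissible only if [w] already exceeds the truncation level on the exterior; near the
    boundary this may hold for only one of [u - a] and [b - u], and the step between scales works
    because it is the same one that is known to be large on a fixed fraction of the cube. Secondly,
    the exponent must not see [O]: the contraction factor [8^(-alpha)] depends on [N], [p], [s]
    through the relative size [1 / (8 N^2)] of exterior cubes, while the domain enters only through
    the scale below which such cubes exist and through a cube containing it. The bound [alpha <= s]
    keeps the source term under control: from one scale to the next [(b - a)^(p-1) r^(-ps)] is
    multiplied by [8^(ps - alpha (p-1)) >= 1], so smallness of [f] at the first scale persists.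
    Cubes are the closed balls of the norm on ['rV[R]_N]; since [mu] is normalised on boxes, their
    measure is exactly [(2r)^N], and the Euclidean norm in the kernel costs only factors of [N]. *)

Section Norms.
Context {R : realType} {N : nat}.
Implicit Types x y : 'rV[R]_N.

Lemma rvnorm_le x r : 0 <= r -> (`|x| <= r) <-> (forall i, `|x ord0 i| <= r).
Proof.
move=> r0; rewrite [X in X <= _]mx_normrE; split.
  move=> h i; apply: le_trans h.
  by apply: (le_trans _ (le_bigmax _ (fun ij => `|x ij.1 ij.2|) (ord0, i))).
move=> h; apply: bigmax_le => // -[i j] _ /=.
by rewrite (ord1 i).
Qed.

Lemma rvcoord_le x i : `|x ord0 i| <= `|x|.
Proof. by move: i; apply/rvnorm_le. Qed.

Lemma enorm_ge0 x : 0 <= enorm x. Proof. exact: sqrtr_ge0. Qed.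

Lemma enorm_ge x : `|x| <= enorm x.
Proof.
apply/rvnorm_le; first exact: enorm_ge0.
move=> i; rewrite -sqrtr_sqr /enorm; apply: ler_wsqrtr.
by rewrite (bigD1 i)//= lerDl sumr_ge0// => j _; exact: sqr_ge0.
Qed.

Lemma enorm_le x : enorm x <= N%:R * `|x|.
Proof.
rewrite -[leRHS]ger0_norm ?mulr_ge0// -sqrtr_sqr /enorm; apply: ler_wsqrtr.
apply: (@le_trans _ _ (\sum_(i < N) `|x| ^+ 2)).
  by apply: ler_sum => i _; rewrite -real_normK ?num_real// lerXn2r ?nnegrE ?rvcoord_le.
rewrite sumr_const card_ord exprMn -[leLHS]mulr_natl.
apply: ler_wpM2r; first exact: sqr_ge0.
by rewrite -natrX ler_nat; case: (N) => // n; rewrite -mulnn leq_pmull.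
Qed.

Lemma enormN x : enorm (- x) = enorm x.
Proof. by rewrite /enorm; under eq_bigr do rewrite mxE sqrrN. Qed.

Lemma enormB x y : enorm (x - y) = enorm (y - x).
Proof. by rewrite -enormN opprB. Qed.

End Norms.

Section Measurability.
Context {R : realType} {N : nat}.
Local Notation T := (BorelRN R N).

Lemma open_measurable_rV (A : set 'rV[R]_N) : open A -> measurable (A : set T).
Proof. by move=> oA; apply: sub_sigma_algebra. Qed.

Lemma continuous_measurable_rV (f : 'rV[R]_N -> R) :
  continuous f -> measurable_fun [set: T] (f : T -> R).
Proof.
move=> cf; apply: (measurability _ (RGenOpens.measurableE R)).
move=> _ [_ [a [b ->] <-]]; rewrite setTI; apply: open_measurable_rV.
by move/continuousP: cf; apply; apply: interval_open.
Qed.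

Lemma measurable_dist (x : 'rV[R]_N) :
  measurable_fun [set: T] (fun y : T => `|(y : 'rV[R]_N) - x|).
Proof.
apply: continuous_measurable_rV => y.
have h : {for y, continuous (fun y : 'rV[R]_N => y - x)}.
  by apply: continuousB; [exact: cvg_id|exact: cst_continuous].
have h2 := continuous_comp h (@norm_continuous _ _ (y - x)).
exact: h2.
Qed.

Lemma measurable_coord (i : 'I_N) :
  measurable_fun [set: T] (fun y : T => (y : 'rV[R]_N) ord0 i).
Proof. by apply: continuous_measurable_rV; exact: coord_continuous. Qed.

(** The reciprocal of [kernel], written as a power. For a nonzero exponent it is [0] on the
    diagonal, by the convention for powers of [0]; lower bounds therefore require [x != y]. *)
Definition gker (p s : R) (x y : 'rV[R]_N) : R :=
  enorm (x - y) `^ (- (N%:R + p * s)).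

Lemma gkerE (p s : R) x y : gker p s x y = (Defs.kernel p s x y)^-1.
Proof. by rewrite /gker powRN. Qed.

Lemma gker_ge0 (p s : R) x y : 0 <= gker p s x y.
Proof. exact: powR_ge0. Qed.

Lemma gkerC (p s : R) x y : gker p s x y = gker p s y x.
Proof. by rewrite /gker enormB. Qed.

Lemma measurable_gker (p s : R) :
  measurable_fun [set: T * T] (fun z : T * T => gker p s z.1 z.2).
Proof.
apply: (measurableT_comp (measurable_powR _)).
apply: (measurableT_comp (continuous_measurable_fun (@sqrt_continuous R))).
apply: measurable_sum => i.
under eq_fun do rewrite mxE mxE.
apply: measurable_funX; apply: measurable_funB.
  by apply: (measurableT_comp (measurable_coord i)); exact: measurable_fst.
by apply: (measurableT_comp (measurable_coord i)); exact: measurable_snd.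
Qed.

Lemma gker_le (p s : R) x y : 0 <= N%:R + p * s ->
  gker p s x y <= `|y - x| `^ (- (N%:R + p * s)).
Proof.
move=> a0; have [->|xy] := eqVneq x y.
  rewrite /gker subrr normr0.
  suff -> : enorm (0 : 'rV[R]_N) = 0 by [].
  by apply/eqP; rewrite eq_le enorm_ge0 (le_trans (enorm_le _))// normr0 mulr0.
have d0 : 0 < `|y - x| by rewrite normr_gt0 subr_eq0 eq_sym.
rewrite /gker !powRN lef_pV2 ?posrE ?powR_gt0//.
  by rewrite ge0_ler_powR ?nnegrE ?enorm_ge0// enormB enorm_ge.
by rewrite enormB (lt_le_trans d0)// enorm_ge.
Qed.

Lemma gker_ge (p s : R) x y r : 0 <= N%:R + p * s -> 0 < r -> x != y ->
  `|y - x| <= r -> (N%:R * r) `^ (- (N%:R + p * s)) <= gker p s x y.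
Proof.
move=> a0 r0 xy xyr.
have d0 : 0 < `|y - x| by rewrite normr_gt0 subr_eq0 eq_sym.
have e0 : 0 < enorm (x - y) by rewrite enormB (lt_le_trans d0)// enorm_ge.
have e1 : enorm (x - y) <= N%:R * r.
  by rewrite enormB (le_trans (enorm_le _))// ler_wpM2l.
have N0 : 0 < N%:R * r by rewrite (lt_le_trans e0).
rewrite /gker !powRN lef_pV2 ?posrE ?powR_gt0//.
by rewrite ge0_ler_powR ?nnegrE ?enorm_ge0// ltW.
Qed.

End Measurability.

Lemma pow_bracket {R : archiRealFieldType} (b : nat) (t : R) : (1 < b)%N -> 1 <= t ->
  exists k, b%:R ^+ k <= t < b%:R ^+ k.+1.
Proof.
move=> b1 t1.
have ex : exists k, t < b%:R ^+ k.+1.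
  exists (Num.bound t); apply: (lt_trans (archi_boundP (le_trans ler01 t1))).
  by rewrite -natrX ltr_nat (ltn_trans (ltn_expl _ b1))// ltn_exp2l.
exists (ex_minn ex); case: ex_minnP => -[|k] -> mk; first by rewrite expr0 t1.
rewrite andbT leNgt; apply/negP => h.
by have := mk _ h; rewrite ltnn.
Qed.

Lemma powR_exprn {R : realType} (a b : R) (k : nat) : 0 <= a ->
  (a ^+ k) `^ b = (a `^ b) ^+ k.
Proof.
by move=> a0; rewrite -(powR_mulrn k a0) -(powR_mulrn k (powR_ge0 a b)) powRAC.
Qed.

(** The integrand is dominated by the series of [c k] times the indicator of [Q k]. The sets may
    overlap, so full cubes can stand in for dyadic annuli. *)
Lemma integral_le_geometric {R : realType} d (T : measurableType d)
    (mu : {measure set T -> \bar R}) (D : set T) (f : T -> R)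
    (Q : nat -> set T) (c : nat -> R) (A w : R) :
  measurable D -> measurable_fun D f -> (forall y, D y -> 0 <= f y) ->
  (forall k, measurable (Q k)) -> (forall k, 0 <= c k) ->
  (forall y, D y -> exists k, Q k y /\ f y <= c k) ->
  0 <= A -> 0 <= w < 1 ->
  (forall k, ((c k)%:E * mu (Q k) <= (A * w ^+ k)%:E)%E) ->
  (\int[mu]_(y in D) (f y)%:E <= (A / (1 - w))%:E)%E.
Proof.
move=> mD mf f0 mQ c0 fQ A0 /andP[w0 w1] cQ.
have mt k : measurable_fun D (fun y => (c k * \1_(Q k) y)%:E).
  apply/measurable_EFinP; apply: measurable_funM => //; exact: measurable_indic.
have t0 k y : D y -> (0 <= (c k * \1_(Q k) y)%:E)%E.
  by move=> _; rewrite lee_fin mulr_ge0.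
apply: (@le_trans _ _ (\int[mu]_(y in D) \sum_(0 <= k <oo) (c k * \1_(Q k) y)%:E)%E).
  apply: ge0_le_integral => //.
  - exact/measurable_EFinP.
  - apply: (@ge0_emeasurable_sum _ _ _ D (fun k y => (c k * \1_(Q k) y)%:E) xpredT).
      by move=> k y Dy _; exact: t0.
    by move=> k _; exact: mt.
  - move=> y Dy; have [k [Qk fk]] := fQ _ Dy.
    apply: (@le_trans _ _ (\sum_(0 <= i < k.+1) (c i * \1_(Q i) y)%:E)%E).
      rewrite big_nat_recr//= (le_trans _ (leeDr _ _))//.
        by rewrite lee_fin indicE mem_set// mulr1.
      by apply: sume_ge0 => i _; apply: t0.
    by apply: nneseries_lim_ge => i _ _; apply: t0.
rewrite integral_nneseries//.
apply: (@le_trans _ _ (\sum_(0 <= k <oo) (A * w ^+ k)%:E)%E).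
  apply: lee_nneseries => k _; first by move=> _; apply: integral_ge0 => y Dy; exact: t0.
  apply: (le_trans _ (cQ k)).
  under eq_integral do rewrite EFinM.
  rewrite ge0_integralZl_EFin//; first last.
  - by apply/measurable_EFinP; exact: measurable_indic.
  rewrite integral_indic// lee_wpmul2l ?lee_fin// le_measure ?inE//.
  by apply: measurableI.
apply: lime_le.
  by apply: is_cvg_nneseries => k _ _; rewrite lee_fin mulr_ge0// exprn_ge0.
apply: nearW => n; rewrite sumEFin lee_fin -mulr_sumr ler_wpM2l//.
rewrite -[leRHS]mul1r -(@ler_pM2r _ (1 - w)) ?subr_gt0// -mulrA mulVf ?mulr1; last first.
  by rewrite subr_eq0 eq_sym lt_eqF.
have -> : (\sum_(0 <= i < n) w ^+ i) * (1 - w) = 1 - w ^+ n.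
  by rewrite -[1 - w ^+ n]opprB subrX1 big_mkord -mulNr opprB mulrC.
by rewrite lerBlDr lerDl exprn_ge0.
Qed.

Section Cubes.
Context {R : realType} {N : nat}.
Local Notation T := (BorelRN R N).

Definition cube (x : 'rV[R]_N) (r : R) : set T :=
  [set y : 'rV[R]_N | `|y - x| <= r].

Lemma cubeE x r : 0 <= r ->
  cube x r = [set y : 'rV[R]_N | forall i,
    (x - const_mx r) ord0 i <= y ord0 i <= (x + const_mx r) ord0 i].
Proof.
move=> r0; apply/seteqP; split => y /=.
  move/rvnorm_le => /(_ r0) h i; have := h i.
  by rewrite !mxE ler_norml; lra.
move=> h; apply/rvnorm_le => // i; have := h i.
by rewrite !mxE ler_norml; lra.
Qed.

Lemma measurable_cube x r : measurable (cube x r).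
Proof.
rewrite [X in measurable X](_ : _ = [set: T] `&` (fun y : T => `|(y : 'rV[R]_N) - x|) @^-1` [set` `]-oo, r]]).
  by apply: measurable_dist => //; exact: measurable_itv.
by rewrite setTI; apply/seteqP; split => y /=; rewrite in_itv.
Qed.

Variable mu : {sigma_finite_measure set T -> \bar R}.
Hypothesis hmu : lebesgue_on_boxes mu.

Lemma mu_cube x r : 0 <= r -> mu (cube x r) = ((2 * r) ^+ N)%:E.
Proof.
move=> r0; rewrite cubeE// hmu => [|i]; last by rewrite !mxE; lra.
congr EFin; rewrite (eq_bigr (fun=> 2 * r)) ?prodr_const ?card_ord// => i _.
by rewrite !mxE; lra.
Qed.

Lemma mu_cube_lty x r : (mu (cube x r) < +oo)%E.
Proof.
have [r0|r0] := leP 0 r; first by rewrite mu_cube// ltry.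
have -> : cube x r = set0; last by rewrite measure0 ltry.
apply/seteqP; split => // y /= h.
by have := lt_le_trans r0 (le_trans (normr_ge0 _) h); rewrite ltxx.
Qed.

Lemma near_integral (b : R) : 0 < b -> exists C, 0 < C /\ forall x r, 0 < r ->
  (\int[mu]_(y in cube x r) (`|(y : 'rV[R]_N) - x| `^ (b - N%:R))%:E <= (C * r `^ b)%:E)%E.
Proof.
move=> b0; have w0 : 0 < 2^-1 `^ b :> R by rewrite powR_gt0.
have w1 : 2^-1 `^ b < 1 :> R.
  have one : 1 `^ b = 1 :> R by rewrite powR1.
  by rewrite -[ltRHS]one gt0_ltr_powR// ?nnegrE//; lra.
exists (2 `^ `|b - N%:R| * 2 ^+ N / (1 - 2^-1 `^ b)); split.
  by rewrite divr_gt0// ?subr_gt0// mulr_gt0 ?powR_gt0.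
move=> x r r0; rewrite -mulrA mulrAC mulrA.
pose rk k : R := 2^-1 ^+ k * r.
have rk0 k : 0 < rk k by rewrite mulr_gt0// exprn_gt0.
apply: (@integral_le_geometric _ _ _ _ _ _ (fun k => cube x (rk k))
  (fun k => 2 `^ `|b - N%:R| * rk k `^ (b - N%:R))).
- exact: measurable_cube.
- apply: measurable_funTS; apply: (measurableT_comp (measurable_powR _)).
  exact: measurable_dist.
- by move=> y _; exact: powR_ge0.
- by move=> k; exact: measurable_cube.
- by move=> k; rewrite mulr_ge0 ?powR_ge0.
- move=> y; rewrite /cube/= => yr.
  (* At the centre the integrand is [0], or [1] when [b = N], by the convention for powers of [0];
     the cube [k = 0] covers it. *)
  have [d0|d0] := eqVneq `|y - x| 0.
    exists 0%N; rewrite /rk expr0 mul1r; split => //.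
    have [e|e] := eqVneq (b - N%:R) 0; last by rewrite d0 powR0// mulr_ge0 ?powR_ge0.
    by rewrite e normr0 !powRr0 mulr1.
  have {}d0 : 0 < `|y - x| by rewrite lt_neqAle eq_sym d0 normr_ge0.
  have [k /andP[k1 k2]] : exists k, 2 ^+ k <= r / `|y - x| < 2 ^+ k.+1.
    by apply: (@pow_bracket _ 2) => //; rewrite ler_pdivlMr// mul1r.
  have d1 : `|y - x| <= rk k.
    rewrite /rk exprVn mulrC ler_pdivlMr ?exprn_gt0// mulrC.
    by move: k1; rewrite ler_pdivlMr.
  have d2 : 2^-1 * rk k <= `|y - x|.
    rewrite /rk mulrA -exprS exprVn mulrC ler_pdivrMr ?exprn_gt0// mulrC.
    by move: k2; rewrite ltr_pdivrMr// => /ltW.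
  (* On the shell between [rk k / 2] and [rk k], the sign of the exponent decides which radius gives
     the larger value; the factor [2^|b - N|] serves both cases. *)
  exists k; split => //; have [e|e] := leP 0 (b - N%:R).
    rewrite (@le_trans _ _ (rk k `^ (b - N%:R)))//.
      by rewrite ge0_ler_powR ?nnegrE// ltW.
    rewrite ler_peMl ?powR_ge0//.
    by rewrite -[leLHS](powRr0 2) ler_powR// ler1n.
  rewrite ltr0_norm// powRN -powR_inv1// powRAC powR_inv1//.
  rewrite -powRM ?(ltW (rk0 _))//.
  have := @ge0_ler_powR R (- (b - N%:R)).
  rewrite oppr_ge0 => /(_ (ltW e)) h.
  have {}h := h (2^-1 * rk k) `|y - x|.
  rewrite -[b - N%:R]opprK !(powRN _ (- _)) lef_pV2 ?posrE ?powR_gt0 ?mulr_gt0//.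
  by apply: h => //; rewrite nnegrE// mulr_ge0// ltW.
- by rewrite !mulr_ge0 ?powR_ge0// exprn_ge0.
- by rewrite ltW.
- move=> k /=; rewrite mu_cube ?(ltW (rk0 _))// -EFinM lee_fin.
  have rkb : rk k `^ b = r `^ b * (2^-1 `^ b) ^+ k.
    rewrite powRM ?exprn_ge0 ?(ltW r0)// mulrC; congr (_ * _).
    by rewrite powR_exprn.
  rewrite powRB ?(gt_eqF (rk0 _)) ?implybT// powR_mulrn ?(ltW (rk0 _))//.
  rewrite rkb (exprMn N _ (rk k)) le_eqVlt; apply/orP; left; apply/eqP.
  have : rk k ^+ N != 0 by rewrite expf_neq0// gt_eqF.
  move: (rk k ^+ N) (2 ^+ N) (2 `^ _) (r `^ b) (_ ^+ k) => a1 a2 a3 a4 a5 a10.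
  by field.
Qed.

Lemma far_integral (b : R) : 0 < b -> exists C, 0 < C /\ forall x r, 0 < r ->
  (\int[mu]_(y in ~` cube x r) (`|(y : 'rV[R]_N) - x| `^ (- (N%:R + b)))%:E
     <= (C * r `^ (- b))%:E)%E.
Proof.
move=> b0; have w0 : 0 < 2 `^ (- b) :> R by rewrite powR_gt0.
have w1 : 2 `^ (- b) < 1 :> R.
  rewrite powRN invf_lt1 ?powR_gt0//.
  have one : 1 `^ b = 1 :> R by rewrite powR1.
  by rewrite -[ltLHS]one gt0_ltr_powR// ?nnegrE//; lra.
(* The shell number [k] is enclosed in the cube of radius [rk k.+1], whose measure is
   [(2 rk k.+1)^N = 4^N (rk k)^N]. *)
exists (4 ^+ N / (1 - 2 `^ (- b))); split.
  by rewrite divr_gt0// subr_gt0.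
move=> x r r0; rewrite mulrAC.
pose rk k : R := 2 ^+ k * r.
have rk0 k : 0 < rk k by rewrite mulr_gt0// exprn_gt0.
apply: (@integral_le_geometric _ _ _ _ _ _ (fun k => cube x (rk k.+1))
  (fun k => rk k `^ (- (N%:R + b)))).
- by apply: measurableC; exact: measurable_cube.
- apply: measurable_funTS; apply: (measurableT_comp (measurable_powR _)).
  exact: measurable_dist.
- by move=> y _; exact: powR_ge0.
- by move=> k; exact: measurable_cube.
- by move=> k; rewrite powR_ge0.
- move=> y; rewrite /cube/= => /negP; rewrite -ltNge => yr.
  have [k /andP[k1 k2]] : exists k, 2 ^+ k <= `|y - x| / r < 2 ^+ k.+1.
    by apply: (@pow_bracket _ 2) => //; rewrite ler_pdivlMr// mul1r ltW.
  exists k; split; first by move: k2; rewrite ltr_pdivrMr// => /ltW.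
  move: k1; rewrite ler_pdivlMr// => k1.
  rewrite !powRN lef_pV2 ?posrE ?powR_gt0//; last exact: lt_trans yr.
  by rewrite ge0_ler_powR ?nnegrE ?(ltW (rk0 _))// addr_ge0// ltW.
- by rewrite !mulr_ge0 ?powR_ge0// exprn_ge0.
- by rewrite ltW.
- move=> k /=; rewrite mu_cube ?(ltW (rk0 _))// -EFinM lee_fin.
  have rkb : rk k `^ (- b) = r `^ (- b) * (2 `^ (- b)) ^+ k.
    rewrite powRM ?exprn_ge0 ?(ltW r0)// mulrC; congr (_ * _).
    by rewrite powR_exprn.
  rewrite opprD powRD ?(gt_eqF (rk0 _)) ?implybT// (powRN _ N%:R) powR_mulrn ?(ltW (rk0 _))//.
  have -> : 2 * rk k.+1 = 4 * rk k by rewrite /rk exprS; ring.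
  rewrite rkb (exprMn N _ (rk k)) le_eqVlt; apply/orP; left; apply/eqP.
  have : rk k ^+ N != 0 by rewrite expf_neq0// gt_eqF.
  move: (rk k ^+ N) (4 ^+ N) (r `^ _) (_ ^+ k) => a1 a2 a4 a5 a10.
  by field.
Qed.

End Cubes.

(** * The signed power and the energy form *)

Section SignedPower.
Context {R : realType}.
Variable q : R.
Hypothesis q0 : 0 < q.
Implicit Types a b P V : R.

Lemma spowN a : spow q (- a) = - spow q a.
Proof. by rewrite /spow normrN mulrN. Qed.

Lemma spow_ge0E a : 0 <= a -> spow q a = a `^ q.
Proof. by move=> a0; rewrite /spow ger0_norm// mulrC mulr_powRB1. Qed.

Lemma spow_le0E a : a <= 0 -> spow q a = - (- a) `^ q.
Proof. by move=> a0; rewrite -[a in LHS]opprK spowN spow_ge0E// oppr_ge0. Qed.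

Lemma spow_le : {homo spow q : a b / a <= b}.
Proof.
move=> a b ab; have [a0|a0] := leP 0 a.
  have b0 := le_trans a0 ab.
  by rewrite !spow_ge0E// ge0_ler_powR// ltW.
rewrite (spow_le0E (ltW a0)); have [b0|b0] := leP 0 b.
  by rewrite spow_ge0E// (@le_trans _ _ 0)// ?oppr_le0 powR_ge0.
rewrite (spow_le0E (ltW b0)) lerN2.
by rewrite ge0_ler_powR ?nnegrE ?oppr_ge0 ?lerN2 ?(ltW a0) ?(ltW b0) ?(ltW q0).
Qed.

Lemma spow_ge0 a : 0 <= a -> 0 <= spow q a.
Proof. by move=> a0; rewrite spow_ge0E// powR_ge0. Qed.

Lemma spow_le0 a : a <= 0 -> spow q a <= 0.
Proof. by move=> a0; rewrite spow_le0E// oppr_le0 powR_ge0. Qed.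

Lemma powRS a : 0 <= a -> a `^ (q + 1) = a `^ q * a.
Proof.
move=> a0; rewrite -(@mulr_powRB1 _ a (q + 1)) ?addrK ?addr_gt0// mulrC.
by [].
Qed.

(** Pointwise Caccioppoli inequality: [P] will be a difference of truncations, [V] one of tents, so
    that [V - P] is a difference of [w]. If [V <= P / 2], then [V - P <= - P / 2] gives the negative
    term. Otherwise [P < 2 V], and both the left side and the coercive term are at most [2 V^(q+1)],
    which explains the constant [4]. *)
Lemma spow_caccioppoli P V :
  spow q (V - P) * P <=
  - (2^-1 `^ q * `|P| `^ (q + 1)) + 4 * `|V| `^ (q + 1).
Proof.
wlog P0 : P V / 0 <= P.
  move=> H; have [|/ltW P0] := leP 0 P; first exact: H.
  have := H (- P) (- V); rewrite oppr_ge0 => /(_ P0).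
  by rewrite !normrN -opprD spowN mulrNN.
rewrite [`|P|]ger0_norm//.
have [VP|VP] := leP V (2^-1 * P).
  apply: (@le_trans _ _ (- (2^-1 `^ q * P `^ (q + 1)))); last first.
    by rewrite lerDl mulr_ge0// powR_ge0.
  rewrite powRS// mulrA -mulNr ler_wpM2r// -powRM// -spow_ge0E ?mulr_ge0//.
  by rewrite -spowN spow_le//; lra.
have V0 : 0 < V by apply: le_lt_trans VP; rewrite mulr_ge0.
rewrite [`|V|]gtr0_norm//.
apply: (@le_trans _ _ (2 * V `^ (q + 1))).
  rewrite powRS ?(ltW V0)// mulrCA; apply: (@le_trans _ _ (spow q V * P)).
    by rewrite ler_wpM2r// spow_le//; lra.
  rewrite spow_ge0E ?(ltW V0)// ler_wpM2l ?powR_ge0//; lra.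
have : 2^-1 `^ q * P `^ (q + 1) <= 2 * V `^ (q + 1).
  apply: (@le_trans _ _ (2^-1 `^ q * (2 * V) `^ (q + 1))).
    rewrite ler_wpM2l ?powR_ge0// ge0_ler_powR ?nnegrE ?mulr_ge0 ?addr_ge0// ?ltW//.
    lra.
  rewrite powRM ?(ltW V0)// powRS// mulrA [X in X * _](_ : _ = 2)//.
  by rewrite mulrA -powRM// mulVf// powR1 mul1r.
lra.
Qed.

End SignedPower.

Section EnergySolution.
Context {R : realType} {N : nat}.
Local Notation T := (BorelRN R N).
Variable mu : {sigma_finite_measure set T -> \bar R}.
Variables p s : R.

Lemma ae_prod (P : T -> Prop) : {ae mu, forall x, P x} ->
  {ae (mu \x mu)%E, forall z : T * T, P z.1 /\ P z.2}.
Proof.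
move=> [A [mA A0 PA]]; exists (A `*` setT `|` setT `*` A); split.
- by apply: measurableU; exact: measurableX.
- apply/eqP; rewrite eq_le measure_ge0 andbT.
  apply: (le_trans (measureU2 _ _ _)); try exact: measurableX.
  by rewrite /= !product_measure1E// A0 [X in (X * _ + _)%E]A0 mul0e mule0 adde0.
- move=> z /= h; have [z1|z1] := pselect (P z.1); last by left; split => //; exact: PA.
  by right; split => //; apply: PA => z2; apply: h.
Qed.

Definition energy_integrand (w psi : 'rV[R]_N -> R) (z : T * T) : R :=
  spow (p - 1) (w z.1 - w z.2) * (psi z.1 - psi z.2) * gker p s z.1 z.2.

Definition gagliardo_finite (w : 'rV[R]_N -> R) : Prop :=
  (\int[(mu \x mu)%E]_z (`|w z.1 - w z.2| `^ p * gker p s z.1 z.2)%:E < +oo)%E.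

(* The equation tested against bounded nonnegative functions only: unlike
   [weak_solution], it is invariant under [w |-> - w] and [w |-> w - a]. *)
Definition energy_solution (O : set 'rV[R]_N) (F : R) (w : 'rV[R]_N -> R) : Prop :=
  [/\ measurable_fun [set: T] (w : T -> R), gagliardo_finite w &
   forall (psi : 'rV[R]_N -> R) (c : R), W0 mu p s O psi ->
     (forall x, 0 <= psi x <= c) ->
     (mu \x mu)%E.-integrable setT (EFin \o energy_integrand w psi) /\
     (`|\int[(mu \x mu)%E]_z (energy_integrand w psi z)%:E| <=
       F%:E * \int[mu]_x (psi x)%:E)%E].

Lemma measurable_spow q : measurable_fun setT (spow q : R -> R).
Proof.
apply: measurable_funM => //; apply: (measurableT_comp (measurable_powR _)).
exact: normr_measurable.
Qed.

Lemma measurable_diff (w : 'rV[R]_N -> R) : measurable_fun [set: T] (w : T -> R) ->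
  measurable_fun [set: T * T] (fun z : T * T => w z.1 - w z.2).
Proof.
by move=> mw; apply: measurable_funB;
  apply: (measurableT_comp mw); [exact: measurable_fst|exact: measurable_snd].
Qed.

Lemma measurable_energy_integrand (w psi : 'rV[R]_N -> R) :
  measurable_fun [set: T] (w : T -> R) -> measurable_fun [set: T] (psi : T -> R) ->
  measurable_fun [set: T * T] (energy_integrand w psi).
Proof.
move=> mw mpsi; apply: measurable_funM; last exact: measurable_gker.
apply: measurable_funM; last exact: measurable_diff.
by apply: (measurableT_comp (measurable_spow _)); exact: measurable_diff.
Qed.

Lemma measurable_gagliardo (w : 'rV[R]_N -> R) :
  measurable_fun [set: T] (w : T -> R) ->
  measurable_fun [set: T * T]
    (fun z : T * T => `|w z.1 - w z.2| `^ p * gker p s z.1 z.2).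
Proof.
move=> mw; apply: measurable_funM; last exact: measurable_gker.
apply: (measurableT_comp (measurable_powR _)).
by apply: (measurableT_comp (@normr_measurable _ _)); exact: measurable_diff.
Qed.

Lemma W0_gagliardo (O : set 'rV[R]_N) (w : 'rV[R]_N -> R) :
  W0 mu p s O w <->
  [/\ measurable_fun [set: T] (w : T -> R),
      (\int[mu]_x (`|w x| `^ p)%:E < +oo)%E, gagliardo_finite w
    & {ae mu, forall x : T, ~ O x -> w x = 0}].
Proof.
rewrite /W0 /gagliardo_finite.
have -> : (\int[(mu \x mu)%E]_z (`|w z.1 - w z.2| `^ p / Defs.kernel p s z.1 z.2)%:E =
  \int[(mu \x mu)%E]_z (`|w z.1 - w z.2| `^ p * gker p s z.1 z.2)%:E)%E.
  by apply: eq_integral => z _; rewrite gkerE.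
by split; [move=> [? [? []]]|move=> []].
Qed.

Lemma energy_solutionN O F w : energy_solution O F w ->
  energy_solution O F (fun x => - w x).
Proof.
move=> [mw gw hw]; split.
- exact: measurableT_comp.
- rewrite /gagliardo_finite; under eq_integral do rewrite -opprD normrN.
  exact: gw.
- move=> psi c W0psi psic; have [i1 i2] := hw psi c W0psi psic.
  have E : (EFin \o energy_integrand (fun x => - w x) psi) =
      (-%E \o (EFin \o energy_integrand w psi)).
    apply/funext => z /=; rewrite /energy_integrand; congr EFin.
    by rewrite -opprD spowN !mulNr.
  split; first by rewrite E; apply: integrableN.
  have -> : (\int[(mu \x mu)%E]_z (energy_integrand (fun x => - w x) psi z)%:E =
    - \int[(mu \x mu)%E]_z (energy_integrand w psi z)%:E)%E.
    rewrite -integralN; last exact: integrable_add_def.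
    by apply: eq_integral => z _; have := congr1 (@^~ z) E.
  by rewrite abseN.
Qed.

Lemma energy_solutionB O F w a : energy_solution O F w ->
  energy_solution O F (fun x => w x - a).
Proof.
have E x y : w x - a - (w y - a) = w x - w y by ring.
move=> [mw gw hw]; split.
- exact: measurable_funB.
- by rewrite /gagliardo_finite; under eq_integral do rewrite E.
- move=> psi c W0psi psic; have := hw psi c W0psi psic.
  suff -> : energy_integrand (fun x => w x - a) psi = energy_integrand w psi by [].
  by apply/funext => z; rewrite /energy_integrand E.
Qed.

(** Allows a change on a null set, after which bounds known almost everywhere may be assumed at
    every point. *)
Lemma energy_solution_ae O F (w w' : 'rV[R]_N -> R) :
  measurable_fun [set: T] (w' : T -> R) -> {ae mu, forall x : T, w x = w' x} ->
  energy_solution O F w -> energy_solution O F w'.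
Proof.
move=> mw' /ae_prod ww' [mw gw hw]; split; first exact: mw'.
- rewrite /gagliardo_finite; move: gw; rewrite /gagliardo_finite.
  have -> // : (\int[(mu \x mu)%E]_z (`|w z.1 - w z.2| `^ p * gker p s z.1 z.2)%:E =
    \int[(mu \x mu)%E]_z (`|w' z.1 - w' z.2| `^ p * gker p s z.1 z.2)%:E)%E.
  apply: ae_eq_integral; first exact: measurableT.
  + by apply/measurable_EFinP; exact: measurable_gagliardo.
  + by apply/measurable_EFinP; exact: measurable_gagliardo.
  + by apply: filterS ww' => z [-> ->].
- move=> psi c W0psi psic; have [i1 i2] := hw psi c W0psi psic.
  have mpsi : measurable_fun [set: T] (psi : T -> R) by case: W0psi.
  have ae_I : ae_eq (mu \x mu)%E setT (EFin \o energy_integrand w psi)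
      (EFin \o energy_integrand w' psi).
    by apply: filterS ww' => z [e1 e2] _ /=; rewrite /energy_integrand e1 e2.
  have m1 := measurable_energy_integrand mw mpsi.
  have m2 := measurable_energy_integrand mw' mpsi.
  split.
    apply/integrableP; split; first exact/measurable_EFinP.
    move/integrableP : i1 => [_]; apply: le_lt_trans; rewrite le_eqVlt; apply/orP; left.
    apply/eqP/ae_eq_integral => //.
    + by apply: measurableT_comp => //; exact/measurable_EFinP.
    + by apply: measurableT_comp => //; exact/measurable_EFinP.
    + by apply: filterS ae_I => z h zT; congr abse; apply/esym; exact: h zT.
  apply: (le_trans _ i2); rewrite le_eqVlt; apply/orP; left; apply/eqP; congr abse.
  by apply: ae_eq_integral => //; [exact/measurable_EFinP|exact/measurable_EFinP|
    exact: ae_eq_sym].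
Qed.

End EnergySolution.

(** * Boundedness *)

(** Being a contraction, it does not increase the Gagliardo energy; being monotone, it makes the
    energy integrand nonnegative; taking values in [[0,1]], it produces the bounded test functions
    that [energy_solution] admits. *)
Definition clamp01 {R : realType} (t : R) : R := Num.min (Num.max t 0) 1.

Lemma clamp01P {R : realType} (t : R) :
  [\/ t <= 0 /\ clamp01 t = 0, 0 < t < 1 /\ clamp01 t = t | 1 <= t /\ clamp01 t = 1].
Proof.
rewrite /clamp01; have [t0|t0] := leP t 0.
  by apply: Or31; split => //; rewrite min_l.
have [t1|t1] := ltP t 1; first by apply: Or32; split => //; apply/andP.
by apply: Or33.
Qed.

Lemma clamp01_homo {R : realType} : {homo @clamp01 R : a b / a <= b}.
Proof.
move=> a b; have [] := clamp01P a => -[h1 ->]; have [] := clamp01P b => -[h2 ->];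
  by move: h1 h2; lra.
Qed.

Lemma clamp01_contract {R : realType} (a b : R) :
  `|clamp01 a - clamp01 b| <= `|a - b|.
Proof.
wlog ab : a b / b <= a.
  move=> H; have [/ltW|] := ltP a b; last exact: H.
  by move=> /H; rewrite distrC [leRHS]distrC.
rewrite !ger0_norm ?subr_ge0 ?clamp01_homo//.
have [] := clamp01P a => -[h1 ->]; have [] := clamp01P b => -[h2 ->];
  by move: h1 h2 ab; lra.
Qed.

(** The coordinates of [y] are at least [3 M], and the distance is at most [M + 4 M + M]. *)
Lemma cube_far {R : realType} {N : nat} (M : R) (x y : 'rV[R]_N) : (0 < N)%N ->
  0 < M -> `|x| <= M -> cube (const_mx (4 * M)) M y ->
  M < `|y| /\ `|y - x| <= 6 * M.
Proof.
rewrite /cube/= => N0 M0 xM yM; split.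
  pose i0 : 'I_N := Ordinal N0.
  have := le_trans (rvcoord_le _ i0) yM; rewrite !mxE ler_norml.
  have := rvcoord_le y i0; have := ler_norm (y ord0 i0); move: M0.
  by set a := y ord0 i0; lra.
have -> : y - x = (y - const_mx (4 * M)) + (const_mx (4 * M) - x).
  by rewrite addrA subrK.
have h : `|const_mx (4 * M) : 'rV[R]_N| <= 4 * M.
  have M4 : 0 <= 4 * M by rewrite mulr_ge0// ltW.
  by apply/rvnorm_le => // i; rewrite mxE ger0_norm.
apply: (le_trans (ler_normD _ _)); apply: (@le_trans _ _ (M + (4 * M + M))).
  by rewrite lerD// (le_trans (ler_normB _ _))// lerD.
by rewrite le_eqVlt; apply/orP; left; apply/eqP; ring.
Qed.

Section Boundedness.
Context {R : realType} {N : nat}.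
Local Notation T := (BorelRN R N).
Variable mu : {sigma_finite_measure set T -> \bar R}.
Hypothesis hmu : lebesgue_on_boxes mu.
Variables p s : R.
Hypotheses (N0 : (0 < N)%N) (s0 : 0 < s) (p1 : 1 < p).

Lemma kernel_exponent_ge0 : 0 <= N%:R + p * s.
Proof. by rewrite addr_ge0// mulr_ge0 ?ltW// (lt_trans ltr01). Qed.

Lemma weak_solution_energy (O : set 'rV[R]_N) (F : R) (f u : 'rV[R]_N -> R) :
  open O -> (mu O < +oo)%E -> measurable_fun (O : set T) (f : T -> R) ->
  0 <= F -> {ae mu, forall x : T, O x -> `|f x| <= F} ->
  weak_solution mu p s O f u -> energy_solution mu p s O F u.
Proof.
move=> oO Ofin mf F0 fF [/W0_gagliardo[mw up gw u0] hw]; split => // psi c W0psi psic.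
have mO : measurable (O : set T) by exact: open_measurable_rV.
have mpsi : measurable_fun [set: T] (psi : T -> R) by case: W0psi.
have psi0 x : 0 <= psi x by case/andP: (psic x).
have := hw psi W0psi.
have -> : (\int[(mu \x mu)%E]_z (spow (p - 1) (u z.1 - u z.2) *
    (psi z.1 - psi z.2) / Defs.kernel p s z.1 z.2)%:E =
    \int[(mu \x mu)%E]_z (energy_integrand p s u psi z)%:E)%E.
  by apply: eq_integral => z _; rewrite /energy_integrand gkerE.
move=> E.
have mfpsi : measurable_fun (O : set T) (fun x : T => f x * psi x).
  by apply: measurable_funM => //; exact: measurable_funTS.
have J1 : (`|\int[mu]_(x in (O : set T)) (f x * psi x)%:E| <=
    \int[mu]_(x in (O : set T)) (F * psi x)%:E)%E.
  apply: (le_trans (le_abse_integral _ _ _)) => //.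
    exact/measurable_EFinP.
  apply: ae_ge0_le_integral => //.
  - by apply: measurableT_comp => //; exact/measurable_EFinP.
  - by move=> x _; rewrite lee_fin mulr_ge0.
  - apply/measurable_EFinP; apply: measurable_funM => //; exact: measurable_funTS.
  - apply: filterS fF => x h Ox; rewrite lee_fin normrM (ger0_norm (psi0 x)).
    by rewrite ler_wpM2r// h.
have J2 : (\int[mu]_(x in (O : set T)) (F * psi x)%:E <=
    F%:E * \int[mu]_x (psi x)%:E)%E.
  rewrite -ge0_integralZl_EFin//; first last.
  - exact/measurable_EFinP.
  - by move=> x _; rewrite lee_fin.
  under [leRHS]eq_integral do rewrite -EFinM.
  apply: ge0_subset_integral => //.
  - by apply/measurable_EFinP; apply: measurable_funM.
  - by move=> x _; rewrite lee_fin mulr_ge0.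
have J3 : (\int[mu]_(x in (O : set T)) (F * psi x)%:E < +oo)%E.
  apply: (@le_lt_trans _ _ (\int[mu]_(x in (O : set T)) (cst (F * c)%:E x))%E).
    apply: ge0_le_integral => //.
    - by move=> x _; rewrite lee_fin mulr_ge0.
    - apply/measurable_EFinP; apply: measurable_funM => //; exact: measurable_funTS.
    - by move=> x _; rewrite lee_fin ler_wpM2l//; case/andP: (psic x).
  rewrite integral_cst// lte_mul_pinfty// ?lee_fin ?mulr_ge0//.
  by have /andP[a b] := psic 0; exact: le_trans b.
have mI := measurable_energy_integrand p s mw mpsi.
split; last by rewrite E (le_trans J1).
(* Integrability of the energy integrand is read off from the equation: its right side is finite
   because [f] and [psi] are bounded and [O] has finite measure, and a finite extended integral
   forces the integral of the absolute value to be finite. *)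
apply/integrableP; split; first exact/measurable_EFinP.
rewrite /= integral_fin_num_abs// E fin_numElt.
have := le_lt_trans J1 J3; move: (\int[mu]_(x in _) _)%E => [r| |]//=.
by rewrite !ltry !ltNyr.
Qed.

(* On the far cube the solution vanishes, so the tail of the operator already
   dominates [F] where [w > k]. *)
Lemma energy_solution_bounded (M : R) : 0 < M -> exists c : R, 0 < c /\
  forall (O : set 'rV[R]_N) (F k : R) (w : 'rV[R]_N -> R), open O -> O `<=` cube 0 M ->
    energy_solution mu p s O F w -> {ae mu, forall x : T, ~ O x -> w x = 0} ->
    0 < k -> F < c * k `^ (p - 1) -> {ae mu, forall x : T, w x <= k}.
Proof.
move=> M0.
pose kap : R := (N%:R * (6 * M)) `^ (- (N%:R + p * s)).
have N0R : 0 < N%:R :> R by rewrite ltr0n.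
have kap0 : 0 < kap by rewrite powR_gt0// !mulr_gt0.
pose E : set T := cube (const_mx (4 * M)) M.
have mE : measurable E by exact: measurable_cube.
exists (kap * (2 * M) ^+ N); split; first by rewrite mulr_gt0// exprn_gt0// mulr_gt0.
move=> O F k w oO OM sw w0 k0 Fk.
have mO : measurable (O : set T) by exact: open_measurable_rV.
(* Cutting [w] to [0] at every point of the complement, a change on a null set only, makes the test
   function vanish there pointwise. *)
pose w' (x : 'rV[R]_N) : R := w x * \1_O x.
have mw : measurable_fun [set: T] (w : T -> R) by case: sw.
have mw' : measurable_fun [set: T] (w' : T -> R).
  by apply: measurable_funM => //; exact: measurable_indic.
have ww' : {ae mu, forall x : T, w x = w' x}.
  apply: filterS w0 => x h; rewrite /w' indicE; have [Ox|Ox] := pselect (O x).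
    by rewrite mem_set// mulr1.
  by rewrite memNset// mulr0 h.
have {}sw := energy_solution_ae mw' ww' sw.
have w'0 x : ~ O x -> w' x = 0 by move=> Ox; rewrite /w' indicE memNset// mulr0.
suff: {ae mu, forall x : T, w' x <= k} by move=> h; apply: filterS2 h ww' => x ? ->.
pose psi (x : 'rV[R]_N) : R := clamp01 (w' x - k).
have mpsi : measurable_fun [set: T] (psi : T -> R).
  apply: measurable_minr => //; apply: measurable_maxr => //.
  exact: measurable_funB.
have psi01 x : 0 <= psi x <= 1.
  by rewrite /psi; have [] := clamp01P (w' x - k) => -[h ->]; move: h; lra.
have psi0 x : 0 <= psi x by case/andP: (psi01 x).
have psiO x : ~ O x -> psi x = 0.
  move=> Ox; rewrite /psi w'0// sub0r.
  by have [] := clamp01P (- k) => -[h ->]; move: h k0; lra.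
have psil x y : `|psi x - psi y| <= `|w' x - w' y|.
  apply: (le_trans (clamp01_contract _ _)).
  by rewrite opprB addrA subrK.
have psik x : 0 < psi x -> k < w' x.
  by rewrite /psi; have [] := clamp01P (w' x - k) => -[h ->]; move: h; lra.
have psim x y : 0 <= spow (p - 1) (w' x - w' y) * (psi x - psi y).
  have q0 : 0 < p - 1 by rewrite subr_gt0.
  have [xy|/ltW xy] := leP (w' x) (w' y).
    apply: mulr_le0; first by apply: spow_le0 => //; rewrite subr_le0.
    by rewrite subr_le0 clamp01_homo// lerD2r.
  apply: mulr_ge0; first by apply: spow_ge0 => //; rewrite subr_ge0.
  by rewrite subr_ge0 clamp01_homo// lerD2r.
have intpsi : (\int[mu]_x (psi x)%:E < +oo)%E.
  apply: (@le_lt_trans _ _ (\int[mu]_x (\1_(cube 0 M : set T) x)%:E)%E).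
    apply: ge0_le_integral => //.
    - by move=> x _; rewrite lee_fin.
    - exact/measurable_EFinP.
    - by apply/measurable_EFinP; apply: measurable_indic; exact: measurable_cube.
    - move=> x _; rewrite lee_fin; have [Ox|Ox] := pselect (O x); last by rewrite psiO.
      by rewrite indicE mem_set; [case/andP: (psi01 x)|exact: OM].
  rewrite integral_indic ?setIT//; last exact: measurable_cube.
  exact: mu_cube_lty.
have W0psi : W0 mu p s O psi.
  apply/W0_gagliardo; split; first exact: mpsi.
  - apply: le_lt_trans intpsi; apply: ge0_le_integral => //.
    + apply/measurable_EFinP; apply: (measurableT_comp (measurable_powR _)).
      exact: (measurableT_comp (@normr_measurable _ _)).
    + exact/measurable_EFinP.
    + move=> x _; rewrite lee_fin ger0_norm//.
      have [->|px] := eqVneq (psi x) 0; first by rewrite powR0// gt_eqF// (lt_trans ltr01).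
      apply: ge1r_powR; last exact: ltW.
      by rewrite lt_neqAle eq_sym px/=.
  - case: sw => _ gw _; apply: le_lt_trans gw; apply: ge0_le_integral => //.
    + by move=> z _; rewrite lee_fin mulr_ge0 ?powR_ge0.
    + by apply/measurable_EFinP; exact: measurable_gagliardo.
    + by apply/measurable_EFinP; exact: measurable_gagliardo.
    + move=> z _; rewrite lee_fin ler_wpM2r ?gker_ge0// ge0_ler_powR ?nnegrE//.
      by rewrite ltW// (lt_trans ltr01).
  - by apply: aeW => x; exact: psiO.
have [_ _ /(_ psi 1 W0psi psi01)[Iint IF]] := sw.
have ptw z : k `^ (p - 1) * kap * (psi z.1 * \1_E z.2) <= energy_integrand p s w' psi z.
  have rhs0 : 0 <= energy_integrand p s w' psi z by rewrite mulr_ge0// gker_ge0.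
  have [zE|zE] := pselect (E z.2); last by rewrite indicE memNset// !mulr0.
  have [px0|px0] := eqVneq (psi z.1) 0; first by rewrite px0 mul0r mulr0.
  have {}px0 : 0 < psi z.1 by rewrite lt_neqAle eq_sym px0 psi0.
  have Oz1 : O z.1.
    by apply: contrapT => /psiO e; rewrite e ltxx in px0.
  have z1M : `|z.1 : 'rV[R]_N| <= M by have := OM _ Oz1; rewrite /cube/= subr0.
  have [z2M z12M] := cube_far N0 M0 z1M zE.
  have z12 : z.1 != z.2 :> 'rV[R]_N.
    by apply/eqP => e; move: z2M; rewrite -e ltNge z1M.
  have Oz2 : ~ O z.2.
    by move=> /OM; rewrite /cube/= subr0 leNgt z2M.
  rewrite /energy_integrand (psiO _ Oz2) (w'0 _ Oz2) !subr0 indicE mem_set// mulr1.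
  rewrite mulrAC ler_pM ?mulr_ge0 ?powR_ge0//.
    rewrite ler_wpM2r// spow_ge0E ?subr_gt0//; last by rewrite ltW// (lt_trans k0)// psik.
    rewrite ge0_ler_powR ?nnegrE ?subr_ge0 ?(ltW p1) ?(ltW k0)//.
      by rewrite ltW// (lt_trans k0)// psik.
    by rewrite ltW// psik.
  by apply: gker_ge => //; [exact: kernel_exponent_ge0|rewrite mulr_gt0].
have : ((k `^ (p - 1) * kap * (2 * M) ^+ N)%:E * \int[mu]_x (psi x)%:E <=
    F%:E * \int[mu]_x (psi x)%:E)%E.
  apply: le_trans IF; apply: le_trans (lee_abs _).
  apply: (@le_trans _ _ (\int[(mu \x mu)%E]_z
      (k `^ (p - 1) * kap * (psi z.1 * \1_E z.2))%:E)%E); last first.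
    apply: ge0_le_integral => //.
    - by move=> z _; rewrite lee_fin !mulr_ge0 ?powR_ge0.
    - apply/measurable_EFinP; apply: measurable_funM => //; apply: measurable_funM.
        by apply: (measurableT_comp mpsi); exact: measurable_fst.
      apply: (@measurableT_comp _ _ _ _ _ _ (\1_E : T -> R)); last exact: measurable_snd.
      exact: measurable_indic.
    - by apply/measurable_EFinP; exact: measurable_energy_integrand.
    - by move=> z _; rewrite lee_fin.
  rewrite fubini_tonelli1/=; first last.
  - by move=> z; rewrite lee_fin !mulr_ge0 ?powR_ge0.
  - apply/measurable_EFinP; apply: measurable_funM => //; apply: measurable_funM.
      by apply: (measurableT_comp mpsi); exact: measurable_fst.
    apply: (@measurableT_comp _ _ _ _ _ _ (\1_E : T -> R)); last exact: measurable_snd.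
    exact: measurable_indic.
  rewrite -ge0_integralZl_EFin//; first last.
  - by rewrite !mulr_ge0 ?powR_ge0// exprn_ge0// mulr_ge0// ltW.
  - exact/measurable_EFinP.
  - by move=> x _; rewrite lee_fin.
  rewrite le_eqVlt; apply/orP; left; apply/eqP; apply: eq_integral => x _.
  rewrite /fubini_F.
  under eq_integral => y _ do rewrite /= mulrA EFinM.
  rewrite ge0_integralZl_EFin//; first last.
  - by rewrite !mulr_ge0 ?powR_ge0.
  - by apply/measurable_EFinP; exact: measurable_indic.
  rewrite integral_indic// setIT [X in (_ = _ * X)%E](mu_cube hmu _ (ltW M0)) -!EFinM.
  by congr EFin; ring.
have : (0 <= \int[mu]_x (psi x)%:E)%E by apply: integral_ge0 => x _; rewrite lee_fin.
move: intpsi; case E1 : (\int[mu]_x (psi x)%:E)%E => [r| |]// _.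
rewrite !lee_fin => r0 hr.
have r00 : r = 0.
  apply/eqP; rewrite eq_le r0 andbT leNgt; apply/negP => rp.
  move: hr; rewrite ler_pM2r// leNgt => /negP; apply; apply: (lt_le_trans Fk).
  by rewrite le_eqVlt; apply/orP; left; apply/eqP; ring.
have : ae_eq mu setT (EFin \o psi) (cst 0%E).
  apply/ae_eq_integral_abs => //; first exact/measurable_EFinP.
  rewrite -[RHS]/(0%:E) -r00 -E1; apply: eq_integral => x _ /=.
  by rewrite ger0_norm.
apply: filterS => x /(_ I) /= [e]; rewrite leNgt; apply/negP => kw.
have : 0 < psi x.
  by rewrite /psi lt_min ltr01 andbT lt_max subr_gt0 kw.
by rewrite e ltxx.
Qed.

End Boundedness.

(** * The growth lemma *)

Lemma powR_div {R : realType} (a r b : R) : 0 <= a -> 0 < r ->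
  (a / r) `^ b = a `^ b * r `^ (- b).
Proof.
move=> a0 r0; rewrite powRM ?invr_ge0 ?(ltW r0)//; congr (_ * _).
by rewrite -(powR_inv1 (ltW r0)) -powRrM mulN1r.
Qed.

(** * Integral bounds for the energy of the tent and for the tail *)

Section TentKernel.
Context {R : realType} {N : nat}.
Local Notation T := (BorelRN R N).
Variable mu : {sigma_finite_measure set T -> \bar R}.
Hypothesis hmu : lebesgue_on_boxes mu.
Variables p s : R.
Hypotheses (s01 : 0 < s < 1) (p1 : 1 < p).

Let s0 : 0 < s. Proof. by case/andP: s01. Qed.
Let p0 : 0 < p. Proof. exact: lt_trans p1. Qed.
Let ps0 : 0 < p * s. Proof. exact: mulr_gt0. Qed.

Lemma integral_mul_indic (A : set T) (f : T -> R) :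
  (\int[mu]_x (f x * \1_A x)%:E = \int[mu]_(x in A) (f x)%:E)%E.
Proof.
rewrite [RHS]integral_mkcond; apply: eq_integral => x _; rewrite patchE indicE.
by case: (x \in A); rewrite ?mulr1 ?mulr0.
Qed.

(** No positive part is taken: for [d > 0] the tent is negative outside [cube x0 (r / 2)], so the
    level sets of a nonnegative [w] stay in the half cube, while on [cube x0 (r / 8)] it is still at
    least [3 d / 4]. *)
Definition tent (x0 : 'rV[R]_N) (r d : R) (x : 'rV[R]_N) : R :=
  d * (1 - 2 * `|x - x0| / r).

Lemma tent_lipschitz x0 r d x y : 0 < r -> 0 <= d ->
  `|tent x0 r d x - tent x0 r d y| <= 2 * d / r * `|y - x|.
Proof.
move=> r0 d0.
have -> : tent x0 r d x - tent x0 r d y = 2 * d / r * (`|y - x0| - `|x - x0|).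
  by rewrite /tent; field; rewrite gt_eqF.
have c0 : 0 <= 2 * d / r by rewrite !mulr_ge0// invr_ge0 ltW.
rewrite normrM (ger0_norm c0) ler_wpM2l// (le_trans (ler_dist_dist _ _))//.
by rewrite opprB addrA subrK.
Qed.

Lemma measurable_tent x0 r d : measurable_fun [set: T] (tent x0 r d : T -> R).
Proof.
apply: measurable_funM => //; apply: measurable_funB => //.
by apply: measurable_funM => //; apply: measurable_funM => //; exact: measurable_dist.
Qed.

Definition tent_term (x0 : 'rV[R]_N) (r d : R) (z : T * T) : R :=
  `|tent x0 r d z.1 - tent x0 r d z.2| `^ p * gker p s z.1 z.2 * \1_(cube x0 r) z.2.

(* The growth [(|y - x0| / r)^(ps/2)] is the power [p - 1] of the lower bound allowed
   for the solution off the cube in [growth_everywhere]; halving the exponent [ps] keeps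
   it integrable against the kernel. *)
Definition tail_term (x0 : 'rV[R]_N) (r d : R) (z : T * T) : R :=
  d `^ p * (`|(z.2 : 'rV[R]_N) - x0| / r) `^ (p * s / 2) * gker p s z.1 z.2 *
  \1_(~` cube x0 r) z.2.

Lemma tent_term_ge0 x0 r d z : 0 <= tent_term x0 r d z.
Proof. by rewrite !mulr_ge0 ?gker_ge0 ?powR_ge0. Qed.

Lemma tail_term_ge0 x0 r d z : 0 <= tail_term x0 r d z.
Proof. by rewrite !mulr_ge0 ?gker_ge0 ?powR_ge0. Qed.

Lemma measurable_tent_term x0 r d : measurable_fun [set: T * T] (tent_term x0 r d).
Proof.
apply: measurable_funM; first apply: measurable_funM.
- apply: (measurableT_comp (measurable_powR _)).
  apply: (measurableT_comp (@normr_measurable _ _)).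
  exact: measurable_diff (measurable_tent x0 r d).
- exact: measurable_gker.
- apply: (@measurableT_comp _ _ _ _ _ _ (\1_(cube x0 r) : T -> R)).
    by apply: measurable_indic; exact: measurable_cube.
  exact: measurable_snd.
Qed.

Lemma measurable_tail_term x0 r d : measurable_fun [set: T * T] (tail_term x0 r d).
Proof.
apply: measurable_funM; first apply: measurable_funM; first apply: measurable_funM.
- by [].
- apply: (measurableT_comp (measurable_powR _)); apply: measurable_funM => //.
  by apply: (measurableT_comp (measurable_dist x0)); exact: measurable_snd.
- exact: measurable_gker.
- apply: (@measurableT_comp _ _ _ _ _ _ (\1_(~` cube x0 r) : T -> R)).
    by apply: measurable_indic; apply: measurableC; exact: measurable_cube.
  exact: measurable_snd.
Qed.

Let a0 : 0 <= N%:R + p * s. Proof. exact: kernel_exponent_ge0. Qed.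

(** The tent has Lipschitz constant [2 d / r], which leaves the power [p - ps - N] of [|y - x|]; it
    is integrable near [x] because [s < 1]. The cube of radius [r] about [x0] lies in the one of
    radius [2 r] about [x]. *)
Lemma tent_term_integral : exists C, 0 < C /\ forall x0 r d x, 0 < r -> 0 <= d ->
  cube x0 (r / 2) x ->
  (\int[mu]_y (tent_term x0 r d (x, y))%:E <= (C * d `^ p * r `^ (- (p * s)))%:E)%E.
Proof.
have b0 : 0 < p - p * s.
  by rewrite subr_gt0 -[ltRHS]mulr1 ltr_pM2l//; case/andP: s01.
have [C [C0 hC]] := near_integral hmu b0.
exists (C * 2 `^ p * 2 `^ (p - p * s)); split; first by rewrite !mulr_gt0 ?powR_gt0.
move=> x0 r d x r0 d0 xr.
have c0 : 0 <= 2 * d / r by rewrite !mulr_ge0// invr_ge0 ltW.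
have cc : cube x0 r `<=` cube x (2 * r).
  move=> y; move: xr; rewrite /cube/= => xr yr.
  have -> : y - x = (y - x0) - (x - x0) by rewrite opprB addrA subrK.
  rewrite (le_trans (ler_normB _ _))// (le_trans (lerD yr xr))//; move: r0; lra.
apply: (@le_trans _ _ (\int[mu]_y ((2 * d / r) `^ p * `|(y : 'rV[R]_N) - x| `^ (p - p * s - N%:R) *
    \1_(cube x (2 * r)) y)%:E)%E).
  apply: ge0_le_integral => //.
  - by move=> y _; rewrite lee_fin tent_term_ge0.
  - apply/measurable_EFinP.
    by apply: (measurableT_comp (measurable_tent_term x0 r d)).
  - apply/measurable_EFinP; apply: measurable_funM.
      apply: measurable_funM => //; apply: (measurableT_comp (measurable_powR _)).
      exact: measurable_dist.
    by apply: measurable_indic; exact: measurable_cube.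
  - move=> y _; rewrite lee_fin /tent_term /=.
    have [yr|yr] := pselect (cube x0 r y); last first.
      by rewrite indicE memNset// mulr0 !mulr_ge0 ?powR_ge0.
    rewrite indicE mem_set// mulr1 indicE (mem_set (cc _ yr)) mulr1.
    have [yx|yx] := eqVneq y x.
      by rewrite yx subrr normr0 powR0 ?(gt_eqF p0)// mul0r mulr_ge0 ?powR_ge0.
    have dy : `|y - x| != 0 by rewrite normr_eq0 subr_eq0.
    rewrite -addrA -opprD [p * s + _]addrC powRD ?dy ?implybT// mulrA.
    apply: ler_pM; rewrite ?powR_ge0 ?gker_ge0//; last exact: gker_le.
    rewrite -powRM// ge0_ler_powR ?nnegrE ?(ltW p0)//; first by rewrite mulr_ge0.
    exact: tent_lipschitz.
rewrite (integral_mul_indic _ (fun y => (2 * d / r) `^ p * `|(y : 'rV[R]_N) - x| `^ (p - p * s - N%:R))).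
under eq_integral do rewrite EFinM.
rewrite ge0_integralZl_EFin ?powR_ge0//; first last.
- apply/measurable_EFinP; apply: measurable_funTS.
  by apply: (measurableT_comp (measurable_powR _)); exact: measurable_dist.
- exact: measurable_cube.
apply: (@le_trans _ _ (((2 * d / r) `^ p)%:E * (C * (2 * r) `^ (p - p * s))%:E)%E).
  by rewrite lee_wpmul2l ?lee_fin ?powR_ge0// hC// mulr_gt0.
rewrite -EFinM lee_fin le_eqVlt; apply/orP; left; apply/eqP.
rewrite powR_div ?mulr_ge0// powRM// [(2 * r) `^ _]powRM ?(ltW r0)//.
rewrite [r `^ (p - _)]powRD ?(gt_eqF r0) ?implybT//.
have e : r `^ (- p) * r `^ p = 1 by rewrite powRN mulVf// gt_eqF// powR_gt0.
transitivity (2 `^ p * d `^ p * C * 2 `^ (p - p * s) * r `^ (- (p * s)) *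
  (r `^ (- p) * r `^ p)); first by ring.
by rewrite e; ring.
Qed.

(** For [x] in the half cube and [y] off the cube, [|y - x| >= |y - x0| / 2], so the kernel may be
    recentred at [x0]; the growth factor then leaves the integrable power [-(N + ps/2)]. *)
Lemma tail_term_integral : exists C, 0 < C /\ forall x0 r d x, 0 < r -> 0 <= d ->
  cube x0 (r / 2) x ->
  (\int[mu]_y (tail_term x0 r d (x, y))%:E <= (C * d `^ p * r `^ (- (p * s)))%:E)%E.
Proof.
have b0 : 0 < p * s / 2 by rewrite divr_gt0.
have [C [C0 hC]] := far_integral hmu b0.
exists (C * 2 `^ (N%:R + p * s)); split; first by rewrite !mulr_gt0 ?powR_gt0.
move=> x0 r d x r0 d0 xr.
pose k : R := d `^ p * 2 `^ (N%:R + p * s) * r `^ (- (p * s / 2)).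
have k0 : 0 <= k by rewrite !mulr_ge0 ?powR_ge0.
apply: (@le_trans _ _ (\int[mu]_y (k * `|(y : 'rV[R]_N) - x0| `^ (- (N%:R + p * s / 2)) *
    \1_(~` cube x0 r) y)%:E)%E).
  apply: ge0_le_integral => //.
  - by move=> y _; rewrite lee_fin tail_term_ge0.
  - apply/measurable_EFinP.
    by apply: (measurableT_comp (measurable_tail_term x0 r d)).
  - apply/measurable_EFinP; apply: measurable_funM.
      apply: measurable_funM => //; apply: (measurableT_comp (measurable_powR _)).
      exact: measurable_dist.
    by apply: measurable_indic; apply: measurableC; exact: measurable_cube.
  - move=> y _; rewrite lee_fin /tail_term /=.
    rewrite indicE; case: (boolP (_ \in _)) => yr; rewrite ?mulr0// !mulr1.
    have {}yr : r < `|y - x0|.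
      by move: yr; rewrite inE /cube/= => /negP; rewrite -ltNge.
    have y0 : 0 < `|y - x0| by exact: lt_trans yr.
    have yx : `|y - x0| / 2 <= `|y - x|.
      have xr' : `|x - x0| <= r / 2 by [].
      have : `|y - x0| <= `|y - x| + `|x - x0|.
        by rewrite (le_trans _ (ler_normD _ _))// addrA subrK.
      by move: yr xr'; set a1 := `|_|; set a2 := `|_|; set a3 := `|_|; lra.
    have kb : gker p s x y <= (`|y - x0| / 2) `^ (- (N%:R + p * s)).
      apply: (le_trans (gker_le _ _ _)) => //.
      rewrite !powRN lef_pV2 ?posrE ?powR_gt0 ?divr_gt0//; last first.
        by rewrite (lt_le_trans _ yx)// divr_gt0.
      by rewrite ge0_ler_powR ?nnegrE ?divr_ge0.
    apply: (@le_trans _ _ (d `^ p * (`|y - x0| / r) `^ (p * s / 2) *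
        (`|y - x0| / 2) `^ (- (N%:R + p * s)))).
      by rewrite ler_wpM2l// mulr_ge0 ?powR_ge0.
    rewrite le_eqVlt; apply/orP; left; apply/eqP; rewrite /k.
    rewrite !powR_div// opprK.
    have -> : - (N%:R + p * s / 2) = p * s / 2 + - (N%:R + p * s) by lra.
    rewrite (@powRD _ `|y - x0| (p * s / 2)) ?(gt_eqF y0) ?implybT//.
    ring.
rewrite (integral_mul_indic _ (fun y => k * `|(y : 'rV[R]_N) - x0| `^ (- (N%:R + p * s / 2)))).
under eq_integral do rewrite EFinM.
rewrite ge0_integralZl_EFin//; first last.
- apply/measurable_EFinP; apply: measurable_funTS.
  by apply: (measurableT_comp (measurable_powR _)); exact: measurable_dist.
- by apply: measurableC; exact: measurable_cube.
apply: (@le_trans _ _ (k%:E * (C * r `^ (- (p * s / 2)))%:E)%E).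
  by rewrite lee_wpmul2l ?lee_fin// hC.
rewrite -EFinM lee_fin le_eqVlt; apply/orP; left; apply/eqP.
have -> : - (p * s) = - (p * s / 2) + - (p * s / 2) by lra.
rewrite (@powRD _ r) ?(gt_eqF r0) ?implybT// /k; ring.
Qed.

End TentKernel.

Lemma powR_add_le {R : realType} (a b p : R) : 0 <= a -> 0 <= b -> 0 <= p ->
  (a + b) `^ p <= 2 `^ p * (a `^ p + b `^ p).
Proof.
move=> a0 b0 p0; wlog ab : a b a0 b0 / a <= b.
  move=> H; have [/H|/ltW/H] := leP a b; first exact.
  by rewrite [b + a]addrC [b `^ p + _]addrC; apply.
apply: (@le_trans _ _ ((2 * b) `^ p)).
  by rewrite ge0_ler_powR ?nnegrE ?addr_ge0 ?mulr_ge0//; move: ab; lra.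
by rewrite powRM// ler_wpM2l ?powR_ge0// lerDr powR_ge0.
Qed.

(** * The pointwise energy inequality on level sets *)

Section LevelSets.
Context {R : realType} {N : nat}.
Local Notation T := (BorelRN R N).
Variables p s : R.
Hypotheses (s01 : 0 < s < 1) (p1 : 1 < p).

Let p0 : 0 < p. Proof. exact: lt_trans p1. Qed.
Let q0 : 0 < p - 1. Proof. by rewrite subr_gt0. Qed.

Variables (x0 : 'rV[R]_N) (r d : R) (w : 'rV[R]_N -> R).

Definition low_set (h : R) : set T :=
  [set x | cube x0 r x /\ w x < tent x0 r d x - h].

(** This is the truncation [(tent - h - w)_+] on the cube, extended by [0]: the De Giorgi test
    function at level [h]. *)
Definition low_part (h : R) (x : 'rV[R]_N) : R :=
  (tent x0 r d x - h - w x) * \1_(low_set h) x.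

Definition high_set (D : R) : set T := [set x | cube x0 r x /\ D / 2 <= w x].

(* The first summand is the coercive part of the energy of the level set against its
   complement, the second the interaction with the set where [w] is at least [D / 2]:
   there the nonlocal term alone pushes [w] up, in place of an isoperimetric inequality. *)
Definition gain (h D : R) (z : T * T) : R :=
  gker p s z.1 z.2 *
  (2^-1 `^ (p - 1) / 2 * low_part h z.1 `^ p * \1_(cube x0 r `\` low_set h) z.2 +
   (D / 4) `^ (p - 1) / 2 * low_part h z.1 * \1_(high_set D) z.2).

Definition cost (S : set T) (z : T * T) : R :=
  \1_S z.1 * (tent_term p s x0 r d z + tail_term p s x0 r d z).

Hypotheses (r0 : 0 < r) (d0 : 0 < d).
Hypothesis mw : measurable_fun [set: T] (w : T -> R).

Lemma measurable_low_set h : measurable (low_set h).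
Proof.
apply: (@measurableI _ _ (cube x0 r) [set x | w x < tent x0 r d x - h]).
  exact: measurable_cube.
rewrite [X in measurable X](_ : _ = [set: T] `&`
    (fun x => tent x0 r d x - h - w x) @^-1` [set` `]0, +oo[]).
  have mf : measurable_fun [set: T] (fun x : T => tent x0 r d x - h - w x).
    by apply: measurable_funB => //; apply: measurable_funB => //; exact: measurable_tent.
  by apply: mf => //; exact: measurable_itv.
by rewrite setTI; apply/seteqP; split => x /=; rewrite in_itv/= andbT subr_gt0.
Qed.

Lemma measurable_high_set D : measurable (high_set D).
Proof.
apply: (@measurableI _ _ (cube x0 r) [set x | D / 2 <= w x]).
  exact: measurable_cube.
rewrite [X in measurable X](_ : _ = [set: T] `&` (w : T -> R) @^-1` [set` `[D / 2, +oo[]).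
  by apply: mw => //; exact: measurable_itv.
by rewrite setTI; apply/seteqP; split => x /=; rewrite in_itv/= andbT.
Qed.

Lemma measurable_low_part h : measurable_fun [set: T] (low_part h : T -> R).
Proof.
apply: measurable_funM; last by apply: measurable_indic; exact: measurable_low_set.
apply: measurable_funB => //; apply: measurable_funB => //; exact: measurable_tent.
Qed.

Lemma low_part_in h x : low_set h x -> low_part h x = tent x0 r d x - h - w x.
Proof. by move=> Sx; rewrite /low_part indicE mem_set// mulr1. Qed.

Lemma low_part_out h x : ~ low_set h x -> low_part h x = 0.
Proof. by move=> Sx; rewrite /low_part indicE memNset// mulr0. Qed.

Lemma low_part_gt0 h x : low_set h x -> 0 < low_part h x.
Proof. by move=> Sx; rewrite low_part_in// subr_gt0; case: Sx. Qed.

Lemma low_part_ge0 h x : 0 <= low_part h x.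
Proof.
have [Sx|Sx] := pselect (low_set h x); last by rewrite low_part_out.
by rewrite ltW// low_part_gt0.
Qed.

Lemma tent_le x : tent x0 r d x <= d.
Proof.
rewrite /tent ler_piMr ?(ltW d0)// gerDl oppr_le0.
by rewrite mulr_ge0 ?invr_ge0 ?(ltW r0)// mulr_ge0.
Qed.

Lemma cost_ge0 S z : 0 <= cost S z.
Proof. by rewrite mulr_ge0// addr_ge0// ?tent_term_ge0 ?tail_term_ge0. Qed.

Lemma measurable_cost (S : set T) : measurable S -> measurable_fun [set: T * T] (cost S).
Proof.
move=> mS; apply: measurable_funM.
  apply: (@measurableT_comp _ _ _ _ _ _ (\1_S : T -> R)); last exact: measurable_fst.
  exact: measurable_indic.
by apply: measurable_funD; [exact: measurable_tent_term|exact: measurable_tail_term].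
Qed.

Lemma measurable_swap_fun (f : T * T -> R) : measurable_fun [set: T * T] f ->
  measurable_fun [set: T * T] (fun z => f (z.2, z.1)).
Proof.
move=> mf; apply: (measurableT_comp mf).
by apply/measurable_fun_pairP; split; [exact: measurable_snd|exact: measurable_fst].
Qed.

Lemma gain_ge0 h D z : 0 <= gain h D z.
Proof.
have c (a : R) : 0 <= a `^ (p - 1) / 2 by rewrite divr_ge0// powR_ge0.
apply: mulr_ge0; first exact: gker_ge0.
by apply: addr_ge0; apply: mulr_ge0 => //; apply: mulr_ge0;
  rewrite ?powR_ge0 ?low_part_ge0 ?c.
Qed.

Lemma measurable_gain h D : measurable_fun [set: T * T] (gain h D).
Proof.
have m1 : measurable_fun [set: T * T] (fun z : T * T => low_part h z.1).
  by apply: (measurableT_comp (measurable_low_part h)); exact: measurable_fst.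
have m2 (A : set T) : measurable A ->
    measurable_fun [set: T * T] (fun z : T * T => \1_A z.2 : R).
  move=> mA; apply: (@measurableT_comp _ _ _ _ _ _ (\1_A : T -> R)).
    exact: measurable_indic.
  exact: measurable_snd.
apply: measurable_funM; first exact: measurable_gker.
apply: measurable_funD; apply: measurable_funM.
- by apply: measurable_funM => //; apply: (measurableT_comp (measurable_powR _)).
- apply: m2; apply: measurableD; [exact: measurable_cube|exact: measurable_low_set].
- exact: measurable_funM.
- by apply: m2; exact: measurable_high_set.
Qed.

Variable h : R.
Hypotheses (h0 : 0 <= h) (w0 : forall x, cube x0 r x -> 0 <= w x).

Let S := low_set h.
Let psi := low_part h.

Lemma low_set_half : S `<=` cube x0 (r / 2).
Proof.
move=> x [xr]; have := w0 xr; rewrite /tent /cube/= => wx hx.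
have : 0 < d * (1 - 2 * `|x - x0| / r) by move: hx wx h0; lra.
rewrite pmulr_rgt0// subr_gt0 ltr_pdivrMr// mul1r; lra.
Qed.

Lemma low_set_in_cube : S `<=` cube x0 r. Proof. by move=> x []. Qed.

Lemma low_set_w x : S x -> 0 <= w x < d.
Proof.
move=> Sx; rewrite w0; last by case: Sx.
by case: Sx => _ wx; rewrite (lt_le_trans wx)// lerBlDr (le_trans (tent_le _))// lerDl.
Qed.

Lemma low_part_le x : psi x <= d.
Proof.
have [Sx|Sx] := pselect (S x); last by rewrite /psi low_part_out// ltW.
rewrite /psi low_part_in//; have := tent_le x; have /andP[] := low_set_w Sx.
move: h0; lra.
Qed.

Hypothesis wtail : forall y, ~ cube x0 r y ->
  - d * (`|y - x0| / r) `^ (p * s / (2 * (p - 1))) <= w y.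

Lemma out_ratio y : ~ cube x0 r y -> 1 <= `|y - x0| / r.
Proof.
by rewrite /cube/= => /negP; rewrite -ltNge ler_pdivlMr// mul1r => /ltW.
Qed.

(** Three positions of [y]. Off the cube, [w x - w y <= 2 d t^eta] with [t = |y - x0| / r] and
    [eta (p - 1) = ps/2], which is the tail term times [2^(p-1)]. In the level set the gain vanishes
    and [spow_caccioppoli] applies to the difference of truncations. In the rest of the cube
    [w y >= tent y - h], so it applies with [P = psi x]; if moreover [w y >= D / 2], then
    [w x - w y <= - D / 4] gives a second bound, and the average of the two accounts for the halves
    in [gain]. *)
Lemma low_part_pair D x y : 8 * d <= D -> S x ->
  energy_integrand p s w psi (x, y) + gain h D (x, y) <=
  (4 + 2 `^ (p - 1)) * cost S (x, y).
Proof.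
move=> dD Sx; have K0 := gker_ge0 p s x y.
have psi0 := low_part_gt0 Sx; have /andP[wx0 wxd] := low_set_w Sx.
have q2 : 0 <= 2 `^ (p - 1) :> R by exact: powR_ge0.
have cle c t : 0 <= t -> 0 <= c <= 4 + 2 `^ (p - 1) ->
    t <= tent_term p s x0 r d (x, y) + tail_term p s x0 r d (x, y) ->
    c * t <= (4 + 2 `^ (p - 1)) * cost S (x, y).
  move=> t0 /andP[c0 c1] tle; rewrite /cost indicE mem_set// mul1r.
  exact: ler_pM.
have t1 := tent_term_ge0 p s x0 r d (x, y); have t2 := tail_term_ge0 p s x0 r d (x, y).
rewrite /energy_integrand /gain /=.
have [yQ|yQ] := pselect (cube x0 r y); last first.
  have yS : ~ S y by case.
  have yH : ~ high_set D y by case.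
  rewrite 2!indicE memNset; last by case.
  rewrite memNset// !mulr0 addr0 mulr0 addr0 /psi (low_part_out yS) subr0.
  apply: (@le_trans _ _ (2 `^ (p - 1) * tail_term p s x0 r d (x, y))); last first.
    apply: cle; [exact: t2| |by rewrite lerDr].
    by rewrite lerDr q2 ler0n.
  rewrite /tail_term/= indicE mem_set// mulr1 mulrA.
  rewrite ler_wpM2r// {t1 t2 cle}.
  have t1 := out_ratio yQ; set t := `|y - x0| / r in t1 *.
  have tq : (t `^ (p * s / (2 * (p - 1)))) `^ (p - 1) = t `^ (p * s / 2).
    by rewrite -powRrM; congr (_ `^ _); field; rewrite gt_eqF.
  have te : 1 <= t `^ (p * s / (2 * (p - 1))).
    rewrite -[leLHS](powRr0 t) ler_powR// divr_ge0 ?mulr_ge0 ?(ltW p0) ?(ltW q0)//.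
    by case/andP: s01 => /ltW.
  apply: (@le_trans _ _ (spow (p - 1) (2 * d * t `^ (p * s / (2 * (p - 1)))) * d)).
    have le1 : w x - w y <= 2 * d * t `^ (p * s / (2 * (p - 1))).
      have := wtail yQ; rewrite -/t; set e := t `^ _ in te *.
      have : d <= d * e by rewrite ler_peMr// ltW.
      move: wxd; lra.
    apply: (@le_trans _ _ (spow (p - 1) (2 * d * t `^ (p * s / (2 * (p - 1)))) * low_part h x)).
      by rewrite ler_wpM2r ?(ltW psi0)// spow_le.
    apply: ler_wpM2l; last exact: low_part_le.
    by apply: spow_ge0 => //; rewrite !mulr_ge0 ?powR_ge0 ?(ltW d0).
  rewrite spow_ge0E// ?mulr_ge0 ?powR_ge0 ?(ltW d0)//.
  rewrite powRM ?mulr_ge0 ?powR_ge0 ?(ltW d0)// tq powRM ?(ltW d0)//.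
  have -> : d `^ p = d `^ (p - 1) * d by rewrite -powRS ?(ltW d0)// subrK.
  by rewrite le_eqVlt; apply/orP; left; apply/eqP; ring.
pose V : R := tent x0 r d x - tent x0 r d y; pose P : R := psi x.
have P0 : 0 < P by [].
have tt : tent_term p s x0 r d (x, y) = `|V| `^ p * gker p s x y.
  by rewrite /tent_term/= indicE mem_set// mulr1.
suff main : spow (p - 1) (w x - w y) * (psi x - psi y) +
    (2^-1 `^ (p - 1) / 2 * P `^ p * \1_(cube x0 r `\` S) y +
     (D / 4) `^ (p - 1) / 2 * P * \1_(high_set D) y) <= 4 * `|V| `^ p.
  apply: (@le_trans _ _ (4 * tent_term p s x0 r d (x, y))); last first.
    apply: cle; [exact: t1| |by rewrite lerDl].
    by rewrite lerDl q2 ler0n.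
  rewrite tt mulrA [gker p s x y * _]mulrC -mulrDl ler_wpM2r//.
have cac := spow_caccioppoli q0 P V; rewrite subrK (gtr0_norm P0) in cac.
have cP : 0 <= 2^-1 `^ (p - 1) * P `^ p by rewrite mulr_ge0 ?powR_ge0.
have Vp : 0 <= `|V| `^ p by exact: powR_ge0.
have [yS|yS] := pselect (S y).
  have yH : ~ high_set D y.
    by case=> _ Dy; have /andP[_] := low_set_w yS; move: Dy dD d0; lra.
  rewrite 2!indicE memNset; last by case.
  rewrite memNset// !mulr0 !addr0.
  have := spow_caccioppoli q0 (psi x - psi y) V; rewrite subrK.
  have -> : V - (psi x - psi y) = w x - w y.
    by rewrite /V /psi !low_part_in//; ring.
  move=> /le_trans; apply; rewrite gerDr oppr_le0.
  by rewrite mulr_ge0 ?powR_ge0.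
have wy : tent x0 r d y - h <= w y.
  by rewrite leNgt; apply/negP => wy; apply: yS.
rewrite [psi y]low_part_out// subr0 indicE mem_set// mulr1.
have A1 : spow (p - 1) (w x - w y) * P <= spow (p - 1) (V - P) * P.
  rewrite ler_wpM2r ?(ltW P0)// spow_le// /V /P /psi low_part_in//.
  by move: wy; lra.
have {}cac := le_trans A1 cac.
rewrite -/P indicE; case: (boolP (_ \in _)) => yH.
  rewrite mulr1; have {}yH : D / 2 <= w y by move: yH; rewrite inE => -[].
  have D0 : 0 <= D / 4 by move: dD d0; lra.
  have : spow (p - 1) (w x - w y) * P <= - (D / 4) `^ (p - 1) * P.
    rewrite ler_wpM2r ?(ltW P0)// -spow_ge0E// -spowN spow_le//.
    by move: yH wxd dD d0; lra.
  move: cac cP Vp; set a1 := spow _ _ * P; set a2 := 2^-1 `^ _; set a3 := P `^ _.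
  set a4 := (D / 4) `^ _.
  have -> : a2 / 2 * a3 = (a2 * a3) / 2 by ring.
  have -> : a4 / 2 * P = (a4 * P) / 2 by ring.
  rewrite mulNr; set a5 := a2 * a3; set a6 := a4 * P; set a7 := `|V| `^ p.
  lra.
rewrite mulr0 addr0; move: cac cP Vp.
set a1 := spow _ _ * P; set a2 := 2^-1 `^ _; set a3 := P `^ _.
have -> : a2 / 2 * a3 = (a2 * a3) / 2 by ring.
by set a5 := a2 * a3; set a7 := `|V| `^ p; lra.
Qed.

End LevelSets.

(** * Testing the equation with the truncation *)

Section LevelSetEnergy.
Context {R : realType} {N : nat}.
Local Notation T := (BorelRN R N).
Variable mu : {sigma_finite_measure set T -> \bar R}.
Hypothesis hmu : lebesgue_on_boxes mu.
Variables p s : R.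
Hypotheses (s01 : 0 < s < 1) (p1 : 1 < p).

Let p0 : 0 < p. Proof. exact: lt_trans p1. Qed.
Let q0 : 0 < p - 1. Proof. by rewrite subr_gt0. Qed.

(** Tonelli in one order for each summand: for a point of [S], the integral over the other variable
    is bounded by the tent and tail estimates uniformly on the half cube. *)
Lemma cost_integral : exists C, 0 < C /\ forall x0 r d (S : set T), 0 < r -> 0 <= d ->
  measurable S -> S `<=` cube x0 (r / 2) ->
  (\int[(mu \x mu)%E]_z (cost p s x0 r d S z + cost p s x0 r d S (z.2, z.1))%:E <=
    (C * d `^ p * r `^ (- (p * s)))%:E * mu S)%E.
Proof.
have [C1 [C10 h1]] := tent_term_integral hmu s01 p1.
have [C2 [C20 h2]] := tail_term_integral hmu s01 p1.
exists (2 * (C1 + C2)); split; first by rewrite mulr_gt0// addr_gt0.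
move=> x0 r d S r0 d0 mS Sr.
pose c := (C1 + C2) * d `^ p * r `^ (- (p * s)).
have c0 : 0 <= c by rewrite !mulr_ge0 ?powR_ge0// addr_ge0// ltW.
have mc := measurable_cost p s x0 r d mS.
have inner x : (\int[mu]_y (cost p s x0 r d S (x, y))%:E <= (c * \1_S x)%:E)%E.
  rewrite /cost /= indicE; case: (boolP (_ \in _)) => [|xS]; last first.
    under eq_integral do rewrite mul0r.
    by rewrite integral0 mulr0.
  rewrite inE => /Sr xS; under eq_integral do rewrite mul1r EFinD.
  rewrite ge0_integralD//=; first last.
  - apply/measurable_EFinP; apply: (measurableT_comp (measurable_tail_term p s x0 r d)).
    exact: measurable_pair1.
  - by move=> y _; rewrite lee_fin tail_term_ge0.
  - apply/measurable_EFinP; apply: (measurableT_comp (measurable_tent_term p s x0 r d)).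
    exact: measurable_pair1.
  - by move=> y _; rewrite lee_fin tent_term_ge0.
  rewrite mulr1 /c !mulrDl EFinD; apply: leeD; [exact: h1|exact: h2].
have outer : (\int[mu]_x \int[mu]_y (cost p s x0 r d S (x, y))%:E <= c%:E * mu S)%E.
  apply: (@le_trans _ _ (\int[mu]_x (c * \1_S x)%:E)%E).
    apply: ge0_le_integral => //.
    - by move=> x _; apply: integral_ge0 => y _; rewrite lee_fin cost_ge0.
    - apply: (@measurable_fun_fubini_tonelli_F _ _ _ _ _ _
        (fun z => (cost p s x0 r d S z)%:E)).
        exact/measurable_EFinP.
      by move=> z; rewrite lee_fin cost_ge0.
    - by apply/measurable_EFinP; apply: measurable_funM => //; exact: measurable_indic.
  under eq_integral do rewrite EFinM.
  rewrite ge0_integralZl_EFin//; last first.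
    by apply/measurable_EFinP; exact: measurable_indic.
  by rewrite integral_indic// setIT.
under eq_integral do rewrite EFinD.
rewrite ge0_integralD//; first last.
- by apply/measurable_EFinP; exact: measurable_swap_fun.
- by move=> z _; rewrite lee_fin cost_ge0.
- exact/measurable_EFinP.
- by move=> z _; rewrite lee_fin cost_ge0.
have -> : 2 * (C1 + C2) * d `^ p * r `^ (- (p * s)) = c + c by rewrite /c; ring.
rewrite EFinD ge0_muleDl ?lee_fin//; apply: leeD.
  rewrite fubini_tonelli1//; first exact/measurable_EFinP.
  by move=> z; rewrite lee_fin cost_ge0.
rewrite fubini_tonelli2//; first by apply/measurable_EFinP; exact: measurable_swap_fun.
by move=> z; rewrite lee_fin cost_ge0.
Qed.

Lemma mu_low_set_lty x0 r d (w : 'rV[R]_N -> R) h :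
  measurable_fun [set: T] (w : T -> R) -> (mu (low_set x0 r d w h) < +oo)%E.
Proof.
move=> mw; apply: le_lt_trans (mu_cube_lty hmu x0 r); apply: le_measure.
- by rewrite inE; exact: measurable_low_set.
- by rewrite inE; exact: measurable_cube.
- exact: low_set_in_cube.
Qed.

Section FixedLevel.
Variables (x0 : 'rV[R]_N) (r d : R) (w : 'rV[R]_N -> R) (h D : R).
Hypotheses (r0 : 0 < r) (d0 : 0 < d) (h0 : 0 <= h) (dD : 8 * d <= D).
Hypothesis w0 : forall x, cube x0 r x -> 0 <= w x.
Hypothesis wtail : forall y, ~ cube x0 r y ->
  - d * (`|y - x0| / r) `^ (p * s / (2 * (p - 1))) <= w y.

Let S := low_set x0 r d w h.
Let psi := low_part x0 r d w h.

(** The energy density is symmetric, whereas [gain] charges only pairs whose first point is in the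
    level set. If only the second point is there, the variables are exchanged; if neither is, the
    left side is [0]. *)
Lemma low_part_pair_sym z :
  energy_integrand p s w psi z + gain p s x0 r d w h D z <=
  (4 + 2 `^ (p - 1)) * (cost p s x0 r d S z + cost p s x0 r d S (z.2, z.1)).
Proof.
case: z => x y /=; have c0 : 0 <= 4 + 2 `^ (p - 1) by rewrite addr_ge0// powR_ge0.
have cz z := mulr_ge0 c0 (cost_ge0 p s x0 r d S z).
rewrite mulrDr; have [Sx|Sx] := pselect (S x).
  rewrite ler_wpDr ?cz//.
  exact: (low_part_pair s01 p1 r0 d0 h0 w0 wtail y dD Sx).
have gx : gain p s x0 r d w h D (x, y) = 0.
  rewrite /gain/= (low_part_out Sx) powR0 ?(gt_eqF p0)//; ring.
have [Sy|Sy] := pselect (S y); last first.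
  rewrite gx addr0 /energy_integrand/= /psi (low_part_out Sx) (low_part_out Sy).
  by rewrite subrr mulr0 mul0r addr_ge0 ?cz.
rewrite gx addr0 ler_wpDl ?cz//.
apply: (le_trans _ (low_part_pair s01 p1 r0 d0 h0 w0 wtail x dD Sy)).
apply: (@le_trans _ _ (energy_integrand p s w psi (y, x))); last first.
  by rewrite lerDl gain_ge0.
rewrite /energy_integrand/= (gkerC p s x y).
by rewrite -[w x - w y]opprB -[psi x - psi y]opprB spowN mulrNN.
Qed.

(** A qualitative bound, used only to see that the truncation has finite Gagliardo energy. *)
Lemma low_part_diff x y : S x ->
  `|psi x - psi y| `^ p * gker p s x y <=
  2 `^ p * (`|w x - w y| `^ p * gker p s x y + cost p s x0 r d S (x, y)).
Proof.
move=> Sx; have K0 := gker_ge0 p s x y.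
have t1 := tent_term_ge0 p s x0 r d (x, y); have t2 := tail_term_ge0 p s x0 r d (x, y).
have px : 0 < psi x by exact: low_part_gt0.
rewrite /cost/= [\1_S x]indicE mem_set// mul1r.
have [yQ|yQ] := pselect (cube x0 r y); last first.
  have yS : ~ S y by case.
  have := out_ratio r0 yQ; set t := `|y - x0| / r => t1'.
  rewrite /psi (low_part_out yS) subr0 gtr0_norm//.
  apply: (@le_trans _ _ (1 * tail_term p s x0 r d (x, y))).
    rewrite mul1r /tail_term/= indicE mem_set// mulr1 ler_wpM2r//.
    rewrite (@le_trans _ _ (d `^ p))//.
      by rewrite ge0_ler_powR ?nnegrE ?(ltW p0) ?(ltW px) ?(ltW d0)// low_part_le.
    rewrite ler_peMr ?powR_ge0// -[leLHS](powRr0 t) ler_powR//.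
    by rewrite divr_ge0// mulr_ge0 ?(ltW p0)//; case/andP: s01 => /ltW.
  apply: ler_pM => //; last by rewrite addrA lerDr addr_ge0 ?mulr_ge0 ?powR_ge0.
  by rewrite -[leLHS](powRr0 2) ler_powR ?ler1n// ltW.
pose V : R := tent x0 r d x - tent x0 r d y.
have tt : tent_term p s x0 r d (x, y) = `|V| `^ p * gker p s x y.
  by rewrite /tent_term/= indicE mem_set// mulr1.
have main : `|psi x - psi y| <= `|w x - w y| + `|V|.
  have W1 := ler_norm (w x - w y); have W2 := ler_norm (w y - w x).
  rewrite distrC in W2.
  have V1 := ler_norm V; have V2 := ler_norm (- V); rewrite normrN in V2.
  have [Sy|Sy] := pselect (S y).
    rewrite /psi !low_part_in//.
    have -> : tent x0 r d x - h - w x - (tent x0 r d y - h - w y) = V - (w x - w y).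
      by rewrite /V; ring.
    by rewrite (le_trans (ler_normB _ _))// addrC.
  have wy : tent x0 r d y - h <= w y.
    by rewrite leNgt; apply/negP => wy; apply: Sy.
  rewrite {2}/psi (low_part_out Sy) subr0 gtr0_norm// /psi low_part_in//.
  by move: W2 V1 wy; rewrite /V; lra.
apply: (@le_trans _ _ (2 `^ p * (`|w x - w y| `^ p + `|V| `^ p) * gker p s x y)).
  rewrite ler_wpM2r//; apply: le_trans (powR_add_le _ _ _) => //; last exact: ltW.
  by rewrite ge0_ler_powR ?nnegrE ?addr_ge0 ?(ltW p0).
rewrite -mulrA ler_wpM2l ?powR_ge0// mulrDl tt addrA lerDl//.
Qed.

Variables (O : set 'rV[R]_N) (F : R).
Hypothesis sw : energy_solution mu p s O F w.
Hypothesis wO : {ae mu, forall x : T, cube x0 (r / 2) x -> ~ O x -> d <= w x}.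

Let mw : measurable_fun [set: T] (w : T -> R). Proof. by case: sw. Qed.
Let mS : measurable S. Proof. exact: measurable_low_set. Qed.
Let mpsi : measurable_fun [set: T] (psi : T -> R). Proof. exact: measurable_low_part. Qed.
Let mcost : measurable_fun [set: T * T]
  (fun z => cost p s x0 r d S z + cost p s x0 r d S (z.2, z.1)).
Proof.
have mc := measurable_cost p s x0 r d mS.
by apply: measurable_funD => //; exact: measurable_swap_fun.
Qed.
Let cost0 z : 0 <= cost p s x0 r d S z + cost p s x0 r d S (z.2, z.1).
Proof. by rewrite addr_ge0 ?cost_ge0. Qed.

Lemma cost_lty : (\int[(mu \x mu)%E]_z
  (cost p s x0 r d S z + cost p s x0 r d S (z.2, z.1))%:E < +oo)%E.
Proof.
have [C [C0 hC]] := cost_integral.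
apply: (le_lt_trans (hC x0 r d S r0 (ltW d0) mS (low_set_half r0 d0 h0 w0))).
by rewrite lte_mul_pinfty ?lee_fin ?mulr_ge0 ?powR_ge0 ?(ltW C0)//; exact: mu_low_set_lty mw.
Qed.

Lemma low_part_integral : (\int[mu]_x (psi x)%:E <= d%:E * mu S)%E.
Proof.
apply: (@le_trans _ _ (\int[mu]_x (d * \1_S x)%:E)%E).
  apply: ge0_le_integral => //.
  - by move=> x _; rewrite lee_fin low_part_ge0.
  - exact/measurable_EFinP.
  - by apply/measurable_EFinP; apply: measurable_funM => //; exact: measurable_indic.
  - move=> x _; rewrite lee_fin indicE; case: (boolP (_ \in _)) => [xS|].
      by rewrite mulr1 low_part_le.
    by rewrite notin_setE => /low_part_out; rewrite /psi => ->; rewrite mulr0.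
under eq_integral do rewrite EFinM.
rewrite ge0_integralZl_EFin ?(ltW d0)//; last first.
  by apply/measurable_EFinP; exact: measurable_indic.
by rewrite integral_indic// setIT.
Qed.

(** The point is the vanishing off [O]: there [w >= d] almost everywhere on the half cube by [wO],
    whereas [w < d] on the level set. *)
Lemma low_part_W0 : W0 mu p s O psi.
Proof.
apply/W0_gagliardo; split; first exact: mpsi.
- apply: (@le_lt_trans _ _ (\int[mu]_x (d `^ p * \1_S x)%:E)%E).
    apply: ge0_le_integral => //.
    + apply/measurable_EFinP; apply: (measurableT_comp (measurable_powR _)).
      exact: measurableT_comp.
    + by apply/measurable_EFinP; apply: measurable_funM => //; exact: measurable_indic.
    + move=> x _; rewrite lee_fin indicE; case: (boolP (_ \in _)) => [xS|].
        rewrite mulr1 ge0_ler_powR ?nnegrE ?(ltW p0) ?(ltW d0)//.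
        by rewrite ger0_norm ?low_part_ge0// low_part_le.
      rewrite notin_setE => /low_part_out; rewrite /psi => ->.
      by rewrite normr0 mulr0 powR0// gt_eqF.
  under eq_integral do rewrite EFinM.
  rewrite ge0_integralZl_EFin ?powR_ge0//; last first.
    by apply/measurable_EFinP; exact: measurable_indic.
  rewrite integral_indic// setIT lte_mul_pinfty ?lee_fin ?powR_ge0//.
  exact: mu_low_set_lty mw.
- pose c := fun z => cost p s x0 r d S z + cost p s x0 r d S (z.2, z.1).
  have mg := measurable_gagliardo p s mw.
  apply: (@le_lt_trans _ _ (\int[(mu \x mu)%E]_z
      ((2 `^ p)%:E * ((`|w z.1 - w z.2| `^ p * gker p s z.1 z.2)%:E + (c z)%:E)))%E).
    apply: ge0_le_integral => //.
    + by move=> z _; rewrite lee_fin mulr_ge0 ?powR_ge0 ?gker_ge0.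
    + by apply/measurable_EFinP; exact: measurable_gagliardo.
    + apply: emeasurable_funM => //; apply: emeasurable_funD; exact/measurable_EFinP.
    + move=> [x y] _ /=; rewrite -EFinD -EFinM lee_fin.
      have g0 : 0 <= `|w x - w y| `^ p * gker p s x y.
        by rewrite mulr_ge0 ?powR_ge0 ?gker_ge0.
      have [Sx|Sx] := pselect (S x).
        apply: (le_trans (low_part_diff y Sx)).
        by rewrite ler_wpM2l ?powR_ge0// lerD2l lerDl cost_ge0.
      have [Sy|Sy] := pselect (S y); last first.
        rewrite /psi (low_part_out Sx) (low_part_out Sy) subrr normr0 powR0 ?gt_eqF//.
        rewrite mul0r; apply: mulr_ge0; first exact: powR_ge0.
        exact: (addr_ge0 g0 (cost0 (x, y))).
      rewrite distrC gkerC [`|w x - _|]distrC; apply: (le_trans (low_part_diff x Sy)).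
      by rewrite ler_wpM2l ?powR_ge0// lerD2l lerDr cost_ge0.
  rewrite ge0_integralZl_EFin ?powR_ge0//; first last.
  + by apply: emeasurable_funD; exact/measurable_EFinP.
  + move=> z _; rewrite -EFinD lee_fin; apply: addr_ge0; last exact: cost0.
    by rewrite mulr_ge0 ?powR_ge0 ?gker_ge0.
  rewrite lte_mul_pinfty ?lee_fin ?powR_ge0// ge0_integralD//; first last.
  + exact/measurable_EFinP.
  + by move=> z _; rewrite lee_fin; exact: cost0.
  + exact/measurable_EFinP.
  + by move=> z _; rewrite lee_fin ?mulr_ge0 ?powR_ge0 ?gker_ge0.
  by rewrite lte_add_pinfty//; [case: sw|exact: cost_lty].
- apply: filterS wO => x hx Ox; apply: low_part_out => Sx.
  have := hx (low_set_half r0 d0 h0 w0 Sx) Ox.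
  by have /andP[_] := low_set_w r0 d0 h0 w0 Sx; rewrite leNgt => ->.
Qed.

Lemma gain_le_cost :
  (\int[(mu \x mu)%E]_z (gain p s x0 r d w h D z)%:E <=
  (4 + 2 `^ (p - 1))%:E * \int[(mu \x mu)%E]_z
    (cost p s x0 r d S z + cost p s x0 r d S (z.2, z.1))%:E +
  F%:E * \int[mu]_x (psi x)%:E)%E.
Proof.
have psid x : 0 <= psi x <= d by rewrite low_part_ge0 low_part_le.
have [_ _ /(_ psi d low_part_W0 psid)[iI IF]] := sw.
pose c z := (4 + 2 `^ (p - 1)) * (cost p s x0 r d S z + cost p s x0 r d S (z.2, z.1)).
have C0 : 0 <= 4 + 2 `^ (p - 1) by rewrite addr_ge0// powR_ge0.
have mc : measurable_fun [set: T * T] c by exact: measurable_funM.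
have Ec : (\int[(mu \x mu)%E]_z (c z)%:E = (4 + 2 `^ (p - 1))%:E *
    \int[(mu \x mu)%E]_z (cost p s x0 r d S z + cost p s x0 r d S (z.2, z.1))%:E)%E.
  rewrite -ge0_integralZl_EFin//; last exact/measurable_EFinP.
  by move=> z _; rewrite lee_fin; exact: cost0.
have ic : (mu \x mu)%E.-integrable setT (EFin \o c).
  apply/integrableP; split; first exact/measurable_EFinP.
  under eq_integral => z _ do rewrite /= ger0_norm ?mulr_ge0//.
  by rewrite Ec lte_mul_pinfty ?lee_fin//; exact: cost_lty.
(* [gain] is dominated by cost minus energy density. Both are integrable, so the integral of the
   difference splits, and the equation bounds the energy by [F] times the integral of the
   truncation. *)
apply: (@le_trans _ _ (\int[(mu \x mu)%E]_z
    ((EFin \o c) z - (EFin \o energy_integrand p s w psi) z))%E).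
  apply: ge0_le_integral => //.
  - by move=> z _; rewrite lee_fin gain_ge0.
  - by apply/measurable_EFinP; exact: measurable_gain.
  - apply: emeasurable_funB; apply/measurable_EFinP => //.
    exact: measurable_energy_integrand.
  - move=> z _; rewrite /= -EFinB lee_fin lerBrDl; exact: low_part_pair_sym.
rewrite integralB// Ec leeD2l//.
by apply: le_trans IF; rewrite -abseN; exact: lee_abs.
Qed.

End FixedLevel.

(** The threshold on [F] makes the source contribution [F d |S|] at most [d^p r^(-ps) |S|], the size
    of the tent and tail costs, so one scale-invariant bound covers all three. *)
Lemma gain_integral : exists C, 0 < C /\
  forall x0 r d (w : 'rV[R]_N -> R) h D O F, 0 < r -> 0 < d -> 0 <= h -> 8 * d <= D ->
  (forall x, cube x0 r x -> 0 <= w x) ->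
  (forall y, ~ cube x0 r y ->
    - d * (`|y - x0| / r) `^ (p * s / (2 * (p - 1))) <= w y) ->
  energy_solution mu p s O F w ->
  {ae mu, forall x : T, cube x0 (r / 2) x -> ~ O x -> d <= w x} ->
  0 <= F -> F <= d `^ (p - 1) * r `^ (- (p * s)) ->
  (\int[(mu \x mu)%E]_z (gain p s x0 r d w h D z)%:E <=
  (C * d `^ p * r `^ (- (p * s)))%:E * mu (low_set x0 r d w h))%E.
Proof.
have [C [C0 hC]] := cost_integral.
have c0 : 0 < 4 + 2 `^ (p - 1) by rewrite addr_gt0// powR_gt0.
exists ((4 + 2 `^ (p - 1)) * C + 1); split; first by rewrite addr_gt0// mulr_gt0.
move=> x0 r d w h D O F r0 d0 h0 dD w0 wtail sw wO F0 Fle.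
apply: (le_trans (gain_le_cost r0 d0 h0 dD w0 wtail sw wO)).
have mw : measurable_fun [set: T] (w : T -> R) by case: sw.
have mS := measurable_low_set x0 r d mw h.
have -> : ((4 + 2 `^ (p - 1)) * C + 1) * d `^ p * r `^ (- (p * s)) =
    (4 + 2 `^ (p - 1)) * (C * d `^ p * r `^ (- (p * s))) + d `^ p * r `^ (- (p * s)).
  by ring.
have e0 : 0 <= C * d `^ p * r `^ (- (p * s)) by rewrite !mulr_ge0 ?powR_ge0// ltW.
have e1 : 0 <= d `^ p * r `^ (- (p * s)) by rewrite mulr_ge0 ?powR_ge0.
rewrite [leRHS](_ : _ = ((4 + 2 `^ (p - 1)) * (C * d `^ p * r `^ (- (p * s))))%:E *
    mu (low_set x0 r d w h) + (d `^ p * r `^ (- (p * s)))%:E *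
    mu (low_set x0 r d w h))%E; last first.
  by rewrite -ge0_muleDl ?lee_fin ?(mulr_ge0 (ltW c0) e0).
apply: leeD.
  rewrite EFinM -muleA lee_wpmul2l ?lee_fin ?(ltW c0)//.
  by apply: hC => //; [exact: ltW|exact: low_set_half].
apply: (@le_trans _ _ (F%:E * (d%:E * mu (low_set x0 r d w h)))%E).
  by rewrite lee_wpmul2l ?lee_fin//; exact: (low_part_integral r0 d0 h0 w0 sw).
rewrite muleA -EFinM lee_wpmul2r ?measure_ge0// lee_fin.
have -> : d `^ p = d `^ (p - 1) * d by rewrite -powRS ?(ltW d0)// subrK.
by rewrite mulrAC ler_wpM2r// ltW.
Qed.

End LevelSetEnergy.

(** * De Giorgi's recursion for a decreasing function of the level *)

Lemma le0_of_geometric {R : realType} (a v w : R) : 0 <= v -> 0 <= w < 1 ->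
  (forall k, a <= v * w ^+ k) -> a <= 0.
Proof.
move=> v0 /andP[w0 w1] H.
have cv : (fun k => v * w ^+ k) @ \oo --> (0 : R).
  by apply: cvg_geometric; rewrite ger0_norm.
rewrite -(cvg_lim _ cv)//; apply: limr_ge; first by apply/cvg_ex; exists 0.
by apply: nearW => k; exact: H.
Qed.

(* With thresholds [d/2 - (d/4) 2^-k], the recursion gives [Y_k <= nu w^k], where
   [w] is chosen so that [2^p w^b = 1]. *)
Lemma degiorgi_iteration {R : realType} (p b C : R) : 0 < p -> 0 < b -> 0 < C ->
  exists nu : R, 0 < nu /\ forall (Y : R -> R) (d : R), 0 < d ->
    (forall h, 0 <= Y h) ->
    (forall h h', 0 <= h -> h < h' -> Y h' <= Y h) ->
    (forall h h', 0 <= h -> h < h' -> 2 * Y h <= 1 ->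
       Y h' <= C * (d / (h' - h)) `^ p * Y h `^ (1 + b)) ->
    Y (d / 4) <= nu -> Y (d / 2) <= 0.
Proof.
move=> p0 b0 C0.
pose w : R := 2 `^ (- (p / b)).
have w0 : 0 < w by rewrite powR_gt0.
have pb0 : 0 < p / b by rewrite divr_gt0.
have w1 : w < 1.
  have one : 1 `^ (p / b) = 1 :> R by rewrite powR1.
  rewrite /w powRN invf_lt1 ?powR_gt0// -[ltLHS]one gt0_ltr_powR// ?nnegrE//; lra.
have wb : 2 `^ p * w `^ b = 1.
  by rewrite /w -powRrM mulNr divfK ?gt_eqF// powRN divff// gt_eqF// powR_gt0.
(* Consecutive thresholds differ by [d / (8 2^k)], hence [8^p]. In [nu], the entry [1/2] keeps
   [2 Y <= 1] throughout, and the other one gives [K nu^b <= w], the factor gained at each step. *)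
pose K := C * 8 `^ p; have K0 : 0 < K by rewrite mulr_gt0// powR_gt0.
pose nu := Num.min 2^-1 ((w / K) `^ b^-1).
have nu0 : 0 < nu by rewrite lt_min invr_gt0 ltr0n powR_gt0// divr_gt0.
have nuK : K * nu `^ b <= w.
  rewrite mulrC -ler_pdivlMr//.
  have -> : w / K = ((w / K) `^ b^-1) `^ b.
    by rewrite -powRrM mulVf ?gt_eqF// powRr1// divr_ge0 ?ltW.
  by rewrite ge0_ler_powR ?nnegrE ?(ltW b0) ?(ltW nu0) ?powR_ge0// ge_min lexx orbT.
exists nu; split => // Y d d0 Y0 Ymono Ystep Y4.
pose h k : R := d / 2 - d / 4 * 2^-1 ^+ k.
have i0 k : 0 < 2^-1 ^+ k :> R by rewrite exprn_gt0.
have i1 k : 2^-1 ^+ k <= 1 :> R by rewrite exprn_ile1//; lra.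
have h0 k : 0 <= h k.
  have : d / 4 * 2^-1 ^+ k <= d / 4 * 1 by rewrite ler_wpM2l// divr_ge0// ltW.
  by rewrite /h; move: d0; lra.
have hS k : h k.+1 - h k = d / (8 * 2 ^+ k).
  by rewrite /h exprS !exprVn; field; rewrite expf_neq0.
have hlt k : h k < h k.+1 by rewrite -subr_gt0 hS divr_gt0// mulr_gt0// exprn_gt0.
have hd k : h k < d / 2 by rewrite /h gtrBl mulr_gt0// divr_gt0.
have Yk k : Y (h k) <= nu * w ^+ k.
  elim: k => [|k IH].
    have -> : h 0%N = d / 4 by rewrite /h expr0; lra.
    by rewrite expr0 mulr1.
  have wk0 : 0 < w ^+ k by rewrite exprn_gt0.
  have wk1 : w ^+ k <= 1 by rewrite exprn_ile1// ltW.
  have Y2 : 2 * Y (h k) <= 1.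
    have : nu <= 2^-1 by rewrite ge_min lexx.
    have : nu * w ^+ k <= nu by rewrite ler_piMr// ltW.
    by move: IH; lra.
  apply: (le_trans (Ystep _ _ (h0 k) (hlt k) Y2)).
  rewrite hS.
  have -> : d / (d / (8 * 2 ^+ k)) = 8 * 2 ^+ k.
    by field; rewrite expf_neq0//= gt_eqF.
  rewrite powRM ?exprn_ge0// powR_exprn// mulrA -/K.
  apply: (@le_trans _ _ (K * (2 `^ p) ^+ k * (nu * w ^+ k) `^ (1 + b))).
    apply: ler_wpM2l; first exact: mulr_ge0 (ltW K0) (exprn_ge0 _ (powR_ge0 _ _)).
    by rewrite ge0_ler_powR ?nnegrE ?addr_ge0 ?(ltW b0)// mulr_ge0 ?ltW.
  have nw : nu * w ^+ k != 0 by rewrite gt_eqF// mulr_gt0.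
  rewrite powRD ?nw ?implybT// powRr1 ?mulr_ge0 ?(ltW nu0) ?(ltW wk0)//.
  rewrite powRM ?(ltW nu0) ?(ltW wk0)// powR_exprn ?(ltW w0)//.
  have -> : K * (2 `^ p) ^+ k * (nu * w ^+ k * (nu `^ b * (w `^ b) ^+ k)) =
     K * nu `^ b * (nu * w ^+ k) * (2 `^ p * w `^ b) ^+ k by rewrite exprMn; ring.
  rewrite wb expr1n mulr1 exprS [nu * (w * _)]mulrCA ler_wpM2r//.
  by rewrite mulr_ge0 ?ltW.
apply: (@le0_of_geometric _ _ nu w); rewrite ?(ltW nu0) ?(ltW w0)// => k.
exact: le_trans (Ymono _ _ (h0 k) (hd k)) (Yk k).
Qed.

(** * Two measure estimates, one for each summand of the gain *)

Section LevelSteps.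
Context {R : realType} {N : nat}.
Local Notation T := (BorelRN R N).
Variable mu : {sigma_finite_measure set T -> \bar R}.
Hypothesis hmu : lebesgue_on_boxes mu.
Variables p s : R.
Hypotheses (N0 : (0 < N)%N) (s01 : 0 < s < 1) (p1 : 1 < p).

Let p0 : 0 < p. Proof. exact: lt_trans p1. Qed.
Let s0 : 0 < s. Proof. by case/andP: s01. Qed.
Let a0 : 0 <= N%:R + p * s. Proof. exact: kernel_exponent_ge0. Qed.

Variables (x0 : 'rV[R]_N) (r d : R) (w : 'rV[R]_N -> R) (D B : R).
Hypotheses (r0 : 0 < r) (d0 : 0 < d) (dD : 8 * d <= D) (B0 : 0 <= B).
Hypothesis mw : measurable_fun [set: T] (w : T -> R).
Hypothesis w0 : forall x, cube x0 r x -> 0 <= w x.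
Hypothesis gain_le : forall h, 0 <= h ->
  (\int[(mu \x mu)%E]_z (gain p s x0 r d w h D z)%:E <= B%:E * mu (low_set x0 r d w h))%E.

Definition low_measure (h : R) : R := fine (mu (low_set x0 r d w h)).

Lemma low_measureE h : mu (low_set x0 r d w h) = (low_measure h)%:E.
Proof.
rewrite fineK// ge0_fin_numE ?measure_ge0//.
exact: mu_low_set_lty mw.
Qed.

Lemma low_measure_ge0 h : 0 <= low_measure h.
Proof. by rewrite fine_ge0// measure_ge0. Qed.

Lemma low_set_mono h h' x : h <= h' -> low_set x0 r d w h' x -> low_set x0 r d w h x.
Proof. by move=> hh [xr wx]; split => //; rewrite (lt_le_trans wx)// lerB. Qed.

Lemma low_measure_mono h h' : h <= h' -> low_measure h' <= low_measure h.
Proof.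
move=> hh; rewrite -lee_fin -!low_measureE; apply: le_measure.
- by rewrite inE; exact: measurable_low_set.
- by rewrite inE; exact: measurable_low_set.
- by move=> x; exact: low_set_mono.
Qed.

(** Chebyshev's inequality in the first variable after Tonelli. The gain is taken at the level [h]
    but bounded below on the smaller set at [h'], where the truncation at [h] is at least
    [h' - h]. *)
Lemma gain_outer h h' A : 0 <= h -> 0 <= A ->
  (forall x, low_set x0 r d w h' x ->
    (A%:E <= \int[mu]_y (gain p s x0 r d w h D (x, y))%:E)%E) ->
  A * low_measure h' <= B * low_measure h.
Proof.
move=> h0 A0 hA; rewrite -lee_fin !EFinM -!low_measureE.
apply: le_trans (gain_le h0).
rewrite (fubini_tonelli1 (fun z => (gain p s x0 r d w h D z)%:E)); first last.
- by move=> z; rewrite lee_fin gain_ge0.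
- by apply/measurable_EFinP; exact: measurable_gain.
have mS := measurable_low_set x0 r d mw h'.
apply: (@le_trans _ _ (\int[mu]_x (A * \1_(low_set x0 r d w h') x)%:E)%E).
  under eq_integral do rewrite EFinM.
  rewrite ge0_integralZl_EFin//; last by apply/measurable_EFinP; exact: measurable_indic.
  by rewrite integral_indic// setIT.
apply: ge0_le_integral => //.
- by move=> x _; rewrite lee_fin mulr_ge0.
- by apply/measurable_EFinP; apply: measurable_funM => //; exact: measurable_indic.
- apply: (@measurable_fun_fubini_tonelli_F _ _ _ _ _ _
    (fun z => (gain p s x0 r d w h D z)%:E)).
    by apply/measurable_EFinP; exact: measurable_gain.
  by move=> z; rewrite lee_fin gain_ge0.
- move=> x _; rewrite indicE; case: (boolP (_ \in _)) => [|xS].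
    by rewrite inE mulr1; exact: hA.
  by rewrite mulr0; apply: integral_ge0 => y _; rewrite lee_fin gain_ge0.
Qed.

Let kap (t : R) : R := (N%:R * t) `^ (- (N%:R + p * s)).

Lemma gain_inner (h A : R) (E : set T) x : 0 <= A -> measurable E ->
  (forall y, E y -> A <= gain p s x0 r d w h D (x, y)) ->
  (A%:E * mu E <= \int[mu]_y (gain p s x0 r d w h D (x, y))%:E)%E.
Proof.
move=> A0 mE hA; apply: (@le_trans _ _ (\int[mu]_y (A * \1_E y)%:E)%E).
  under eq_integral do rewrite EFinM.
  rewrite ge0_integralZl_EFin//; last by apply/measurable_EFinP; exact: measurable_indic.
  by rewrite integral_indic// setIT.
apply: ge0_le_integral => //.
- by move=> y _; rewrite lee_fin mulr_ge0.
- by apply/measurable_EFinP; apply: measurable_funM => //; exact: measurable_indic.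
- apply/measurable_EFinP; apply: (measurableT_comp (measurable_gain p s x0 r d mw h D)).
  exact: measurable_pair1.
- move=> y _; rewrite lee_fin indicE; case: (boolP (_ \in _)) => [|yE].
    by rewrite inE mulr1; exact: hA.
  by rewrite mulr0 gain_ge0.
Qed.

Lemma low_part_gap h h' x : h <= h' -> low_set x0 r d w h' x ->
  h' - h <= low_part x0 r d w h x.
Proof.
move=> hh Sx; rewrite low_part_in; last exact: low_set_mono Sx.
by case: Sx => _; lra.
Qed.

(** Every point of the level set sees the whole high set within distance [2 r]. The two sets are
    disjoint since [w < d < D / 2] on the first, so the zero of [gker] on the diagonal is
    avoided. *)
Lemma level_step_high h h' mH : 0 <= h -> h < h' -> 0 <= mH ->
  (mH%:E <= mu (high_set x0 r w D))%E ->
  kap (2 * r) * ((D / 4) `^ (p - 1) / 2 * (h' - h)) * mH * low_measure h' <=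
  B * low_measure h.
Proof.
move=> h0 hh' mH0 hH; have hh := ltW hh'.
have k0 : 0 <= kap (2 * r) by exact: powR_ge0.
have e0 : 0 <= (D / 4) `^ (p - 1) / 2 * (h' - h).
  by rewrite mulr_ge0 ?subr_ge0// divr_ge0// powR_ge0.
apply: gain_outer => // [|x Sx]; first exact: mulr_ge0 (mulr_ge0 k0 e0) mH0.
have Sx' := low_set_mono hh Sx.
apply: (@le_trans _ _ ((kap (2 * r) * ((D / 4) `^ (p - 1) / 2 * (h' - h)))%:E *
    mu (high_set x0 r w D))%E).
  by rewrite EFinM lee_wpmul2l// lee_fin; exact: mulr_ge0 k0 e0.
apply: gain_inner; [exact: mulr_ge0 k0 e0|exact: measurable_high_set|].
move=> y Hy; rewrite /gain/=; apply: ler_pM => //.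
  apply: gker_ge => //; first by rewrite mulr_gt0.
    apply/eqP => xy; case: Hy => _; rewrite -xy.
    by have /andP[_] := low_set_w r0 d0 h0 w0 Sx'; move: dD d0; lra.
  have -> : y - x = (y - x0) - (x - x0) by rewrite opprB addrA subrK.
  rewrite (le_trans (ler_normB _ _))// mulr_natl mulr2n lerD//; first by case: Hy.
  by case: Sx.
rewrite [\1_(high_set _ _ _ _) y]indicE mem_set// mulr1.
apply: (@le_trans _ _ ((D / 4) `^ (p - 1) / 2 * low_part x0 r d w h x)).
  by rewrite ler_wpM2l ?divr_ge0 ?powR_ge0// low_part_gap.
by rewrite lerDr !mulr_ge0 ?powR_ge0.
Qed.

(* This replaces the Sobolev inequality: with [(2 t)^N = 2 |S|], every point of the
   level set [S] sees at least [|S|] of its complement within distance [t]. *)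
Lemma level_step_self h h' t : 0 <= h -> h < h' -> 0 < t -> t <= r / 2 ->
  low_measure h <= (2 * t) ^+ N ->
  kap t * (2^-1 `^ (p - 1) / 2 * (h' - h) `^ p) * ((2 * t) ^+ N - low_measure h) *
    low_measure h' <= B * low_measure h.
Proof.
move=> h0 hh' t0 tr mt; have hh := ltW hh'.
have k0 : 0 <= kap t by exact: powR_ge0.
have e0 : 0 <= 2^-1 `^ (p - 1) / 2 * (h' - h) `^ p.
  by rewrite mulr_ge0 ?powR_ge0// divr_ge0// powR_ge0.
apply: gain_outer => // [|x Sx].
  by apply: mulr_ge0; [exact: mulr_ge0 k0 e0|rewrite subr_ge0].
have Sx' := low_set_mono hh Sx.
have mS := measurable_low_set x0 r d mw h.
have mE : measurable (cube x t `\` low_set x0 r d w h).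
  by apply: measurableD => //; exact: measurable_cube.
apply: (@le_trans _ _ ((kap t * (2^-1 `^ (p - 1) / 2 * (h' - h) `^ p))%:E *
    mu (cube x t `\` low_set x0 r d w h))%E).
  rewrite EFinM lee_wpmul2l ?lee_fin ?(mulr_ge0 k0 e0)//.
  rewrite EFinB leeBlDr// -low_measureE -(mu_cube hmu x (ltW t0)).
  apply: (@le_trans _ _ (mu ((cube x t `\` low_set x0 r d w h) `|` low_set x0 r d w h))).
    apply: le_measure; rewrite ?inE.
    - exact: measurable_cube.
    - exact: measurableU.
    - move=> y yt; have [Sy|Sy] := pselect (low_set x0 r d w h y); by [right|left].
  exact: measureU2.
apply: gain_inner => //; first exact: mulr_ge0 k0 e0.
move=> y [yt Sy]; rewrite /gain/=; apply: ler_pM => //.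
  apply: gker_ge => //; apply/eqP => xy; apply: Sy; rewrite -xy//.
(* [x] lies in the half cube and [t <= r / 2], so [cube x t] stays inside [cube x0 r]. *)
rewrite [\1_(cube _ _ `\` _) y]indicE mem_set; last first.
  split => //; have xr := low_set_half r0 d0 h0 w0 Sx'.
  rewrite /cube/= in yt xr *.
  have -> : y - x0 = (y - x) + (x - x0) by rewrite addrA subrK.
  rewrite (le_trans (ler_normD _ _))// (le_trans (lerD yt xr))//; move: tr; lra.
rewrite mulr1 (@le_trans _ _ (2^-1 `^ (p - 1) / 2 * low_part x0 r d w h x `^ p))//.
  rewrite ler_wpM2l ?divr_ge0 ?powR_ge0// ge0_ler_powR ?nnegrE ?(ltW p0) ?low_part_ge0//.
    by rewrite subr_ge0.
  exact: low_part_gap.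
rewrite lerDl; apply: mulr_ge0 => //; apply: mulr_ge0; last exact: low_part_ge0.
by rewrite divr_ge0// powR_ge0.
Qed.

End LevelSteps.

(** * From measure information to a pointwise lower bound *)

Section Growth.
Context {R : realType} {N : nat}.
Local Notation T := (BorelRN R N).
Variable mu : {sigma_finite_measure set T -> \bar R}.
Hypothesis hmu : lebesgue_on_boxes mu.
Variables p s : R.
Hypotheses (N0 : (0 < N)%N) (s01 : 0 < s < 1) (p1 : 1 < p).

Let p0 : 0 < p. Proof. exact: lt_trans p1. Qed.
Let s0 : 0 < s. Proof. by case/andP: s01. Qed.
Let q0 : 0 < p - 1. Proof. by rewrite subr_gt0. Qed.
Let a0 : 0 <= N%:R + p * s. Proof. exact: kernel_exponent_ge0. Qed.
Let NR : 0 < N%:R :> R. Proof. by rewrite ltr0n. Qed.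

Let powR_Nps (r : R) : 0 < r -> r `^ (N%:R + p * s) = r ^+ N * r `^ (p * s).
Proof. by move=> r0; rewrite powRD ?(gt_eqF r0) ?implybT// powR_mulrn// ltW. Qed.

Section FixedBall.
Variables (x0 : 'rV[R]_N) (r d : R) (w : 'rV[R]_N -> R) (D C : R).
Hypotheses (r0 : 0 < r) (d0 : 0 < d) (dD : 8 * d <= D) (C0 : 0 < C).
Hypothesis mw : measurable_fun [set: T] (w : T -> R).
Hypothesis w0 : forall x, cube x0 r x -> 0 <= w x.
Hypothesis gain_le : forall h, 0 <= h ->
  (\int[(mu \x mu)%E]_z (gain p s x0 r d w h D z)%:E <=
   (C * d `^ p * r `^ (- (p * s)))%:E * mu (low_set x0 r d w h))%E.

Let m := low_measure mu x0 r d w.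
Let B0 : 0 <= C * d `^ p * r `^ (- (p * s)).
Proof. by rewrite !mulr_ge0 ?powR_ge0// ltW. Qed.
Let rN : 0 < r ^+ N. Proof. exact: exprn_gt0. Qed.

(** [level_step_self] at a radius adapted to the level set: the kernel bound of order
    [t^(-(N + ps))] with [t] of order [r Y^(1/N)] yields the superlinear exponent [1 + ps/N]. *)
Lemma low_measure_step h h' : 0 <= h -> h < h' -> 2 * (m h / r ^+ N) <= 1 ->
  m h' / r ^+ N <=
    (C * N%:R `^ (N%:R + p * s) * 2 `^ (1 + p * s / N%:R) * 2 / 2^-1 `^ (p - 1)) *
    (d / (h' - h)) `^ p * (m h / r ^+ N) `^ (1 + p * s / N%:R).
Proof.
move=> h0 hh' Y2.
have t0 : 0 < h' - h by rewrite subr_gt0.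
have mh0 : 0 <= m h by exact: low_measure_ge0.
have mm : m h' <= m h by apply: low_measure_mono => //; exact: ltW.
have c2 : 0 < 2^-1 `^ (p - 1) :> R by rewrite powR_gt0.
have [mz|mz] := eqVneq (m h) 0.
  have -> : m h' = 0.
    by apply/eqP; rewrite eq_le low_measure_ge0 andbT -mz.
  by rewrite mul0r !mulr_ge0 ?powR_ge0// ?invr_ge0 ?(ltW C0)// ltW.
have {mz} mp : 0 < m h by rewrite lt_neqAle eq_sym mz.
pose Y := m h / r ^+ N; have Y0 : 0 < Y by rewrite divr_gt0.
(* With [t = r k / 2] one has [(2 t)^N = 2 m h], so the complement seen has measure at least [m h],
   and this factor cancels against the right side. The assumption [2 Y <= 1] gives [k <= 1], that
   is, [t <= r / 2]. *)
pose k : R := (2 * Y) `^ N%:R^-1.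
have k0 : 0 < k by rewrite powR_gt0// mulr_gt0.
have kN : k ^+ N = 2 * Y.
  rewrite -(powR_mulrn _ (ltW k0)) -powRrM mulVf ?gt_eqF// powRr1//.
  by rewrite mulr_ge0// ltW.
have k1 : k <= 1.
  have one : 1 `^ N%:R^-1 = 1 :> R by rewrite powR1.
  by rewrite -[leRHS]one ge0_ler_powR ?nnegrE ?invr_ge0 ?(ltW NR) ?(mulr_ge0 _ (ltW Y0)).
have t2N : (2 * (r * k / 2)) ^+ N = 2 * m h.
  have -> : 2 * (r * k / 2) = r * k by field.
  by rewrite exprMn kN /Y; field; rewrite gt_eqF.
have := @level_step_self _ _ mu hmu p s s01 p1 x0 r d w D _ r0 d0 mw w0 gain_le h h'
  (r * k / 2) h0 hh'.
rewrite t2N -/(m h) -/(m h') => H.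
have {}H := H (divr_gt0 (mulr_gt0 r0 k0) (ltr0Sn R 1)).
have {}H : (N%:R * (r * k / 2)) `^ (- (N%:R + p * s)) *
    (2^-1 `^ (p - 1) / 2 * (h' - h) `^ p) * (2 * m h - m h) * m h' <=
    C * d `^ p * r `^ (- (p * s)) * m h.
  apply: H; last by move: mp; lra.
  by rewrite ler_wpM2r// ler_piMr// ltW.
have {}H : (N%:R * (r * k / 2)) `^ (- (N%:R + p * s)) *
    (2^-1 `^ (p - 1) / 2 * (h' - h) `^ p) * m h' <=
    C * d `^ p * r `^ (- (p * s)).
  rewrite -(ler_pM2r mp); apply: le_trans H; rewrite le_eqVlt; apply/orP; left.
  by apply/eqP; ring.
have tp : 0 < (h' - h) `^ p by rewrite powR_gt0.
have rk : 0 < r * k by rewrite mulr_gt0.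
have ap : 0 < (N%:R * (r * k / 2)) `^ (N%:R + p * s).
  by rewrite powR_gt0 // mulr_gt0// divr_gt0.
have {}H : m h' <= C * d `^ p * r `^ (- (p * s)) * (N%:R * (r * k / 2)) `^ (N%:R + p * s) *
    2 / 2^-1 `^ (p - 1) / (h' - h) `^ p.
  rewrite ler_pdivlMr// ler_pdivlMr//.
  move: H; rewrite powRN; set A := _ `^ (N%:R + _) in ap *; set A1 := 2^-1 `^ _ in c2 *.
  set A2 := _ `^ p in tp *; set A3 := C * _ * _ => H.
  have : A * 2 * (A^-1 * (A1 / 2 * A2) * m h') <= A * 2 * A3.
    by rewrite ler_wpM2l// mulr_ge0// ltW.
  have -> : A * 2 * (A^-1 * (A1 / 2 * A2) * m h') = m h' * A2 * A1.
    by field; rewrite gt_eqF.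
  move=> /le_trans; apply; rewrite le_eqVlt; apply/orP; left; apply/eqP; ring.
rewrite ler_pdivrMr//; apply: (le_trans H).
have ka : k `^ (N%:R + p * s) = 2 `^ (1 + p * s / N%:R) * Y `^ (1 + p * s / N%:R).
  rewrite /k -powRrM -powRM ?(ltW Y0)//; congr (_ `^ _).
  by field; rewrite gt_eqF.
have ra : (N%:R * (r * k / 2)) `^ (N%:R + p * s) <=
    N%:R `^ (N%:R + p * s) * (r ^+ N * r `^ (p * s)) * k `^ (N%:R + p * s).
  rewrite -powR_Nps// -powRM ?(ltW r0) ?(ltW NR)// -powRM ?mulr_ge0 ?(ltW r0) ?(ltW k0)//.
  have e1 : 0 <= N%:R * (r * k / 2) by rewrite mulr_ge0// divr_ge0// ltW.
  have e2 : 0 <= N%:R * r * k by rewrite !mulr_ge0 ?ltW.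
  rewrite ge0_ler_powR ?nnegrE//.
  by rewrite -[leRHS]mulrA ler_wpM2l// ler_pdivrMr//; move: rk; lra.
apply: (@le_trans _ _ (C * d `^ p * r `^ (- (p * s)) *
    (N%:R `^ (N%:R + p * s) * (r ^+ N * r `^ (p * s)) * k `^ (N%:R + p * s)) *
    2 / 2^-1 `^ (p - 1) / (h' - h) `^ p)).
  rewrite !ler_wpM2r ?invr_ge0 ?(ltW tp) ?(ltW c2)//.
  by rewrite ler_wpM2l.
rewrite ka (powR_div p (ltW d0) t0) (powRN (h' - h)) (powRN r).
have rp : r `^ (p * s) != 0 by rewrite gt_eqF// powR_gt0.
rewrite -/Y le_eqVlt; apply/orP; left; apply/eqP; field.
by rewrite rp !gt_eqF.
Qed.

(** [level_step_high] from level [0] to [d / 4], with the level set at [0] bounded by the half cube,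
    of measure [r^N]. The gain carries [D^(p-1) d] and the cost [d^p], hence the ratio
    [(d / D)^(p-1)]. *)
Lemma low_measure_start mu0 : 0 < mu0 -> ((mu0 * r ^+ N)%:E <= mu (high_set x0 r w D))%E ->
  m (d / 4) / r ^+ N <=
    (C * (2 * N%:R) `^ (N%:R + p * s) * 8 * 4 `^ (p - 1) / mu0) * (d / D) `^ (p - 1).
Proof.
move=> mu00 hH.
have D0 : 0 < D by move: dD d0; lra.
have d40 : 0 < d / 4 by rewrite divr_gt0.
have := @level_step_high _ _ mu hmu p s s01 p1 x0 r d w D _ r0 d0 dD mw w0 gain_le 0 (d / 4)
  (mu0 * r ^+ N) (lexx 0) d40 (mulr_ge0 (ltW mu00) (ltW rN)) hH.
rewrite subr0 -/(m _) => H.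
have {}H := le_trans H (_ : _ <= C * d `^ p * r `^ (- (p * s)) * r ^+ N).
have {}H : (N%:R * (2 * r)) `^ (- (N%:R + p * s)) *
    ((D / 4) `^ (p - 1) / 2 * (d / 4)) * (mu0 * r ^+ N) * m (d / 4) <=
    C * d `^ p * r `^ (- (p * s)) * r ^+ N.
  apply: H; rewrite ler_wpM2l// -lee_fin -low_measureE//.
  have -> : (r ^+ N)%:E = mu (cube x0 (r / 2)).
    by rewrite mu_cube ?divr_ge0 ?(ltW r0)//; congr ((_ ^+ _)%:E); field.
  apply: le_measure; rewrite ?inE.
  - exact: measurable_low_set.
  - exact: measurable_cube.
  - exact: low_set_half.
have A0 : 0 < (2 * N%:R) `^ (N%:R + p * s) by rewrite powR_gt0// mulr_gt0.
have E1 : (N%:R * (2 * r)) `^ (- (N%:R + p * s)) =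
    ((2 * N%:R) `^ (N%:R + p * s))^-1 * (r ^+ N)^-1 * r `^ (- (p * s)).
  rewrite powRN mulrA [N%:R * 2]mulrC powRM ?mulr_ge0 ?(ltW r0) ?(ltW NR)//.
  by rewrite (powR_Nps r0) powRN !invfM mulrA.
have rp : 0 < r `^ (- (p * s)) by rewrite powR_gt0.
have dq : 0 < d `^ (p - 1) by rewrite powR_gt0.
have Dq : 0 < D `^ (p - 1) by rewrite powR_gt0.
have f4 : 0 < 4 `^ (p - 1) :> R by rewrite powR_gt0.
have dpE : d `^ p = d `^ (p - 1) * d by rewrite -powRS ?(ltW d0)// subrK.
rewrite powR_div ?(ltW d0)// (powRN D) ler_pdivrMr//.
rewrite E1 dpE powR_div ?(ltW D0)// (powRN 4) in H.
have rN' := rN; set A := _ `^ (N%:R + _) in A0 H *; set rn := r ^+ N in H rN' *.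
set r1 := r `^ _ in rp H; set d1 := d `^ _ in dq H *; set D1 := D `^ _ in Dq H *.
set f1 := 4 `^ _ in f4 H *; set M := m (d / 4) in H *.
(* The inverse of the coefficient of [M] on the left of [H]. *)
pose Z := A * 8 * f1 / (D1 * d * mu0 * r1).
have Z0 : 0 <= Z by rewrite /Z divr_ge0 ?mulr_ge0 ?(ltW A0) ?(ltW f4) ?(ltW Dq) ?(ltW d0) ?(ltW mu00) ?(ltW rp).
have := ler_wpM2l Z0 H.
have -> : Z * (A^-1 * rn^-1 * r1 * (D1 / f1 / 2 * (d / 4)) * (mu0 * rn) * M) = M.
  by rewrite /Z; field; rewrite !gt_eqF.
move=> /le_trans; apply; rewrite le_eqVlt; apply/orP; left; apply/eqP.
by rewrite /Z; field; rewrite !gt_eqF.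
Qed.

End FixedBall.

(** The high set makes the level set at [d / 4] small; self-interaction then drives the iteration to
    [d / 2], where the level set is null. *)
Lemma growth_everywhere (mu0 : R) : 0 < mu0 -> exists d0 : R, 0 < d0 <= 8^-1 /\
  forall x0 r D O F (w : 'rV[R]_N -> R), 0 < r -> 0 < D ->
  energy_solution mu p s O F w -> 0 <= F ->
  F <= (d0 * D) `^ (p - 1) * r `^ (- (p * s)) ->
  (forall x, cube x0 r x -> 0 <= w x) ->
  (forall y, ~ cube x0 r y ->
    - (d0 * D) * (`|y - x0| / r) `^ (p * s / (2 * (p - 1))) <= w y) ->
  {ae mu, forall x : T, cube x0 (r / 2) x -> ~ O x -> d0 * D <= w x} ->
  ((mu0 * r ^+ N)%:E <= mu (high_set x0 r w D))%E ->
  {ae mu, forall x : T, cube x0 (r / 8) x -> d0 * D / 4 <= w x}.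
Proof.
move=> mu00; have [C [C0 hC]] := gain_integral hmu s01 p1.
pose C2 : R := C * N%:R `^ (N%:R + p * s) * 2 `^ (1 + p * s / N%:R) * 2 / 2^-1 `^ (p - 1).
have C20 : 0 < C2 by rewrite divr_gt0 ?powR_gt0// !mulr_gt0 ?powR_gt0.
have b0 : 0 < p * s / N%:R by rewrite divr_gt0// mulr_gt0.
have [nu [nu0 hnu]] := degiorgi_iteration p0 b0 C20.
pose C3 : R := C * (2 * N%:R) `^ (N%:R + p * s) * 8 * 4 `^ (p - 1) / mu0.
have C30 : 0 < C3 by rewrite divr_gt0// !mulr_gt0 ?powR_gt0// mulr_gt0.
(* The entry [1/8] ensures [8 d <= D]; the other brings the starting measure [C3 d0^(p-1)] below the
   threshold [nu] of the iteration. *)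
pose d0 : R := Num.min 8^-1 ((nu / C3) `^ (p - 1)^-1).
have d00 : 0 < d0 by rewrite lt_min invr_gt0 ltr0n powR_gt0// divr_gt0.
have d08 : d0 <= 8^-1 by rewrite ge_min lexx.
have d0nu : C3 * d0 `^ (p - 1) <= nu.
  rewrite mulrC -ler_pdivlMr//.
  have -> : nu / C3 = ((nu / C3) `^ (p - 1)^-1) `^ (p - 1).
    by rewrite -powRrM mulVf ?gt_eqF// powRr1// divr_ge0 ?ltW.
  by rewrite ge0_ler_powR ?nnegrE ?(ltW q0) ?(ltW d00) ?powR_ge0// ge_min lexx orbT.
exists d0; split; first by rewrite d00.
move=> x0 r D O F w r0 D0 sw F0 FD w0 wtail wO hH.
have mw : measurable_fun [set: T] (w : T -> R) by case: sw.
pose d := d0 * D; have dp : 0 < d by rewrite mulr_gt0.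
have dD : 8 * d <= D.
  by rewrite /d mulrA ler_piMl ?(ltW D0)//; move: d08; lra.
have gle h : 0 <= h -> (\int[(mu \x mu)%E]_z (gain p s x0 r d w h D z)%:E <=
   (C * d `^ p * r `^ (- (p * s)))%:E * mu (low_set x0 r d w h))%E.
  by move=> h0; apply: (hC x0 r d w h D O F).
have rN : 0 < r ^+ N by exact: exprn_gt0.
pose Y h := low_measure mu x0 r d w h / r ^+ N.
have Yd : Y (d / 2) <= 0.
  apply: hnu => //.
  - by move=> h; rewrite divr_ge0 ?low_measure_ge0// ltW.
  - move=> h h' h0 hh'; rewrite ler_pM2r ?invr_gt0//.
    by apply: low_measure_mono => //; exact: ltW.
  - by move=> h h' h0 hh' Y2;
    exact: (low_measure_step r0 dp C0 mw w0 gle h0 hh' Y2).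
  - apply: le_trans d0nu; have dE : d / D = d0 by rewrite /d mulfK// gt_eqF.
    have := low_measure_start r0 dp dD C0 mw w0 gle mu00 hH.
    by rewrite dE.
have mz : mu (low_set x0 r d w (d / 2)) = 0%E.
  rewrite low_measureE//; congr EFin; apply/eqP; rewrite eq_le low_measure_ge0 andbT.
  by move: Yd; rewrite /Y pmulr_lle0 ?invr_gt0.
exists (low_set x0 r d w (d / 2)); split => //; first exact: measurable_low_set.
move=> x /= /not_implyP[xr /negP]; rewrite -ltNge => wx.
have xr' : cube x0 r x by rewrite /cube/= in xr *; move: r0 xr; lra.
split => //; apply: (lt_le_trans wx); rewrite -/d /tent.
(* On [cube x0 (r / 8)] the tent is at least [3 d / 4], so lying outside the level set at [d / 2]
   means [w >= d / 4]. *)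
have : 2 * `|x - x0| / r <= 1 / 4.
  by rewrite ler_pdivrMr//; move: xr; rewrite /cube/=; move: r0; lra.
move=> h; have : d * (2 * `|x - x0| / r) <= d * (1 / 4) by rewrite ler_wpM2l// ltW.
by rewrite mulrBr mulr1; move: dp; lra.
Qed.

End Growth.

(** * Decay of the oscillation *)

Lemma ae_le_measure {R : realType} d (T : measurableType d)
    (mu : {measure set T -> \bar R}) (A B : set T) :
  measurable A -> measurable B -> {ae mu, forall x, A x -> B x} ->
  (mu A <= mu B)%E.
Proof.
move=> mA mB [C [mC C0 AB]].
have -> : mu B = (mu B + mu C)%E by rewrite C0 adde0.
apply: le_trans (measureU2 mu mB mC); apply: le_measure; rewrite ?inE//.
  exact: measurableU.
move=> x Ax; have [Bx|Bx] := pselect (B x); first by left.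
by right; apply: AB => /(_ Ax).
Qed.

Section Oscillation.
Context {R : realType} {N : nat}.
Local Notation T := (BorelRN R N).
Variable mu : {sigma_finite_measure set T -> \bar R}.
Hypothesis hmu : lebesgue_on_boxes mu.
Variables p s : R.
Hypotheses (N0 : (0 < N)%N) (s01 : 0 < s < 1) (p1 : 1 < p).

Let p0 : 0 < p. Proof. exact: lt_trans p1. Qed.
Let s0 : 0 < s. Proof. by case/andP: s01. Qed.
Let q0 : 0 < p - 1. Proof. by rewrite subr_gt0. Qed.

Local Notation eta := (p * s / (2 * (p - 1))).

Let eta0 : 0 < eta. Proof. by rewrite divr_gt0 ?mulr_gt0. Qed.

(** The function is raised to the assumed lower bounds, [0] in the cube and the tail profile
    outside; this alters it on a null set only, and [growth_everywhere] applies. *)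
Lemma growth (mu0 : R) : 0 < mu0 -> exists k : R, 0 < k <= 8^-1 /\
  forall x0 r D O F (w : 'rV[R]_N -> R), 0 < r -> 0 < D ->
  energy_solution mu p s O F w -> 0 <= F ->
  F <= (k * D) `^ (p - 1) * r `^ (- (p * s)) ->
  {ae mu, forall x : T, cube x0 r x -> 0 <= w x} ->
  {ae mu, forall y : T, ~ cube x0 r y ->
    - (k * D) * (`|(y : 'rV[R]_N) - x0| / r) `^ eta <= w y} ->
  {ae mu, forall x : T, cube x0 (r / 2) x -> ~ O x -> k * D <= w x} ->
  ((mu0 * r ^+ N)%:E <= mu (high_set x0 r w D))%E ->
  {ae mu, forall x : T, cube x0 (r / 8) x -> k * D / 4 <= w x}.
Proof.
move=> mu00; have [k [k08 H]] := growth_everywhere hmu N0 s01 p1 mu00.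
exists k; split => // x0 r D O F w r0 D0 sw F0 FD w0 wtail wO hH.
have mw : measurable_fun [set: T] (w : T -> R) by case: sw.
pose lo (y : 'rV[R]_N) : R := - (k * D) * (`|y - x0| / r) `^ eta.
pose w' (x : 'rV[R]_N) : R :=
  Num.max (w x) 0 * \1_(cube x0 r) x + Num.max (w x) (lo x) * \1_(~` cube x0 r) x.
have w'in x : cube x0 r x -> w' x = Num.max (w x) 0.
  by move=> xr; rewrite /w' !indicE mem_set// memNset ?mulr1 ?mulr0 ?addr0//=; apply.
have w'out x : ~ cube x0 r x -> w' x = Num.max (w x) (lo x).
  by move=> xr; rewrite /w' !indicE memNset// mem_set// mulr1 mulr0 add0r.
have mw' : measurable_fun [set: T] (w' : T -> R).
  apply: measurable_funD; apply: measurable_funM.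
  - exact: measurable_maxr.
  - by apply: measurable_indic; exact: measurable_cube.
  - apply: measurable_maxr => //; apply: measurable_funM => //.
    apply: (measurableT_comp (measurable_powR _)); apply: measurable_funM => //.
    exact: measurable_dist.
  - by apply: measurable_indic; apply: measurableC; exact: measurable_cube.
have ww' : {ae mu, forall x : T, w x = w' x}.
  apply: filterS2 w0 wtail => x h1 h2; have [xr|xr] := pselect (cube x0 r x).
    by rewrite w'in// max_l// h1.
  by rewrite w'out// max_l// h2.
have hw' : {ae mu, forall x : T, cube x0 (r / 8) x -> k * D / 4 <= w' x}.
  apply: (H x0 r D O F w') => //.
  - exact: energy_solution_ae sw.
  - by move=> x xr; rewrite w'in// le_max lexx orbT.
  - by move=> y yr; rewrite w'out// le_max lexx orbT.
  - by apply: filterS2 ww' wO => x -> h xr Ox; exact: h.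
  - apply: (le_trans hH); apply: le_measure; rewrite ?inE.
    + exact: measurable_high_set.
    + exact: measurable_high_set.
    + by move=> x [xr wx]; split => //; rewrite w'in// le_max wx.
by apply: filterS2 ww' hw' => x ->.
Qed.

(* The second clause controls the tail; rescaling by [8] multiplies it by [8^eta], which
   is what absorbs the loss from shrinking [b - a] in [osc_bound_step]. *)
Definition osc_bound (u : 'rV[R]_N -> R) (k : R) x0 r a b : Prop :=
  {ae mu, forall x : T, cube x0 r x -> a <= u x <= b} /\
  {ae mu, forall y : T, ~ cube x0 r y ->
    a - k * (b - a) * (`|(y : 'rV[R]_N) - x0| / r) `^ eta <= u y <=
    b + k * (b - a) * (`|(y : 'rV[R]_N) - x0| / r) `^ eta}.

(** The cube has measure [(2 r)^N >= 2 r^N], as [N >= 1]. *)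
Let half_cube x0 r (A B : set T) : 0 < r -> measurable A -> measurable B ->
  cube x0 r `<=` A `|` B ->
  ((r ^+ N)%:E <= mu A)%E \/ ((r ^+ N)%:E <= mu B)%E.
Proof.
move=> r0 mA mB AB; apply: contrapT => /not_orP[/negP + /negP].
rewrite -!ltNge => hA hB.
have : (mu (cube x0 r) <= mu A + mu B)%E.
  apply: (le_trans _ (measureU2 mu mA mB)); apply: le_measure; rewrite ?inE//.
    exact: measurable_cube.
  exact: measurableU.
rewrite leNgt => /negP; apply; rewrite mu_cube ?(ltW r0)//.
apply: (lt_le_trans (lteD hA hB)); rewrite -EFinD lee_fin exprMn.
rewrite -mulr2n -[X in X <= _]mulr_natl ler_wpM2r ?exprn_ge0 ?(ltW r0)//.
rewrite -natrX ler_nat; case: N N0 => // n _; rewrite expnS leq_pmulr// expn_gt0//.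
Qed.

(* Off [O] the solution vanishes, so an exterior cube lies in the upper or in the lower
   half of the range [a, b] according to the sign of [a + b]; the truncation at the
   other end then vanishes off [O] and is an admissible test function. *)
Lemma osc_step (c : R) : 0 < c -> exists k : R, 0 < k <= 8^-1 /\
  forall (O : set 'rV[R]_N) F (u : 'rV[R]_N -> R) x0 r a b, 0 < r -> a < b ->
  energy_solution mu p s O F u -> {ae mu, forall x : T, ~ O x -> u x = 0} ->
  0 <= F -> F <= (k * (b - a)) `^ (p - 1) * r `^ (- (p * s)) ->
  osc_bound u k x0 r a b ->
  cube x0 (r / 2) `<=` O \/ (exists z, cube z (c * r) `<=` cube x0 r `\` O) ->
  {ae mu, forall x : T, cube x0 (r / 8) x -> a + k * (b - a) / 4 <= u x} \/
  {ae mu, forall x : T, cube x0 (r / 8) x -> u x <= b - k * (b - a) / 4}.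
Proof.
(* [1] is the fraction given by [half_cube] when the half cube lies in [O], and [(2 c)^N] that of
   the exterior cube; one [k] must serve both. *)
move=> c0; pose mu0 : R := Num.min 1 ((2 * c) ^+ N).
have mu00 : 0 < mu0 by rewrite lt_min ltr01 exprn_gt0// mulr_gt0.
have [k [k08 H]] := growth mu00; exists k; split => //.
move=> O F u x0 r a b r0 ab su u0 F0 FD [ub utail] alt.
have rN : 0 <= r ^+ N by rewrite exprn_ge0// ltW.
have D0 : 0 < b - a by rewrite subr_gt0.
have /andP[k0 k8] := k08.
have kD : 0 < k * (b - a) by rewrite mulr_gt0.
have kD8 : k * (b - a) <= (b - a) / 8.
  by rewrite mulrC ler_wpM2l// ltW.
have su1 := energy_solutionB a su.
have su2 := energy_solutionB (- b) (energy_solutionN su).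
have mu1 : measurable_fun [set: T] ((fun x => u x - a) : T -> R) by case: su1.
have mu2 : measurable_fun [set: T] ((fun x => - u x - - b) : T -> R) by case: su2.
have low : {ae mu, forall x : T, cube x0 (r / 2) x -> ~ O x -> a + k * (b - a) <= u x} ->
    ((mu0 * r ^+ N)%:E <= mu (high_set x0 r (fun x => (u x - a)%R) (b - a)))%E ->
    {ae mu, forall x : T, cube x0 (r / 8) x -> a + k * (b - a) / 4 <= u x}.
  move=> h1 h2.
  have E : {ae mu, forall x : T, cube x0 (r / 8) x -> k * (b - a) / 4 <= u x - a}.
    apply: (H x0 r (b - a) O F) => //.
    - by apply: filterS ub => x h xr; rewrite subr_ge0; case/andP: (h xr).
    - apply: filterS utail => y h yr; case/andP: (h yr) => h3 _.
      by rewrite lerBrDr mulNr addrC.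
    - by apply: filterS h1 => x h xr Ox; rewrite lerBrDr addrC h.
  by apply: filterS E => x h xr; rewrite addrC -lerBrDr h.
have high : {ae mu, forall x : T, cube x0 (r / 2) x -> ~ O x -> u x <= b - k * (b - a)} ->
    ((mu0 * r ^+ N)%:E <= mu (high_set x0 r (fun x => (- u x - - b)%R) (b - a)))%E ->
    {ae mu, forall x : T, cube x0 (r / 8) x -> u x <= b - k * (b - a) / 4}.
  move=> h1 h2.
  have E : {ae mu, forall x : T, cube x0 (r / 8) x -> k * (b - a) / 4 <= - u x - - b}.
    apply: (H x0 r (b - a) O F) => //.
    - apply: filterS ub => x h xr; case/andP: (h xr) => _ h3.
      by rewrite opprK addrC subr_ge0.
    - apply: filterS utail => y h yr; case/andP: (h yr) => _.
      by rewrite mulNr; set t := _ * _; lra.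
    - by apply: filterS h1 => x h xr Ox; have := h xr Ox; lra.
  by apply: filterS E => x h xr; have := h xr; lra.
have mA := measurable_high_set x0 r mu1 (b - a).
have mB := measurable_high_set x0 r mu2 (b - a).
have mu0r : mu0 * r ^+ N <= r ^+ N by rewrite ler_piMl// ge_min lexx.
case: alt => [inO|[z zO]].
  have AB : cube x0 r `<=` high_set x0 r (fun x => (u x - a)%R) (b - a) `|`
      high_set x0 r (fun x => (- u x - - b)%R) (b - a).
    move=> x xr; have [h|h] := leP ((b - a) / 2) (u x - a); [left|right]; split => //.
    by move: h; lra.
  case: (half_cube r0 mA mB AB) => h; [left; apply: low|right; apply: high];
    try (by apply: aeW => x /inO);
    by apply: le_trans h; rewrite lee_fin.
have ext (v : 'rV[R]_N -> R) : measurable_fun [set: T] (v : T -> R) ->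
    {ae mu, forall x : T, ~ O x -> (b - a) / 2 <= v x} ->
    ((mu0 * r ^+ N)%:E <= mu (high_set x0 r v (b - a)))%E.
  move=> mv hv; apply: (@le_trans _ _ (mu (cube z (c * r)))).
    rewrite mu_cube ?mulr_ge0 ?(ltW c0) ?(ltW r0)// lee_fin mulrA [leRHS]exprMn.
    by rewrite ler_wpM2r// ge_min lexx orbT.
  apply: ae_le_measure; [exact: measurable_cube|exact: measurable_high_set|].
  by apply: filterS hv => x h /zO[xr Ox]; split => //; exact: h.
have [ab0|ab0] := leP (a + b) 0; [left; apply: low|right; apply: high].
- by apply: filterS u0 => x h _ Ox; rewrite h//; move: kD8 ab0 D0; lra.
- by apply: ext => //; apply: filterS u0 => x h Ox; rewrite h//; move: ab0; lra.
- by apply: filterS u0 => x h _ Ox; rewrite h//; move: kD8 ab0 D0; lra.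
- by apply: ext => //; apply: filterS u0 => x h Ox; rewrite h//; move: ab0; lra.
Qed.

(** Each end moves by at most [(1 - tau) (b - a)], and the new tail allowance must absorb this.
    Inside the old cube [1 - k / 4 <= tau] suffices. Outside it the old tail is still to be paid
    for, and what remains is exactly [k (tau 8^eta - 1)], whence the second condition on [tau]. *)
Lemma osc_bound_step (k tau a b a' b' r : R) (u : 'rV[R]_N -> R) x0 :
  0 < r -> a < b -> 0 < k <= 8^-1 -> 1 - k / 4 <= tau < 1 ->
  1 - tau <= k * (tau * 8 `^ eta - 1) ->
  a <= a' -> b' <= b -> b' - a' = tau * (b - a) ->
  {ae mu, forall x : T, cube x0 (r / 8) x -> a' <= u x <= b'} ->
  osc_bound u k x0 r a b -> osc_bound u k x0 (r / 8) a' b'.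
Proof.
move=> r0 ab /andP[k0 k8] /andP[tk t1] tau_eta aa bb bab u1 [u2 u3]; split => //.
have D0 : 0 < b - a by rewrite subr_gt0.
have e0 : 0 < 8 `^ eta :> R by rewrite powR_gt0.
have a1 : a' - a <= (1 - tau) * (b - a) by move: bab bb; lra.
have b1 : b - b' <= (1 - tau) * (b - a) by move: bab aa; lra.
apply: filterS2 u2 u3 => y h2 h3 yr.
have y8 : r / 8 < `|y - x0|.
  by move: yr; rewrite /cube/= => /negP; rewrite -ltNge.
have -> : `|y - x0| / (r / 8) = 8 * (`|y - x0| / r) by field; rewrite gt_eqF.
set t := `|y - x0| / r; have t8 : 1 <= 8 * t.
  by rewrite /t mulrA ler_pdivlMr// mul1r; move: y8; lra.
apply/andP; rewrite bab; have [yr'|yr'] := pselect (cube x0 r y).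
  have /andP[h4 h5] := h2 yr'.
  have : (1 - tau) * (b - a) <= k * (tau * (b - a)) * (8 * t) `^ eta.
    have T1 : 1 <= (8 * t) `^ eta by rewrite -[leLHS](powRr0 (8 * t)) ler_powR// ltW.
    apply: (@le_trans _ _ (k * (tau * (b - a)))); last first.
      by rewrite ler_peMr// !mulr_ge0 ?(ltW k0) ?(ltW D0)//; move: tk k8; lra.
    rewrite mulrA ler_wpM2r ?(ltW D0)//.
    have : k * (1 - k / 4) <= k * tau by rewrite ler_wpM2l// ltW.
    have : k * k <= k * 8^-1 by rewrite ler_wpM2l// ltW.
    by move: tk k0; lra.
  by move: a1 b1 h4 h5; split; lra.
have /andP[h4 h5] := h3 yr'; rewrite -/t in h4 h5.
have t1' : 1 <= t by apply: out_ratio.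
have T1 : 1 <= t `^ eta by rewrite -[leLHS](powRr0 t) ler_powR// ltW.
have t0 : 0 <= t by exact: le_trans t1'.
rewrite powRM//.
have : (1 - tau) * (b - a) <= k * (tau * 8 `^ eta - 1) * (b - a) * t `^ eta.
  apply: (@le_trans _ _ (k * (tau * 8 `^ eta - 1) * (b - a))).
    by rewrite ler_wpM2r// ltW.
  rewrite ler_peMr// mulr_ge0 ?(ltW D0)//; apply: le_trans tau_eta.
  by rewrite subr_ge0 ltW.
have -> : k * (tau * 8 `^ eta - 1) * (b - a) * t `^ eta =
  k * (tau * (b - a)) * (8 `^ eta * t `^ eta) - k * (b - a) * t `^ eta by ring.
set X := k * (tau * (b - a)) * _; set Z := k * (b - a) * _.
rewrite -/Z in h4 h5.
by move: a1 b1 h4 h5; split; lra.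
Qed.

End Oscillation.

(** * Exterior cubes at the boundary *)

Lemma MVT_segment {R : realType} {N : nat} (g : 'rV[R]_N -> R^o) (a v : 'rV[R]_N) :
  (forall x, differentiable g x) ->
  exists t : R, 0 < t < 1 /\ g (a + v) - g a = 'd g (a + t *: v) v.
Proof.
move=> dg; pose h (t : R) : R := g (a + t *: v).
have E (x : R) : (fun e : R => e^-1 *: (h (e *: 1 + x) - h x)) =
    (fun e : R => e^-1 *: (g (e *: v + (a + x *: v)) - g (a + x *: v))).
  apply/funext => e; rewrite /h; congr (_ *: (g _ - _)).
  by rewrite [e *: 1]mulr1 scalerDl addrCA.
have dh x : is_derive x (1 : R) h ('d g (a + x *: v) v).
  have dv := @diff_derivable _ _ _ g (a + x *: v) v (dg _).
  apply: DeriveDef; first by rewrite /derivable E.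
  rewrite -(deriveE _ (dg _)) /derive; congr (lim _).
  by rewrite E.
have ch : {within `[0, 1], continuous h}.
  apply: continuous_subspaceT => x.
  by apply: differentiable_continuous; apply/derivable1_diffP; case: (dh x).
have [c c01 hc] := @MVT _ h (fun t => 'd g (a + t *: v) v) 0 1 ltr01 (fun x _ => dh x) ch.
exists c; split; first by move: c01; rewrite in_itv.
by move: hc; rewrite /h scale1r scale0r addr0 subr0 mulr1.
Qed.

(** First-order Taylor bound: the mean value theorem along the segment, then the Lipschitz bound on
    the derivative. [C11_fun] puts no sign on its constant, hence [Num.max L 0]. *)
Lemma C11_fun_lower {R : realType} {N : nat} (g : 'rV[R]_N -> R^o) : C11_fun g ->
  exists L : R, 0 <= L /\ forall a v : 'rV[R]_N,
    g a + 'd g a v - L * (N%:R * `|v|) ^+ 2 <= g (a + v).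
Proof.
move=> [dg [L hL]]; exists (Num.max L 0); split; first by rewrite le_max lexx orbT.
move=> a v; have [t [/andP[t0 t1] ht]] := MVT_segment a v dg.
have e0 : a + t *: v - a = t *: v by rewrite addrAC subrr add0r.
have h := hL (a + t *: v) a v.
have e1 : enorm (t *: v) <= N%:R * `|v|.
  rewrite (le_trans (enorm_le _))// ler_wpM2l// normrZ gtr0_norm//.
  by rewrite ler_piMl// ltW.
have e2 : L * enorm (a + t *: v - a) * enorm v <= Num.max L 0 * (N%:R * `|v|) ^+ 2.
  rewrite e0 expr2 -mulrA; have P0 : 0 <= enorm (t *: v) * enorm v.
    by rewrite mulr_ge0// enorm_ge0.
  apply: (@le_trans _ _ (Num.max L 0 * (enorm (t *: v) * enorm v))).
    by rewrite ler_wpM2r// le_max lexx.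
  rewrite ler_wpM2l ?le_max ?lexx ?orbT//.
  by apply: ler_pM; rewrite ?enorm_ge0 ?enorm_le.
have {e2}h := le_trans h e2.
have aux (A B G G' X : R) : `|A - B| <= X -> G' - G = A -> G + B - X <= G'.
  by rewrite ler_norml; lra.
exact: aux h ht.
Qed.

Lemma mulmx_norm_le {R : realType} {N : nat} (x : 'rV[R]_N) (M : 'M[R]_N) :
  (forall i j, `|M i j| <= 1) -> `|x *m M| <= N%:R * `|x|.
Proof.
move=> M1; apply/rvnorm_le; first by rewrite mulr_ge0.
move=> j; rewrite mxE (le_trans (ler_norm_sum _ _ _))//.
apply: (@le_trans _ _ (\sum_(i < N) `|x|)); last first.
  by rewrite sumr_const card_ord mulr_natl.
apply: ler_sum => i _; rewrite normrM -[leRHS]mulr1.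
by apply: ler_pM => //; exact: rvcoord_le.
Qed.

Lemma orthogonal_entry_le {R : realType} {N : nat} (Q : 'M[R]_N) : orthogonal_mx Q ->
  forall i j, `|Q i j| <= 1.
Proof.
move=> QQ i j; have := congr1 (fun M : 'M[R]_N => M i i) QQ; rewrite !mxE eqxx mulr1n => h.
rewrite -(@expr_le1 _ 2)// real_normK ?num_real// -[leRHS]h.
rewrite (bigD1 j)//= mxE expr2 lerDl sumr_ge0// => l _.
by rewrite mxE -expr2 sqr_ge0.
Qed.

Lemma compact_closure {R : realType} {N : nat} (O : set 'rV[R]_N) (M : R) :
  (forall x, O x -> `|x| <= M) -> compact (closure O).
Proof.
move=> OM; apply: bounded_closed_compact; last exact: closed_closure.
exists M; split; first exact: num_real.
move=> M' MM' x cx /=.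
have cl : closed [set x : 'rV[R]_N | `|x| <= M'].
  have -> : [set x : 'rV[R]_N | `|x| <= M'] = Num.norm @^-1` [set t | t <= M'] by [].
  by apply: closed_comp; [move=> y _; exact: norm_continuous|exact: closed_le].
suff : closure [set x : 'rV[R]_N | `|x| <= M'] x by rewrite -(closure_id _).1.
by apply: closureS cx => y /OM h; exact: le_trans h (ltW MM').
Qed.

Section ExteriorCubes.
Context {R : realType} {N : nat}.
Hypothesis N0 : (0 < N)%N.
Variable O : set 'rV[R]_N.
Hypotheses (oO : open O) (bO : bounded_domain O) (cO : C11_boundary O).

Let NR : 1 <= N%:R :> R. Proof. by rewrite ler1n. Qed.
Let NR0 : 0 < N%:R :> R. Proof. by rewrite ltr0n. Qed.

(** In the chart the centre is shifted by [rho = r / (2 N)]. A rotation costs a factor [N] in the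
    sup norm, so this radius becomes [r / (4 N) = rho / 2] in the rotated coordinates. *)
Definition has_exterior_cube (x : 'rV[R]_N) (r : R) : Prop :=
  exists z, cube z (r / (4 * N%:R ^+ 2)) `<=` cube x r `\` O.

(* The direction [n] is the sign vector of the inner normal [l] of the graph, so that
   [l (- rho n + xi) <= - |l|_1 (rho - |xi|)] with [|l|_1 >= 1]. *)
Lemma exterior_cube_local (xb : 'rV[R]_N) : (closure O `\` O) xb ->
  exists e : R, 0 < e /\ forall x1 r, `|x1 - xb| < e -> ~ O x1 -> 0 < r <= e ->
    has_exterior_cube x1 r.
Proof.
move=> /cO [rb [k [Q [g [rb0 [QQ [/C11_fun_lower[L [L0 gL]] chart]]]]]]].
have Q1 := orthogonal_entry_le QQ.
have QT1 i j : `|Q^T i j| <= 1 by rewrite mxE.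
have QTQ : Q^T *m Q = 1%:M by apply: mulmx1C.
pose Pr (y : 'rV[R]_N) : 'rV[R]_N := y - (y ord0 k) *: delta_mx ord0 k.
have PrD y1 y2 : Pr (y1 + y2) = Pr y1 + Pr y2.
  by rewrite /Pr mxE scalerDl opprD addrACA.
have Prle y : `|Pr y| <= `|y|.
  apply/rvnorm_le => // i; rewrite !mxE eqxx/=; case: eqVneq => [->|_].
    by rewrite mulr1 subrr normr0.
  by rewrite mulr0 subr0 rvcoord_le.
(* The first entry keeps all points within the chart radius [rb], the factor [N] comparing the
   norms. The second bounds the quadratic Taylor error at displacement [3 rho / 2] by [rho / 2], the
   linear gain. *)
pose e : R := Num.min (rb / (2 * N%:R) / 2) (9 * N%:R ^+ 2 * (L + 1))^-1.
have e0 : 0 < e.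
  by rewrite lt_min !divr_gt0 ?mulr_gt0//= invr_gt0 !mulr_gt0 ?exprn_gt0// ltr_wpDl.
exists e; split => // x1 r x1e Ox1 /andP[r0 re].
have near_xb x : `|x - x1| <= r -> enorm (x - xb) < rb.
  move=> xr; apply: (le_lt_trans (enorm_le _)).
  rewrite mulrC -ltr_pdivlMr//.
  have -> : x - xb = (x - x1) + (x1 - xb) by rewrite addrA subrK.
  apply: (le_lt_trans (ler_normD _ _)).
  apply: (@lt_le_trans _ _ (e + e)); first by rewrite ler_ltD// (le_trans xr).
  have : e <= rb / (2 * N%:R) / 2 by rewrite ge_min lexx.
  have -> : rb / (2 * N%:R) / 2 = (rb / N%:R) / 4 by field; rewrite gt_eqF.
  have : 0 < rb / N%:R by rewrite divr_gt0.
  lra.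
pose y1 := (x1 - xb) *m Q.
have g1 : y1 ord0 k <= g (Pr y1).
  rewrite leNgt; apply/negP => h; apply: Ox1.
  by apply/(chart x1); [apply: near_xb; rewrite subrr normr0 ltW|exact: h].
pose A : {linear 'rV[R]_N -> R^o} := 'd g (Pr y1).
(* Coefficients of [l(z) = z_k - A (Pr z)]. [Pr] kills the direction [k], so [c k = 1], whatever the
   slope of the graph. *)
pose c (i : 'I_N) : R := (i == k)%:R - A (Pr (delta_mx ord0 i)).
have lE (z : 'rV[R]_N) : z ord0 k - A (Pr z) = \sum_(i < N) z ord0 i * c i.
  pose B (z : 'rV[R]_N) : R := A (Pr z).
  have BE : B z = \sum_(i < N) z ord0 i * B (delta_mx ord0 i).
    rewrite /B {1}[z]row_sum_delta.
    have -> : Pr (\sum_i z 0 i *: delta_mx 0 i) = \sum_i z 0 i *: Pr (delta_mx 0 i).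
      rewrite /Pr; under [RHS]eq_bigr do rewrite scalerBr.
      rewrite sumrB; congr (_ - _).
      rewrite summxE scaler_suml; apply: eq_bigr => i _.
      by rewrite !mxE scalerA.
    rewrite linear_sum; apply: eq_bigr => i _; by rewrite linearZ.
  rewrite -/(B z) BE /c.
  under [RHS]eq_bigr do rewrite mulrBr.
  rewrite sumrB; congr (_ - _).
  rewrite (bigD1 k)//= eqxx mulr1 big1 ?addr0// => i ik.
  by rewrite (negbTE ik) mulr0.
have ck : c k = 1.
  rewrite /c eqxx.
  have -> : Pr (delta_mx ord0 k) = 0 by rewrite /Pr mxE !eqxx scale1r subrr.
  by rewrite linear0 subr0.
pose S : R := \sum_(i < N) `|c i|.
have S1 : 1 <= S.
  by rewrite /S (bigD1 k)//= ck normr1 lerDl sumr_ge0.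
pose rho : R := r / (2 * N%:R).
have rho0 : 0 < rho by rewrite divr_gt0// mulr_gt0.
pose n : 'rV[R]_N := \row_i Num.sg (c i).
have n1 : `|n| <= 1.
  by apply/rvnorm_le => // i; rewrite mxE normr_sg lern1 leq_b1.
exists (x1 - rho *: (n *m Q^T)) => x xz; set w := x - (x1 - rho *: (n *m Q^T)) in xz.
have xE : x = x1 + (w - rho *: (n *m Q^T)).
  rewrite /w; move: (rho *: _) => t.
  by apply/rowP => i; rewrite !mxE; ring.
have wr : `|w| <= r / (4 * N%:R ^+ 2) by [].
have w4 : `|w| <= r / 4.
  apply: (le_trans wr); rewrite ler_pM2l// lef_pV2 ?posrE ?mulr_gt0 ?exprn_gt0//.
  by rewrite ler_peMr// exprn_ege1.
have nr : `|rho *: (n *m Q^T)| <= r / 2.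
  rewrite normrZ gtr0_norm//; apply: (@le_trans _ _ (rho * (N%:R * 1))).
    rewrite ler_wpM2l ?(ltW rho0)//; apply: (le_trans (mulmx_norm_le _ QT1)).
    by rewrite ler_wpM2l.
  by rewrite le_eqVlt; apply/orP; left; apply/eqP; rewrite /rho; field; rewrite gt_eqF.
have xr : `|x - x1| <= r.
  rewrite xE addrC addKr (le_trans (ler_normB _ _))//.
  by move: w4 nr r0; lra.
split; first exact: xr.
move=> Ox; have := (chart x (near_xb x xr)).1 Ox => /=.
pose xi := w *m Q; pose z := xi - rho *: n.
have -> : (x - xb) *m Q = y1 + z.
  rewrite xE /y1 /z /xi -addrA addrCA addrC mulmxDl; congr (_ + _).
  by rewrite mulmxBl -scalemxAl -mulmxA QTQ mulmx1.
rewrite -/(Pr (y1 + z)) PrD mxE; apply/negP; rewrite -leNgt.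
have xir : `|xi| <= rho / 2.
  apply: (le_trans (mulmx_norm_le _ Q1)).
  apply: (@le_trans _ _ (N%:R * (r / (4 * N%:R ^+ 2)))); first by rewrite ler_wpM2l.
  by rewrite le_eqVlt; apply/orP; left; apply/eqP; rewrite /rho; field; rewrite gt_eqF.
have lz : z ord0 k - A (Pr z) <= - (rho / 2).
  rewrite lE; apply: (@le_trans _ _ (\sum_(i < N) (- (rho / 2)) * `|c i|)).
    apply: ler_sum => i _.
    have -> : z ord0 i * c i = xi ord0 i * c i - rho * `|c i|.
      have -> : z ord0 i = xi ord0 i - rho * Num.sg (c i).
        by rewrite /z mxE; congr (_ + _); rewrite !mxE.
      by rewrite mulrBl -mulrA -normrEsg.
    have : xi ord0 i * c i <= rho / 2 * `|c i|.
      apply: (le_trans (ler_norm _)); rewrite normrM ler_wpM2r//.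
      exact: le_trans (rvcoord_le _ _) xir.
    by lra.
  by rewrite -mulr_sumr -/S mulNr lerN2 ler_peMr// divr_ge0// ltW.
have zr : `|z| <= 3 / 2 * rho.
  rewrite (le_trans (ler_normB _ _))// normrZ gtr0_norm//.
  have : rho * `|n| <= rho * 1 by rewrite ler_wpM2l// ltW.
  by move: xir; lra.
have quad : L * (N%:R * `|Pr z|) ^+ 2 <= rho / 2.
  have P1 : (N%:R * `|Pr z|) ^+ 2 <= (N%:R * (3 / 2 * rho)) ^+ 2.
    have p1 : 0 <= N%:R * `|Pr z| by rewrite mulr_ge0.
    have p2 : 0 <= N%:R * (3 / 2 * rho) by rewrite !mulr_ge0// ltW.
    rewrite lerXn2r ?nnegrE// ler_wpM2l//.
    exact: le_trans (Prle _) zr.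
  have re1 : rho <= (9 * N%:R ^+ 2 * (L + 1))^-1.
    apply: (@le_trans _ _ r); last by apply: (le_trans re); rewrite ge_min lexx orbT.
    rewrite ler_pdivrMr ?mulr_gt0// ler_peMr ?(ltW r0)//; move: NR; lra.
  have L1 : 0 < L + 1 by rewrite ltr_wpDl.
  have N2 : 0 < 9 * N%:R ^+ 2 * (L + 1) by rewrite !mulr_gt0 ?exprn_gt0.
  have re2 : 9 * N%:R ^+ 2 * (L + 1) * rho <= 1.
    by rewrite mulrC -ler_pdivlMr// mul1r.
  apply: (@le_trans _ _ ((L + 1) * (N%:R * (3 / 2 * rho)) ^+ 2)).
    by apply: ler_pM => //; rewrite lerDl.
  have -> : (L + 1) * (N%:R * (3 / 2 * rho)) ^+ 2 =
    (9 * N%:R ^+ 2 * (L + 1) * rho) * rho / 4 by field.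
  have : 9 * N%:R ^+ 2 * (L + 1) * rho * rho <= 1 * rho.
    by rewrite ler_wpM2r// ltW.
  by move: rho0; lra.
have aux (G G' Y B Z X h : R) : Y <= G -> G + B - X <= G' -> Z - B <= - h -> X <= h ->
    Y + Z <= G' by lra.
exact: (aux _ _ _ _ _ _ _ g1 (gL (Pr y1) (Pr z)) lz quad).
Qed.

(** Near-covering compactness of the boundary, with the filter of small positive [r], turns the
    local radii into a single one. *)
Lemma exterior_cube : exists e : R, 0 < e /\
  forall x, closure O x -> ~ O x -> forall r, 0 < r <= e -> has_exterior_cube x r.
Proof.
pose K := closure O `\` O.
have cK : compact K.
  have [_ [_ [_ [M hM]]]] := bO.
  apply: (@subclosed_compact _ _ (closure O)); last by move=> x [].
    by apply: closedI; [exact: closed_closure|exact: open_closedC].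
  by apply: (@compact_closure _ _ _ M) => x /hM; apply: le_trans; exact: enorm_ge.
have /compact_near_coveringP cov := cK.
have [|e /= e0 he] := cov R (0^'+) (fun r x => ~ O x -> has_exterior_cube x r) _.
  move=> xb Kxb; have [e [e0 he]] := exterior_cube_local Kxb.
  exists ([set x | `|x - xb| < e], [set r : R | 0 < r <= e]) => /=; last first.
    by move=> [x r] [/= h1 h2] h3; exact: he.
  split.
    apply/nbhs_ballP; exists e => //= y; rewrite mx_norm_ball /ball_ /= distrC.
    exact.
  by near=> r; apply/andP; split; near: r; [exact: nbhs_right_gt|exact: nbhs_right_le].
exists (e / 2); split; first by rewrite divr_gt0.
move=> x cx Ox r /andP[r0 re]; apply: (he r) => //=.
rewrite /ball_ /= sub0r normrN gtr0_norm//; move: re e0; lra.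
Unshelve. all: end_near.
Qed.

End ExteriorCubes.

(** * Iteration over scales *)

Section Decay.
Context {R : realType} {N : nat}.
Local Notation T := (BorelRN R N).
Variable mu : {sigma_finite_measure set T -> \bar R}.
Hypothesis hmu : lebesgue_on_boxes mu.
Variables p s : R.
Hypotheses (N0 : (0 < N)%N) (s01 : 0 < s < 1) (p1 : 1 < p).

Let p0 : 0 < p. Proof. exact: lt_trans p1. Qed.
Let s0 : 0 < s. Proof. by case/andP: s01. Qed.
Let q0 : 0 < p - 1. Proof. by rewrite subr_gt0. Qed.

Definition cube_alternative (O : set 'rV[R]_N) (c : R) (x0 : 'rV[R]_N) (r : R) : Prop :=
  cube x0 (r / 2) `<=` O \/ exists z, cube z (c * r) `<=` cube x0 r `\` O.

Lemma exists_contraction (k e : R) : 0 < k <= 8^-1 -> 0 < e ->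
  exists alpha, [/\ 0 < alpha <= s, 1 - k / 4 <= 8 `^ (- alpha) < 1 &
    1 - 8 `^ (- alpha) <= k * (8 `^ (- alpha) * 8 `^ e - 1)].
Proof.
move=> /andP[k0 k8] e0.
have lt1 (x : R) : 0 < x -> 8 `^ (- x) < 1.
  move=> x0; rewrite powRN invf_lt1 ?powR_gt0//.
  have one : 1 `^ x = 1 :> R by rewrite powR1.
  by rewrite -[ltLHS]one gt0_ltr_powR// ?nnegrE//; lra.
pose E : R := 8 `^ e.
have E1 : 1 < E.
  by have := lt1 _ e0; rewrite powRN invf_lt1 ?powR_gt0.
have kE : 0 < 1 + k * E by rewrite addr_gt0// mulr_gt0// (lt_trans ltr01).
(* Three numbers below [1]: the first gives [alpha <= s], the second is the required lower bound,
   and the third solves [1 - tau <= k (tau E - 1)] with equality. *)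
pose tau : R := Num.max (8 `^ (- s)) (Num.max (1 - k / 4) ((1 + k) / (1 + k * E))).
have t1 : tau < 1.
  rewrite !gt_max lt1//=; apply/andP; split; first by move: k0; lra.
  by rewrite ltr_pdivrMr// mul1r ltrD2l ltr_pMr.
have ts : 8 `^ (- s) <= tau by rewrite le_max lexx.
have tk : 1 - k / 4 <= tau by rewrite !le_max lexx !orbT.
have tE : (1 + k) / (1 + k * E) <= tau by rewrite !le_max lexx !orbT.
have t0 : 0 < tau by rewrite (lt_le_trans _ ts)// powR_gt0.
have ln8 : 0 < ln 8 :> R by rewrite ln_gt0//; lra.
pose alpha := - ln tau / ln 8.
have tauE : 8 `^ (- alpha) = tau.
  rewrite /powR gt_eqF//; have -> : - alpha * ln 8 = ln tau.
    by rewrite /alpha; field; rewrite gt_eqF.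
  by rewrite lnK.
exists alpha; rewrite tauE; split.
- rewrite divr_gt0 ?oppr_gt0 ?ln_lt0 ?t0//=.
  rewrite ler_pdivrMr// lerNl -mulNr.
  have -> : - s * ln 8 = ln (8 `^ (- s)) :> R by rewrite ln_powR.
  by rewrite ler_ln ?posrE ?powR_gt0.
- by rewrite tk.
- move: tE; rewrite ler_pdivrMr// -/E; lra.
Qed.

(** Induction on the scale, with three invariants: the width of [[a, b]], the smallness of [F]
    relative to width and scale, and the tail bound. [alpha] and [k] are chosen from [c] before the
    domain. *)
Lemma oscillation_decay (c : R) : 0 < c -> exists alpha k : R,
  [/\ 0 < alpha <= s, 0 < k & forall (O : set 'rV[R]_N) F (u : 'rV[R]_N -> R) x0 r L,
  0 < r -> 0 < L -> energy_solution mu p s O F u ->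
  {ae mu, forall x : T, ~ O x -> u x = 0} ->
  0 <= F -> F <= (k * L) `^ (p - 1) * r `^ (- (p * s)) ->
  {ae mu, forall x : T, `|u x| <= L / 2} ->
  (forall t, 0 < t <= r -> cube_alternative O c x0 t) ->
  forall n, exists a b, b - a = L * (8 `^ (- alpha)) ^+ n /\
    {ae mu, forall x : T, cube x0 (r / 8 ^+ n) x -> a <= u x <= b}].
Proof.
move=> c0; have [k [k08 H]] := osc_step hmu N0 s01 p1 c0.
have eta0 : 0 < p * s / (2 * (p - 1)) by rewrite divr_gt0 ?mulr_gt0.
have [alpha [als tau1 tau2]] := exists_contraction k08 eta0.
have [/andP[k0 k8] /andP[al0 als']] := (k08, als).
exists alpha, k; split => // O F u x0 r L r0 L0 su u0 F0 FL uL alt n.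
pose tau : R := 8 `^ (- alpha); rewrite -/tau in tau1 tau2 *.
have t0 : 0 < tau by rewrite powR_gt0.
suff [a [b [ab [Fn osc]]]] : exists a b, b - a = L * tau ^+ n /\
    F <= (k * (b - a)) `^ (p - 1) * (r / 8 ^+ n) `^ (- (p * s)) /\
    osc_bound mu p s u k x0 (r / 8 ^+ n) a b.
  by exists a, b; split => //; case: osc.
elim: n => [|n [a [b [ab [Fn osc]]]]].
  (* The global bound makes the tail clause trivial at the first scale. *)
  exists (- (L / 2)), (L / 2).
  have -> : L / 2 - - (L / 2) = L by field.
  rewrite !expr0 mulr1 divr1; split => //; split => //; split.
    by apply: filterS uL => x; rewrite ler_norml.
  apply: filterS uL => x; rewrite ler_norml => /andP[h1 h2] _.
  have : 0 <= k * (L / 2 - - (L / 2)) * (`|x - x0| / r) `^ (p * s / (2 * (p - 1))).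
    by rewrite !mulr_ge0 ?powR_ge0 ?(ltW k0)//; move: L0; lra.
  set X := _ * (_ `^ _) => X0; apply/andP; move: h1 h2 X0; split; lra.
have rn0 : 0 < r / 8 ^+ n by rewrite divr_gt0// exprn_gt0.
have D0 : 0 < b - a by rewrite ab mulr_gt0// exprn_gt0.
have ltab : a < b by rewrite -subr_gt0.
have rS : r / 8 ^+ n.+1 = r / 8 ^+ n / 8.
  by rewrite exprS; field; rewrite expf_neq0.
have altn : cube_alternative O c x0 (r / 8 ^+ n).
  apply: alt; rewrite rn0 ler_pdivrMr ?exprn_gt0// ler_peMr ?(ltW r0)//.
  by rewrite exprn_ege1// ler1n.
have step := H O F u x0 (r / 8 ^+ n) a b rn0 ltab su u0 F0 Fn osc altn.
have kt : 1 - tau <= k / 4 by move/andP: tau1 => [? _]; lra.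
have kt2 : (1 - tau) * (b - a) <= k * (b - a) / 4.
  by rewrite [k * _ / 4]mulrAC ler_wpM2r// ltW.
have t1 : 0 <= (1 - tau) * (b - a).
  by rewrite mulr_ge0 ?(ltW D0)// subr_ge0; case/andP: tau1 => _ /ltW.
(* The threshold on [F] is multiplied by [tau^(p-1) 8^(ps) = 8^(ps - alpha (p-1))], at least [1]
   since [alpha <= s]. *)
have FS : F <= (k * (tau * (b - a))) `^ (p - 1) * (r / 8 ^+ n.+1) `^ (- (p * s)).
  apply: (le_trans Fn); rewrite rS.
  have -> : k * (tau * (b - a)) = tau * (k * (b - a)) by ring.
  rewrite [(tau * _) `^ _]powRM ?mulr_ge0 ?(ltW t0) ?(ltW k0) ?(ltW D0)//.
  rewrite [(r / 8 ^+ n / 8) `^ _]powR_div ?(ltW rn0)// opprK.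
  set X := (k * _) `^ _; set Y := (r / _) `^ _.
  have X0 : 0 <= X * Y by rewrite mulr_ge0 ?powR_ge0.
  have -> : tau `^ (p - 1) * X * (Y * 8 `^ (p * s)) = tau `^ (p - 1) * 8 `^ (p * s) * (X * Y).
    by ring.
  rewrite ler_peMl// /tau -powRrM -powRD ?pnatr_eq0 ?implybT//.
  rewrite -[leLHS](powRr0 8) ler_powR ?ler1n//.
  have : alpha * (p - 1) <= s * (p - 1) by rewrite ler_wpM2r// ltW.
  by move: s0; lra.
have u1 := osc.1.
have cS : cube x0 (r / 8 ^+ n / 8) `<=` cube x0 (r / 8 ^+ n).
  by move=> x; rewrite /cube/=; move: rn0; set t := r / _; lra.
(* Only one end moves, by exactly [(1 - tau) (b - a)], which is at most the available gain
   [k (b - a) / 4]. *)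
case: step => h.
- exists (a + (1 - tau) * (b - a)), b; rewrite rS.
  have e1 : b - (a + (1 - tau) * (b - a)) = tau * (b - a) by ring.
  rewrite e1; split; first by rewrite ab exprS; ring.
  rewrite -rS; split => //; rewrite rS.
  apply: (osc_bound_step s01 p1 rn0 ltab k08 tau1 tau2) => //; first by rewrite lerDl.
  apply: filterS2 h u1 => x h1 h2 xr; have /andP[_ ->] := h2 (cS _ xr).
  by rewrite andbT (le_trans _ (h1 xr))// lerD2l.
- exists a, (b - (1 - tau) * (b - a)); rewrite rS.
  have e1 : b - (1 - tau) * (b - a) - a = tau * (b - a) by ring.
  rewrite e1; split; first by rewrite ab exprS; ring.
  rewrite -rS; split => //; rewrite rS.
  apply: (osc_bound_step s01 p1 rn0 ltab k08 tau1 tau2) => //; first by rewrite gerBl.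
  apply: filterS2 h u1 => x h1 h2 xr; have /andP[-> _] := h2 (cS _ xr).
  by rewrite (le_trans (h1 xr))// lerB.
Qed.

(** First exit from [O] along the segment from [x] to [z]: the exit point is outside because [O] is
    open, and in the closure because all earlier points are in [O]. *)
Lemma boundary_point_near (O : set 'rV[R]_N) (x z : 'rV[R]_N) : open O ->
  closure O x -> ~ O z -> exists y, [/\ closure O y, ~ O y & `|y - x| <= `|z - x|].
Proof.
move=> oO cx Oz; have [Ox|Ox] := pselect (O x); last first.
  by exists x; split => //; rewrite subrr normr0.
pose f (t : R) : 'rV[R]_N := x + t *: (z - x).
have cf : continuous f.
  move=> t; apply: cvgD; first exact: cvg_cst.
  by apply: cvgZr_tmp; exact: cvg_id.
pose S := [set t : R | 0 <= t <= 1 /\ ~ O (f t)].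
have S1 : S 1 by split; [rewrite ler01 lexx|rewrite /f scale1r addrCA subrr addr0].
have hS : has_inf S.
  by split; [exists 1|exists 0 => t [/andP[]]].
pose t0 := inf S.
have t00 : 0 <= t0 by apply: lb_le_inf; [exists 1|move=> t [/andP[]]].
have t01 : t0 <= 1 by apply: ge_inf => //; case: hS.
have nO : ~ O (f t0).
  move=> Of; have /nbhs_ballP[e /= e0 he] : nbhs t0 (f @^-1` O).
    by apply: cf; apply: open_nbhs_nbhs; split.
  have [t St tlt] := inf_adherent e0 hS.
  case: (St) => _; apply; apply: he; rewrite /ball/= distrC ger0_norm ?subr_ge0.
    by rewrite ltrBlDl.
  by apply: ge_inf => //; case: hS.
exists (f t0); split => //; last first.
  by rewrite /f addrC addKr normrZ ger0_norm// ler_piMl.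
have t0p : 0 < t0.
  rewrite lt_neqAle t00 andbT eq_sym; apply/eqP => t0z.
  by apply: nO; rewrite t0z /f scale0r addr0.
move=> B /cf /nbhs_ballP[e /= e0 he].
pose t := t0 - Num.min (e / 2) t0.
have m0 : 0 < Num.min (e / 2) t0 by rewrite lt_min t0p divr_gt0.
have tlt : t < t0 by rewrite gtrBl.
exists (f t); split.
  apply: contrapT => nOt; have : t0 <= t.
    apply: ge_inf; first by case: hS.
    by split => //; rewrite subr_ge0 ge_min lexx orbT/= (le_trans (ltW tlt)).
  by rewrite leNgt tlt.
apply: he; rewrite /ball/= /t opprB addrC subrK gtr0_norm//.
by rewrite gt_min ltr_pdivrMr// ltr_pMr// ltr1n.
Qed.

(** If the half cube leaves [O], some boundary point lies within [r / 2] of [x]. Its exterior cube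
    at scale [r / 2] lies in [cube x r], so the ratio [1 / (4 N^2)] is halved. *)
Lemma cube_alternative_closure (O : set 'rV[R]_N) : open O -> bounded_domain O ->
  C11_boundary O -> exists e : R, 0 < e /\ forall x r, closure O x -> 0 < r <= e ->
    cube_alternative O (8 * N%:R ^+ 2)^-1 x r.
Proof.
move=> oO bO cO; have [e [e0 he]] := exterior_cube N0 oO bO cO.
exists e; split => // x r cx /andP[r0 re].
have [inO|/existsNP[z /not_implyP[zr Oz]]] := pselect (cube x (r / 2) `<=` O); first by left.
right; have [y [cy Oy yx]] := boundary_point_near oO cx Oz.
have [|z' hz'] := he y cy Oy (r / 2).
  by rewrite divr_gt0//=; move: re r0; lra.
have NR0 : 0 < N%:R :> R by rewrite ltr0n.
exists z'; have -> : (8 * N%:R ^+ 2)^-1 * r = r / 2 / (4 * N%:R ^+ 2).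
  by field; rewrite gt_eqF.
move=> w /hz'[wy Ow]; split => //; rewrite /cube/= in wy zr *.
have -> : w - x = (w - y) + (y - x) by rewrite addrA subrK.
rewrite (le_trans (ler_normD _ _))// (le_trans (lerD wy (le_trans yx zr)))//.
by move: r0; lra.
Qed.

End Decay.

(** * The Hölder representative *)

Section Representative.
Context {R : realType} {N : nat}.
Local Notation T := (BorelRN R N).
Variable mu : {sigma_finite_measure set T -> \bar R}.
Hypothesis hmu : lebesgue_on_boxes mu.

(* Compactness in its near-covering form, for the almost-everywhere filter. *)
Lemma ae_compact (K : set 'rV[R]_N) (Q : T -> Prop) : compact K ->
  (forall x, K x -> exists r : R, 0 < r /\ {ae mu, forall y : T, `|(y : 'rV[R]_N) - x| < r -> Q y}) ->
  {ae mu, forall y : T, K y -> Q y}.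
Proof.
move=> /compact_near_coveringP cov hQ.
have : {ae mu, forall y : T, K `<=` (fun x => y = x -> Q y)}.
  apply: (cov T (almost_everywhere mu) (fun y x => y = x -> Q y)) => x Kx.
  have [r [r0 hr]] := hQ x Kx.
  exists ([set x' | `|x' - x| < r], [set y : T | `|(y : 'rV[R]_N) - x| < r -> Q y]) => /=.
    split => //; apply/nbhs_ballP; exists r => //= y.
    by rewrite mx_norm_ball /ball_ /= distrC.
  by move=> [x' y] [/= h1 h2] yx; apply: h2; rewrite yx.
by apply: filterS => y h Ky; exact: h Ky erefl.
Qed.

Variable u : 'rV[R]_N -> R.

(** The supremum of these values is the essential lower limit of [u] at [x], defined at every point
    and unaffected by null sets. *)
Definition lower_values (x : 'rV[R]_N) : set R :=
  [set a | exists r : R, 0 < r /\ {ae mu, forall y : T, cube x r y -> a <= u y}].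

Definition lower_repr (x : 'rV[R]_N) : R := sup (lower_values x).

Lemma cube_ae_nonempty (x : 'rV[R]_N) r (P : T -> Prop) : 0 < r -> {ae mu, forall y, P y} ->
  exists y, cube x r y /\ P y.
Proof.
move=> r0 hP; apply: contrapT => /forallNP H.
have : (mu (cube x r) <= mu set0)%E.
  apply: ae_le_measure; [exact: measurable_cube|exact: measurable0|].
  by apply: filterS hP => y Py xy; apply: (H y).
by rewrite measure0 mu_cube ?(ltW r0)// lee_fin leNgt exprn_gt0// mulr_gt0.
Qed.

Lemma lower_repr_bounds (x y : 'rV[R]_N) r a b : `|y - x| < r ->
  {ae mu, forall z : T, cube x r z -> a <= u z <= b} -> a <= lower_repr y <= b.
Proof.
move=> yx hab; pose r' := r - `|y - x|; have r'0 : 0 < r' by rewrite subr_gt0.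
have sub : cube y r' `<=` cube x r.
  move=> z; rewrite /cube/= => zy; have -> : z - x = (z - y) + (y - x).
    by rewrite addrA subrK.
  by rewrite (le_trans (ler_normD _ _))// -lerBrDr.
have La : lower_values y a.
  exists r'; split => //; apply: filterS hab => z h zy.
  by case/andP: (h (sub _ zy)).
have ub : ubound (lower_values y) b.
  move=> a' [r1 [r10 h1]].
  have m0 : 0 < Num.min r1 r' by rewrite lt_min r10.
  have [z [zm [h2 h3]]] := cube_ae_nonempty y m0 (filterI h1 hab).
  rewrite /cube/= le_min in zm; case/andP: zm => zm1 zm2.
  apply: (le_trans (h2 zm1)); by case/andP: (h3 (sub _ zm2)).
apply/andP; split; first by apply: ub_le_sup => //; exists b.
by apply: ge_sup => //; exists a.
Qed.

Variables (K : set 'rV[R]_N) (r L t : R).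
Hypotheses (r0 : 0 < r) (L0 : 0 <= L) (t01 : 0 < t < 1) (cK : compact K).
Hypothesis decay : forall x, K x -> forall n, exists a b, b - a = L * t ^+ n /\
  {ae mu, forall z : T, cube x (r / 8 ^+ n) z -> a <= u z <= b}.

(** This takes the place of Lebesgue differentiation: around each point of [K], [u] and [lower_repr]
    lie in a common interval of length [L t^n], compactness makes this hold almost everywhere on
    [K], and countably many [n] force equality. *)
Lemma lower_repr_ae : {ae mu, forall x : T, K x -> u x = lower_repr x}.
Proof.
have H n : {ae mu, forall x : T, K x -> `|u x - lower_repr x| <= L * t ^+ n}.
  apply: ae_compact => // x Kx; have [a [b [ab hab]]] := decay Kx n.
  exists (r / 8 ^+ n); split; first by rewrite divr_gt0// exprn_gt0.
  apply: filterS (hab) => y h yx; have /andP[h1 h2] := h (ltW yx).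
  have /andP[h3 h4] := lower_repr_bounds yx hab.
  by rewrite -ab ler_norml; lra.
have {}H : {ae mu, forall x : T, forall n, K x -> `|u x - lower_repr x| <= L * t ^+ n}.
  exact: ae_foralln.
apply: filterS H => x h Kx; apply/eqP; rewrite -subr_eq0 -normr_le0.
apply: (@le0_of_geometric _ _ L t) => //; last by move=> k; exact: h.
by case/andP: t01 => /ltW -> ->.
Qed.

Lemma lower_repr_osc n x y : K x -> `|y - x| < r / 8 ^+ n -> `|lower_repr x - lower_repr y| <= L * t ^+ n.
Proof.
move=> Kx yx; have [a [b [ab h]]] := decay Kx n.
have /andP[h1 h2] := lower_repr_bounds yx h.
have xx : `|x - x| < r / 8 ^+ n by rewrite subrr normr0 divr_gt0// exprn_gt0.
have /andP[h3 h4] := lower_repr_bounds xx h.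
by rewrite -ab ler_norml; lra.
Qed.

End Representative.

(** The norm is an infimum and is used only through numbers strictly above it; this recovers the
    estimate at the norm itself, including norm [0]. *)
Lemma le_powR_limit {R : realType} (X B F e : R) : 0 < e -> 0 <= B -> 0 <= F ->
  (forall F', F < F' -> X <= B * F' `^ e) -> X <= B * F `^ e.
Proof.
move=> e0 B0 F0 H; rewrite leNgt; apply/negP => XB.
have [Bz|Bp] := eqVneq B 0.
  have := H (F + 1); rewrite ltrDl ltr01 => /(_ isT).
  by rewrite Bz !mul0r leNgt => /negP; apply; rewrite Bz mul0r in XB.
have {}Bp : 0 < B by rewrite lt_neqAle eq_sym Bp.
have XY : F `^ e < X / B by rewrite ltr_pdivlMr// mulrC.
have Y0 : 0 < X / B by apply: le_lt_trans XY; exact: powR_ge0.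
have FY : F < (X / B) `^ e^-1.
  have {1}-> : F = (F `^ e) `^ e^-1 by rewrite -powRrM divff ?gt_eqF// powRr1.
  by rewrite gt0_ltr_powR ?invr_gt0 ?nnegrE ?powR_ge0// ltW.
pose G := (X / B) `^ e^-1.
have /H : F < (F + G) / 2 by move: FY; rewrite -/G; lra.
have lt1 : ((F + G) / 2) `^ e < X / B.
  have -> : X / B = G `^ e by rewrite /G -powRrM mulVf ?gt_eqF// powRr1// ltW.
  rewrite gt0_ltr_powR ?nnegrE//; first by move: FY F0; rewrite -/G; lra.
    exact: powR_ge0.
  by move: FY; rewrite -/G; lra.
rewrite leNgt => /negP; apply.
by move: lt1; rewrite ltr_pdivlMr// mulrC.
Qed.

Lemma Linf_norm_ge0 {R : realType} {N : nat}
    (mu : {sigma_finite_measure set (BorelRN R N) -> \bar R}) (O : set 'rV[R]_N)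
    (f : 'rV[R]_N -> R) : Linf mu O f -> 0 <= Linf_norm mu O f.
Proof.
move=> [_ [M hM]]; apply: lb_le_inf; last by move=> x [].
exists (Num.max M 0); split; first by rewrite le_max lexx orbT.
by apply: filterS hM => x h Ox; rewrite le_max h.
Qed.

Lemma Linf_norm_ae {R : realType} {N : nat}
    (mu : {sigma_finite_measure set (BorelRN R N) -> \bar R}) (O : set 'rV[R]_N)
    (f : 'rV[R]_N -> R) (F : R) : Linf mu O f -> Linf_norm mu O f < F ->
  {ae mu, forall x : BorelRN R N, O x -> `|f x| <= F}.
Proof.
move=> [_ [M hM]] FL.
have hinf : has_inf [set M : R | 0 <= M /\
    {ae mu, forall x : BorelRN R N, O x -> `|f x| <= M}].
  split; last by exists 0 => x [].
  exists (Num.max M 0); split; first by rewrite le_max lexx orbT.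
  by apply: filterS hM => x h Ox; rewrite le_max h.
have d0 : 0 < F - Linf_norm mu O f by rewrite subr_gt0.
have [M' [_ hM'] M'F] := inf_adherent d0 hinf.
apply: filterS hM' => x h Ox; apply: (le_trans (h Ox)); apply: ltW.
by move: M'F; rewrite /Linf_norm addrCA subrr addr0.
Qed.

Lemma power_modulus {R : realType} (w L r d alpha : R) : 0 < r -> 0 < d -> 0 <= L ->
  0 <= alpha -> w <= L -> (forall n, d < r / 8 ^+ n -> w <= L * (8 `^ (- alpha)) ^+ n) ->
  w <= L * (16 / r) `^ alpha * d `^ alpha.
Proof.
move=> r0 d0 L0 al0 wL H.
have r16 : 0 <= 16 / r by rewrite divr_ge0// ltW.
rewrite -mulrA -powRM ?(ltW d0)//.
have [dr|rd] := leP (2 * d) r.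
  (* The factor [2] makes [d < r / 8^n] strict, and the upper bound gives [8^(-n) < 16 d / r]. When
     [2 d > r], [16 d / r] exceeds [1] and [w <= L] suffices. *)
  have [n /andP[n1 n2]] : exists n, 8%:R ^+ n <= r / (2 * d) < 8%:R ^+ n.+1.
    by apply: pow_bracket => //; rewrite ler_pdivlMr ?mulr_gt0// mul1r.
  have p8 : 0 < 8 ^+ n :> R by rewrite exprn_gt0.
  have dn : d < r / 8 ^+ n.
    rewrite ltr_pdivlMr//; move: n1; rewrite ler_pdivlMr ?mulr_gt0// => n1.
    by apply: (lt_le_trans _ n1); rewrite mulrC ltr_pM2l// ltr_pMl// ltr1n.
  apply: (le_trans (H n dn)); rewrite ler_wpM2l// -powR_exprn//.
  rewrite powRN -powR_inv1 ?powR_ge0// powRAC powR_inv1; last exact: ltW.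
  have i1 : 0 <= (8 ^+ n)^-1 :> R by rewrite invr_ge0 ltW.
  have i2 : 0 <= 16 / r * d by rewrite mulr_ge0// ltW.
  rewrite ge0_ler_powR ?nnegrE//.
  rewrite -[leLHS]mul1r ler_pdivrMr//.
  have -> : 16 / r * d * 8 ^+ n = 16 * d * 8 ^+ n / r by rewrite mulrAC; ring.
  rewrite ler_pdivlMr// mul1r.
  move: n2; rewrite exprS ltr_pdivrMr ?mulr_gt0// => /ltW/le_trans; apply.
  by rewrite le_eqVlt; apply/orP; left; apply/eqP; ring.
apply: (le_trans wL); rewrite ler_peMr// -[leLHS](powRr0 (16 / r * d)) ler_powR//.
by rewrite mulrAC ler_pdivlMr// mul1r; move: rd r0; lra.
Qed.

Theorem theorem1p1 (R : realType) (N : nat) (hN : (1 < N)%N)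
  (mu : {sigma_finite_measure set (BorelRN R N) -> \bar R})
  (hmu : lebesgue_on_boxes mu) (s p : R) (hs : 0 < s < 1) (hp : 1 < p) :
  exists alpha : R, 0 < alpha <= s /\
  forall O : set 'rV[R]_N, bounded_domain O -> C11_boundary O ->
  exists C : R, 0 < C /\
  forall f u : 'rV[R]_N -> R,
    Linf mu O f -> weak_solution mu p s O f u ->
    exists v : 'rV[R]_N -> R,
      {ae mu, forall x : BorelRN R N, O x -> u x = v x} /\
      exists M H : R,
        (forall x, closure O x -> `|v x| <= M) /\
        (forall x y, closure O x -> closure O y ->
           `|v x - v y| <= H * enorm (x - y) `^ alpha) /\
        M + H <= C * Linf_norm mu O f `^ (p - 1)^-1.
Proof.
have N0 : (0 < N)%N by exact: ltn_trans hN.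
have NR0 : 0 < N%:R :> R by rewrite ltr0n.
have s0 : 0 < s by case/andP: hs.
have p0 : 0 < p by exact: lt_trans hp.
have q0 : 0 < p - 1 by rewrite subr_gt0.
have c0 : 0 < (8 * N%:R ^+ 2)^-1 :> R by rewrite invr_gt0 mulr_gt0// exprn_gt0.
(* The exponent is fixed here, before the domain: the ratio [1 / (8 N^2)] involves only [N]. *)
have [alpha [k [als k0 decay]]] := oscillation_decay hmu N0 hs hp c0.
exists alpha; split => // O bO cO; have /andP[al0 _] := als.
have oO : open O by case: bO.
have [M0 [M00 OM]] : exists M0 : R, 0 < M0 /\ O `<=` cube 0 M0.
  have [_ [_ [_ [M hM]]]] := bO; exists (Num.max M 1); split.
    by rewrite lt_max ltr01 orbT.
  move=> x /hM h; rewrite /cube/= subr0 (le_trans (enorm_ge _))//.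
  by rewrite le_max h.
have cK : compact (closure O).
  by apply: (@compact_closure _ _ _ M0) => x /OM; rewrite /cube/= subr0.
have Ofin : (mu O < +oo)%E.
  have mO : measurable (O : set (BorelRN R N)) by exact: open_measurable_rV.
  apply: le_lt_trans (mu_cube_lty hmu 0 M0).
  apply: ae_le_measure; [exact: mO|exact: measurable_cube|by apply: aeW => x /OM].
have [c4 [c40 bounded]] := energy_solution_bounded hmu N0 s0 hp M00.
have [r [r0 alt]] := cube_alternative_closure N0 oO bO cO.
pose iq : R := (p - 1)^-1.
have iq0 : 0 < iq by rewrite invr_gt0.
have iqK (x : R) : 0 <= x -> (x `^ iq) `^ (p - 1) = x.
  by move=> x0; rewrite -powRrM mulVf ?gt_eqF// powRr1.
(* With [L = A F^iq], [A1] gives [c4 (L / 2)^(p-1) >= 2 F], as the sup bound requires, and [A2]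
   gives [(k L)^(p-1) r^(-ps) >= F], as the decay requires at scale [r]. *)
pose A1 : R := 2 * (2 / c4) `^ iq; pose A2 : R := (r `^ (p * s)) `^ iq / k.
have A10 : 0 < A1 by rewrite mulr_gt0// powR_gt0// divr_gt0.
have A20 : 0 < A2 by rewrite divr_gt0// !powR_gt0.
pose A := A1 + A2; have A0 : 0 < A by rewrite addr_gt0.
have r16 : 0 <= (16 / r) `^ alpha by exact: powR_ge0.
exists (A * (1 + (16 / r) `^ alpha)); split.
  by rewrite mulr_gt0// ltr_wpDr.
move=> f u hf hu.
have u0 : {ae mu, forall x : BorelRN R N, ~ O x -> u x = 0}.
  by case: hu => /W0_gagliardo[].
have norm0 : 0 <= Linf_norm mu O f by exact: Linf_norm_ge0.
have sol F : Linf_norm mu O f < F -> energy_solution mu p s O F u.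
  move=> fF; apply: weak_solution_energy hu => //; first by case: hf.
    exact: le_trans norm0 (ltW fF).
  exact: Linf_norm_ae hf fF.
have bnd F : Linf_norm mu O f < F ->
    {ae mu, forall x : BorelRN R N, `|u x| <= A * F `^ iq / 2}.
  move=> fF; have F0 : 0 < F by exact: le_lt_trans norm0 fF.
  have Fq : 0 < F `^ iq by rewrite powR_gt0.
  have L0 : 0 < A * F `^ iq / 2 by rewrite divr_gt0// mulr_gt0.
  have FL : F < c4 * (A * F `^ iq / 2) `^ (p - 1).
    apply: (@lt_le_trans _ _ (c4 * ((2 / c4) `^ iq * F `^ iq) `^ (p - 1))).
      rewrite powRM ?powR_ge0// !iqK ?divr_ge0 ?(ltW c40) ?(ltW F0)//.
      rewrite mulrA mulrCA divff ?gt_eqF// mulr1; move: F0; lra.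
    rewrite ler_pM2l// ge0_ler_powR ?nnegrE ?(ltW q0) ?(ltW L0) ?mulr_ge0 ?powR_ge0//.
    rewrite mulrAC ler_wpM2r ?(ltW Fq)// /A /A1; move: A20; lra.
  have u0N : {ae mu, forall x : BorelRN R N, ~ O x -> - u x = 0}.
    by apply: filterS u0 => x h Ox; rewrite h// oppr0.
  have h1 := bounded O F _ u oO OM (sol F fF) u0 L0 FL.
  have h2 := bounded O F _ _ oO OM (energy_solutionN (sol F fF)) u0N L0 FL.
  by apply: filterS2 h1 h2 => x h3 h4; rewrite ler_norml h3 lerNl h4.
have osc F : Linf_norm mu O f < F -> forall x, closure O x -> forall n, exists a b,
    b - a = A * F `^ iq * (8 `^ (- alpha)) ^+ n /\
    {ae mu, forall z : BorelRN R N, cube x (r / 8 ^+ n) z -> a <= u z <= b}.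
  move=> fF x cx; have F0 : 0 < F by exact: le_lt_trans norm0 fF.
  have Fq : 0 < F `^ iq by rewrite powR_gt0.
  apply: (decay O F) => //.
  - by rewrite mulr_gt0.
  - exact: sol.
  - exact: ltW.
  - apply: (@le_trans _ _ (((r `^ (p * s)) `^ iq * F `^ iq) `^ (p - 1) * r `^ (- (p * s)))).
      rewrite powRM ?powR_ge0// !iqK ?powR_ge0 ?(ltW F0)// powRN mulrAC divff ?mul1r//.
      by rewrite gt_eqF// powR_gt0.
    rewrite ler_wpM2r ?powR_ge0// ge0_ler_powR ?nnegrE ?(ltW q0) ?mulr_ge0 ?powR_ge0//.
    + exact: ltW.
    + exact: ltW.
    + rewrite mulrA ler_wpM2r ?(ltW Fq)// /A mulrDr.
      have -> : k * A2 = (r `^ (p * s)) `^ iq by rewrite /A2 mulrC divfK// gt_eqF.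
      by rewrite lerDr mulr_ge0 ?ltW.
  - exact: bnd.
  - by move=> t tr; exact: alt.
have f1 : Linf_norm mu O f < Linf_norm mu O f + 1 by rewrite ltrDl.
have t01 : 0 < 8 `^ (- alpha) < 1.
  rewrite powR_gt0//= powRN invf_lt1 ?powR_gt0//.
  have one : 1 `^ alpha = 1 :> R by rewrite powR1.
  by rewrite -[ltLHS]one gt0_ltr_powR// ?nnegrE//; lra.
(* [v] does not depend on [F]: the value [norm + 1] identifies it with [u], and the estimates for
   all [F] above the norm concern the same function, so [F] may tend to the norm. *)
pose v := lower_repr mu u.
have vbnd F x : Linf_norm mu O f < F -> `|v x| <= A * F `^ iq / 2.
  move=> fF; have := @lower_repr_bounds _ _ mu hmu u x x 1 (- (A * F `^ iq / 2)) (A * F `^ iq / 2).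
  rewrite subrr normr0 ler_norml; apply => //.
  by apply: filterS (bnd F fF) => z h _; rewrite -ler_norml.
exists v; split.
  have L0 : 0 <= A * (Linf_norm mu O f + 1) `^ iq by rewrite mulr_ge0 ?powR_ge0 ?ltW.
  have := lower_repr_ae hmu r0 L0 t01 cK (osc _ f1).
  by apply: filterS => x h Ox; apply: h; exact: subset_closure.
exists (A * Linf_norm mu O f `^ iq), (A * (16 / r) `^ alpha * Linf_norm mu O f `^ iq).
split; last split.
- move=> x _; apply: le_powR_limit => // [|F fF]; first exact: ltW.
  apply: (le_trans (vbnd F x fF)); rewrite ler_pdivrMr// ler_peMr ?ler1n//.
  by rewrite mulr_ge0 ?powR_ge0 ?ltW.
- move=> x y cx cy; rewrite mulrAC; apply: le_powR_limit => // [|F fF].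
    by rewrite !mulr_ge0 ?powR_ge0 ?ltW.
  have [->|xy] := eqVneq x y.
    by rewrite subrr normr0 !mulr_ge0 ?powR_ge0 ?ltW.
  have d0 : 0 < `|y - x| by rewrite normr_gt0 subr_eq0 eq_sym.
  have AF : 0 <= A * F `^ iq by rewrite mulr_ge0 ?powR_ge0 ?ltW.
  apply: (@le_trans _ _ (A * F `^ iq * (16 / r) `^ alpha * `|y - x| `^ alpha)).
    apply: power_modulus => //; first exact: ltW.
      have := vbnd F x fF; have := vbnd F y fF; rewrite !ler_norml.
      by move: (A * _) => L; lra.
    by move=> n yx; apply: (lower_repr_osc hmu r0 (osc F fF) cx).
  have -> : A * (16 / r) `^ alpha * enorm (x - y) `^ alpha * F `^ iq =
    A * F `^ iq * (16 / r) `^ alpha * enorm (x - y) `^ alpha by ring.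
  rewrite ler_wpM2l ?mulr_ge0 ?powR_ge0 ?(ltW A0)//.
  by rewrite ge0_ler_powR ?nnegrE ?enorm_ge0 ?(ltW al0)// enormB enorm_ge.
- by rewrite le_eqVlt; apply/orP; left; apply/eqP; rewrite /iq; ring.
Qed.
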